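(* Let $q \geq 5$ be an odd integer. Then there exists $n_0$ (depending on $q$) such that for all $n \geq n_0$ the following holds: if $G$ is any graph with $n$ vertices and exactly as many edges as the Turán graph $T_2(n)$, and $G$ is not isomorphic to $T_2(n)$, then $P_{T_2(n)}(q) > P_G(q)$, i.e. $T_2(n)$ has strictly more $q$-colorings than $G$.
   Context: All graphs are finite, undirected, without loops or multiple edges. For a positive integer $q$, $[q]=\{1,\dots,q\}$. A $q$-coloring of a graph $G$ is a function $f:V(G)\to[q]$ with $f(x)\neq f(y)$ for every edge $xy$ of $G$ (not all colors need be used), and $P_G(q)$ denotes the number of $q$-colorings of $G$. The Turán graph $T_2(n)$ is the complete bipartite graph on $n$ vertices with parts of sizes $\lfloor n/2\rfloor$ and $\lceil n/2\rceil$. *)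

(* Defs.v *)
From mathcomp Require Import all_boot.
Set Implicit Arguments.
Unset Strict Implicit.
Unset Printing Implicit Defensive.

Record sgraph := SGraph {
  vertex :> finType;
  adj : rel vertex;
  adj_sym : symmetric adj;
  adj_irrefl : irreflexive adj }.

(* An edge is an unordered pair, so each edge is counted once. *)
Definition edges (G : sgraph) : {set {set G}} :=
  [set e : {set G} | [exists x : G, exists y : G, adj x y && (e == [set x; y])]].

Definition isomorphic (G H : sgraph) : Prop :=
  exists2 f : G -> H, bijective f & forall x y : G, adj (f x) (f y) = adj x y.

(* The color set {1, ..., q} is represented by 'I_q = {0, ..., q - 1}. *)
Definition colorings (G : sgraph) (q : nat) : {set {ffun G -> 'I_q}} :=
  [set f : {ffun G -> 'I_q} |
    [forall x : G, forall y : G, adj x y ==> (f x != f y)]].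

Definition num_colorings (G : sgraph) (q : nat) : nat := #|colorings G q|.

Section CompleteBipartite.
Variables a b : nat.

Definition bip_adj : rel ('I_a + 'I_b)%type := fun u v =>
  match u, v with
  | inl _, inr _ | inr _, inl _ => true
  | _, _ => false
  end.

Lemma bip_adj_sym : symmetric bip_adj.
Proof. by case=> i [] j. Qed.

Lemma bip_adj_irrefl : irreflexive bip_adj.
Proof. by case. Qed.

Definition complete_bipartite : sgraph := SGraph bip_adj_sym bip_adj_irrefl.

End CompleteBipartite.

Definition turan2 (n : nat) : sgraph := complete_bipartite n./2 (uphalf n).

(* Main.v *)
(* Let [q = 2 k + 1]. A coloring of [T_2(n)] typically uses [k] colors on one side and the other
   [k + 1] on the other side, which gives about [(k (k + 1)) ^ (n / 2)] colorings.

   For an arbitrary [G] with as many edges, the color classes are independent sets, so by a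
   container argument the colorings are covered by [e ^ o(n)] assignments of color lists to
   vertices in which few edges join vertices with intersecting lists. Since [G] has about
   [n^2 / 4] edges, the lists [C], [D] of two random vertices then intersect with probability at
   most [1/2 + o(1)]. This probability is at least the mean of [|C n D| / sqrt (|C| |D|)], a
   positive semidefinite kernel, hence at least [E (sqrt |C|)^2 / q]; so an assignment with
   [(k (k + 1)) ^ (n / 2) / e ^ o(n)] colorings has nearly extremal [E (ln |C|)], and the stability
   of these inequalities shows that almost half of the lists are some [A] with [|A|] equal to [k]
   or [k + 1] and almost half are its complement. The number of colorings that do not arise from
   such assignments is negligible.

   If there is any other coloring, then outside a small set [Z] of vertices of low degree, [G] is
   close to bipartite with sides [V1], [V2], and all remaining colorings use [A] on [V1] and the
   complement of [A] on [V2], up to few deviating vertices. A deviating vertex deprives its many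
   neighbours on the other side of a color, so the number of these colorings is negligible too. In
   the colorings without deviation, the edges inside [V1] and [V2] cost powers of [k / (k + 1)].
   As the number of edges is that of [T_2(n)], these losses outweigh the freedom on [Z] and the
   imbalance of [V1] and [V2] by a constant factor, unless [Z] is empty and there are no such
   edges, that is, [G] is [T_2(n)]. *)
From mathcomp Require Import all_boot all_order all_algebra.
From mathcomp Require Import archimedean Rstruct.
From mathcomp Require Import reals topology normedtype derive realfun sequences exp.
From mathcomp Require Import ring lra zify.
Require Import Defs.
Set Implicit Arguments.
Unset Strict Implicit.
Unset Printing Implicit Defensive.

(** * Containers *)

Section Graph.
Variable G : sgraph.
Implicit Types (X Y S I : {set G}) (u v : G).

Definition nbhd v : {set G} := [set u | adj v u].
Definition deg_in X v := #|nbhd v :&: X|.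
(* Ordered pairs: [eb X X] counts every edge inside [X] twice. *)
Definition eb X Y := \sum_(u in X) deg_in Y u.
Definition nbhds S : {set G} := \bigcup_(v in S) nbhd v.
(** The set [S] is a fingerprint: it alone determines the container, so few small fingerprints mean
    few containers. *)
Definition container t S : {set G} :=
  [set v | (v \notin nbhds S) && (#|nbhd v :\: nbhds S| < t)].

Lemma in_nbhds S u : (u \in nbhds S) = [exists v in S, adj v u].
Proof.
apply/bigcupP/exists_inP => -[v vS]; first by rewrite inE; exists v.
by exists v; rewrite ?inE.
Qed.

(** The fingerprint is a largest subset of [I] whose neighbourhood has at least [t] vertices per
    element; since the neighbourhood fits into [G], the fingerprint is small. *)
Lemma container_exists t I : 0 < t -> (forall u v, u \in I -> v \in I -> ~~ adj u v) ->
  exists2 S : {set G}, t * #|S| <= #|G| & I \subset container t S.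
Proof.
move=> t0 indep.
pose P := [pred S : {set G} | (S \subset I) && (t * #|S| <= #|nbhds S|)].
have P0 : P set0 by rewrite /= sub0set cards0 muln0.
have [S /andP[SI tS] Smax] := @arg_maxnP _ set0 P (fun S : {set G} => #|S|) P0.
(* A vertex of [I] outside the container could be added to the maximal [S]. *)
exists S; first by apply: leq_trans tS (max_card _).
apply/subsetP => v vI; rewrite inE; apply/andP; split.
  rewrite in_nbhds; apply/exists_inP => -[u uS].
  by apply/negP/indep => //; apply: (subsetP SI).
rewrite ltnNge; apply/negP => tv.
have vS : v \notin S.
  apply: contraTN tv => vS; rewrite -ltnNge (_ : _ :\: _ = set0) ?cards0 //.
  by apply/eqP; rewrite setD_eq0; apply: bigcup_sup.
have : P (v |: S).
  rewrite /= subUset sub1set vI SI /= cardsU1 vS add1n mulnS addnC.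
  have -> : nbhds (v |: S) = nbhds S :|: (nbhd v :\: nbhds S).
    rewrite {1}/nbhds bigcup_setU big_set1 -/(nbhds S); apply/setP => x; rewrite !inE.
    by case: (x \in nbhds S); rewrite ?orbT ?orbF.
  rewrite cardsU (_ : _ :&: _ = set0) ?cards0 ?subn0 ?leq_add //.
  by apply/setP => x; rewrite !inE; case: (x \in nbhds S).
move/Smax => h; have : #|v |: S| <= #|S| := h.
by rewrite cardsU1 vS add1n ltnn.
Qed.

(** The container avoids [nbhds S], so the neighbours of [v] in it are among the fewer than [t] that
    lie outside [nbhds S]. *)
Lemma deg_container t S v : v \in container t S -> deg_in (container t S) v < t.
Proof.
rewrite inE => /andP[_]; apply: leq_ltn_trans; apply: subset_leq_card.
by apply/subsetP => u; rewrite !inE => /andP[-> /andP[->]].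
Qed.

Lemma ebE X Y : eb X Y = \sum_(u in X) \sum_(v in Y) adj u v.
Proof.
apply: eq_bigr => u _; rewrite /deg_in -sum1_card big_mkcond [RHS]big_mkcond.
by apply: eq_bigr => v _; rewrite !inE; case: (v \in Y); case: (adj u v).
Qed.

Lemma ebC X Y : eb X Y = eb Y X.
Proof.
rewrite !ebE exchange_big; apply: eq_bigr => u _; apply: eq_bigr => v _.
by rewrite adj_sym.
Qed.

Lemma eb_subset X X' Y Y' : X \subset X' -> Y \subset Y' -> eb X Y <= eb X' Y'.
Proof.
move=> sX sY; rewrite /eb [leqRHS](big_setID X) /= (setIidPr sX).
apply: leq_trans (leq_addr _ _); apply: leq_sum => u _.
by apply: subset_leq_card; apply: setIS.
Qed.

Lemma eb_setUl X X' Y : eb (X :|: X') Y <= eb X Y + eb X' Y.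
Proof.
rewrite /eb (big_setID X) /= setUK leq_add2l.
rewrite setDUl setDv set0U [leqRHS](big_setID X) /= [leqRHS]addnC; exact: leq_addr.
Qed.

Lemma eb_setUr X Y Y' : eb X (Y :|: Y') <= eb X Y + eb X Y'.
Proof. by rewrite ![eb X _]ebC eb_setUl. Qed.

Lemma eb_le X Y : eb X Y <= #|X| * #|Y|.
Proof.
rewrite -sum_nat_const; apply: leq_sum => u _.
by apply: subset_leq_card; apply: subsetIr.
Qed.

Lemma eb_container t S : eb (container t S) (container t S) <= #|G| * t.
Proof.
apply: (@leq_trans (\sum_(u in container t S) t)).
  by apply: leq_sum => u /deg_container /ltnW.
by rewrite sum_nat_const leq_mul2r max_card orbT.
Qed.

Lemma eb_edges : eb setT setT = 2 * #|edges G|.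
Proof.
pose D := [set p : G * G | adj p.1 p.2].
have -> : eb setT setT = #|D|.
  rewrite ebE pair_big /= -sum1_card [RHS]big_mkcond; apply: eq_big => [p|p _].
    by rewrite !inE.
  by rewrite inE; case: (adj _ _).
(* The fibre of [h] over an edge consists of its two orientations. *)
pose h (p : G * G) := [set p.1; p.2].
rewrite -sum1_card (partition_big h (mem (edges G))) /=; last first.
  by move=> p; rewrite !inE => pD; apply/existsP; exists p.1; apply/existsP; exists p.2; rewrite pD /=.
rewrite mulnC -sum_nat_const; apply: eq_bigr => e.
rewrite inE => /existsP[x /existsP[y /andP[xy /eqP ->]]].
rewrite sum1dep_card.
have nxy : x != y by apply: contraTneq xy => ->; rewrite adj_irrefl.
rewrite (_ : [set p | _] = [set (x, y); (y, x)]).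
  by rewrite cards2 xpair_eqE negb_and nxy.
apply/setP => -[u v]; rewrite !inE /h !xpair_eqE /=; apply/andP/orP.
  case=> uv /eqP exy.
  have : u \in [set x; y] by rewrite -exy set21.
  have : v \in [set x; y] by rewrite -exy set22.
  rewrite !inE => /orP[] /eqP ev /orP[] /eqP eu; subst.
  - by rewrite adj_irrefl in uv.
  - by right; rewrite !eqxx.
  - by left; rewrite !eqxx.
  - by rewrite adj_irrefl in uv.
by case=> /andP[/eqP -> /eqP ->]; [rewrite xy | rewrite adj_sym xy setUC].
Qed.

End Graph.

(** Each such set is the range of a map from ['I_m] to [option T], with [None] as padding for sets
    of fewer than [m] elements. *)
Lemma card_small_sets (T : finType) m :
  #|[set S : {set T} | #|S| <= m]| <= #|T|.+1 ^ m.
Proof.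
pose F (g : {ffun 'I_m -> option T}) : {set T} := [set x | [exists i, g i == Some x]].
apply: (@leq_trans #|F @: [set: {ffun 'I_m -> option T}]|).
  apply: subset_leq_card; apply/subsetP => S; rewrite inE => Sm.
  apply/imsetP; exists [ffun i : 'I_m => nth None (map Some (enum S)) i]; first by rewrite inE.
  apply/setP => x; rewrite inE; apply/idP/existsP => [xS|[i]].
    have xi : index x (enum S) < m.
      by apply: leq_trans Sm; rewrite cardE index_mem mem_enum.
    exists (Ordinal xi); rewrite ffunE /= (nth_map x) ?nth_index ?mem_enum //.
    by rewrite index_mem mem_enum.
  rewrite ffunE; have [l|l] := ltnP i (size (enum S)).
    rewrite (nth_map x) // => /eqP[<-].
    by rewrite -mem_enum mem_nth.
  by rewrite nth_default ?size_map.
by apply: leq_trans (leq_imset_card _ _) _; rewrite cardsT card_ffun card_option card_ord.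
Qed.

Section Lists.
Variables (G : sgraph) (q t : nat).

(** There is one fingerprint per color class. A coloring whose classes lie in the respective
    containers picks every color from these lists. *)
Definition clist (S : {ffun 'I_q -> {set G}}) (v : G) : {set 'I_q} :=
  [set i | v \in container t (S i)].

Lemma clist_exists (f : {ffun G -> 'I_q}) : 0 < t -> f \in colorings G q ->
  exists2 S : {ffun 'I_q -> {set G}}, (forall i, t * #|S i| <= #|G|) & f \in family (clist S).
Proof.
move=> t0; rewrite inE => /forallP fc.
have ex i : exists S : {set G}, (t * #|S| <= #|G|) && ([set v | f v == i] \subset container t S).
  have [u v|S hS sub] := @container_exists G t [set v | f v == i] t0.
    rewrite !inE => /eqP fu /eqP fv; apply/negP => uv.
    by have := implyP (forallP (fc u) v) uv; rewrite fu fv eqxx.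
  by exists S; rewrite hS.
exists [ffun i => xchoose (ex i)] => [i|].
  by rewrite ffunE; case/andP: (xchooseP (ex i)).
apply/familyP => v; rewrite inE ffunE; case/andP: (xchooseP (ex (f v))) => _ /subsetP; apply.
by rewrite inE.
Qed.

(** If the lists of two adjacent vertices share the color [i], the edge lies inside the container of
    [S i], which is sparse by [eb_container]. *)
Lemma eb_clist S :
  \sum_(u : G) \sum_(v : G) (adj u v && (clist S u :&: clist S v != set0)) <= q * (#|G| * t).
Proof.
apply: (@leq_trans (\sum_(i < q) eb (container t (S i)) (container t (S i)))); last first.
  rewrite -[X in _ <= X * _]card_ord -sum_nat_const; apply: leq_sum => i _.
  exact: eb_container.
under [leqRHS]eq_bigr => i _.
  rewrite ebE big_mkcond /=; under eq_bigr => u _. rewrite big_mkcond /=. over. over.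
rewrite [leqRHS]exchange_big /=; apply: leq_sum => u _.
apply: (@leq_trans (\sum_v \sum_(i < q) ((u \in container t (S i)) && (v \in container t (S i)) && adj u v))).
  apply: leq_sum => v _; have [uv|] := boolP (adj u v) => //=.
  have [//|/set0Pn[i]] := eqVneq (clist S u :&: clist S v) set0.
  rewrite in_setI ![i \in clist _ _]in_set => /andP[ui vi]; rewrite (bigD1 i) //= ui vi; exact: leq_addr.
rewrite exchange_big /=; apply: leq_sum => i _.
case: (u \in container t (S i)) => //=; last by rewrite big1.
by apply: leq_sum => v _; case: (v \in container t (S i)).
Qed.

End Lists.

(** * Colorings from lists *)

Section ProperLists.
Variables (V : finType) (r : rel V).
Hypothesis r_sym : symmetric r.
Hypothesis r_irr : irreflexive r.
Implicit Types (U : {set V}) (u v w : V).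

Definition rdeg U v := #|[set u in U | r v u]|.
Definition rsum U := \sum_(v in U) rdeg U v.

Section Colors.
Variables (q : nat) (L : V -> {set 'I_q}).

Definition proper_lists U : {set {ffun V -> 'I_q}} :=
  [set f in family (fun v => mem (L v)) |
    [forall u in U, forall v in U, r u v ==> (f u != f v)]].

Lemma proper_listsP U (f : {ffun V -> 'I_q}) : reflect ((forall v, f v \in L v) /\
   forall u v, u \in U -> v \in U -> r u v -> f u != f v) (f \in proper_lists U).
Proof.
rewrite inE; apply: (iffP andP) => -[h1 h2]; split.
- by move=> v; apply: (familyP h1).
- by move=> u v uU vU ruv; have := implyP (forall_inP (forall_inP h2 u uU) v vU) ruv.
- exact/familyP.
- by apply/forall_inP => u uU; apply/forall_inP => v vU; apply/implyP; apply: h2.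
Qed.

Definition upd (f : {ffun V -> 'I_q}) v c : {ffun V -> 'I_q} :=
  [ffun u => if u == v then c else f u].

(* Trading the color of [v] for an arbitrary color of its list is injective, and the color
   given up is missing from [w]. *)
Lemma proper_lists_step U v w : v \in U -> w \in U -> r v w -> L v = L w ->
  #|proper_lists U| * #|L v| <= #|proper_lists (U :\ v)| * #|L v|.-1.
Proof.
move=> vU wU rvw Lvw.
have wv : w != v by apply: contraTneq rvw => ->; rewrite r_irr.
pose D := [set p : {ffun V -> 'I_q} * 'I_q | (p.1 \in proper_lists U) && (p.2 \in L v)].
pose E := [set p : {ffun V -> 'I_q} * 'I_q | (p.1 \in proper_lists (U :\ v)) &&
   (p.2 \in L v :\ p.1 w)].
have -> : #|proper_lists U| * #|L v| = #|D|.
  rewrite -cardsX; apply: eq_card => -[f c]; by rewrite !inE.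
have -> : #|proper_lists (U :\ v)| * #|L v|.-1 = #|E|.
  rewrite -[RHS]sum1_card (eq_bigl (fun p => (p.1 \in proper_lists (U :\ v)) && (p.2 \in L v :\ p.1 w))).
    rewrite -(pair_big_dep (fun f => f \in proper_lists (U :\ v)) (fun f c => c \in L v :\ f w) (fun _ _ => 1)) /=.
    rewrite -sum_nat_const; apply: eq_bigr => f /proper_listsP[fL _].
    by rewrite sum1_card (cardsD1 (f w) (L v)) Lvw fL.
  by move=> p; rewrite inE.
pose h (p : {ffun V -> 'I_q} * 'I_q) := (upd p.1 v p.2, p.1 v).
have h_inj : {in D &, injective h}.
  move=> [f c] [g e] _ _ [/ffunP e1 e2]; congr (_, _).
    apply/ffunP => u; have := e1 u; rewrite !ffunE; case: eqVneq => [->|] //.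
  by have := e1 v; rewrite !ffunE eqxx.
rewrite -(card_in_imset h_inj); apply: subset_leq_card; apply/subsetP => p /imsetP[[f c]].
rewrite in_set => /andP[/= /proper_listsP[fL fU] cL] ->; rewrite in_set /=; apply/andP; split.
  apply/proper_listsP; split=> [u|u u'].
    by rewrite ffunE; case: eqVneq => [->|].
  rewrite !in_setD1 !ffunE => /andP[/negPf -> uU] /andP[/negPf -> u'U]; exact: fU.
by rewrite in_setD1 fL andbT ffunE (negPf wv) fU.
Qed.

End Colors.

Lemma rdegD1 U v u : r u v -> v \in U -> rdeg U u = (rdeg (U :\ v) u).+1.
Proof.
move=> ruv vU; rewrite /rdeg (cardsD1 v) inE vU ruv add1n; congr _.+1.
by apply: eq_card => x; rewrite !inE andbA.
Qed.

Lemma rdegD1_le U v u : rdeg U u <= (rdeg (U :\ v) u).+1.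
Proof.
rewrite /rdeg (cardsD1 v) -add1n leq_add ?leq_b1 //.
by apply: subset_leq_card; apply/subsetP => x; rewrite !inE => /and3P[-> -> ->].
Qed.

Lemma rsumD1 U v : v \in U -> rsum U = rsum (U :\ v) + 2 * rdeg U v.
Proof.
move=> vU; rewrite /rsum (big_setD1 v) //=.
have -> : \sum_(u in U :\ v) rdeg U u = rsum (U :\ v) + \sum_(u in U :\ v) r u v.
  rewrite /rsum -big_split; apply: eq_bigr => u _ /=.
  have [ruv|ruv] := boolP (r u v); first by rewrite (rdegD1 ruv vU) addn1.
  rewrite addn0 /rdeg; apply: eq_card => x; rewrite !inE.
  by case: (eqVneq x v) => [->|//]; rewrite (negPf ruv) /= andbF.
have -> : \sum_(u in U :\ v) r u v = rdeg U v.
  rewrite /rdeg -sum1_card big_mkcond [RHS]big_mkcond /=; apply: eq_bigr => u _.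
  rewrite !inE [r u v]r_sym; case: eqVneq => [->|_]; first by rewrite r_irr andbF.
  by case: (u \in U) => //=; case: (r v u).
by rewrite addnCA mul2n -addnn.
Qed.

(* Vertices of minimum positive degree are removed one at a time, each at the cost of a factor
   [K / K.+1]; [rsum U] is twice the number of edges and the degree of a removed vertex exceeds
   the number of later removals by at most one, whence [rsum U <= f * f.+1]. *)
Lemma forest_colorings U : exists f : nat,
  [/\ rsum U <= f * f.+1,
      forall d, (forall v, v \in U -> rdeg U v != 0 -> d <= rdeg U v) -> rsum U != 0 -> d <= f &
      forall (q K : nat) (L : V -> {set 'I_q}), (forall v, v \in U -> #|L v| <= K.+1) ->
        (forall u v, u \in U -> v \in U -> r u v -> L u = L v) ->
        #|proper_lists L U| * K.+1 ^ f <= (\prod_v #|L v|) * K ^ f].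
Proof.
have [n] := ubnP #|U|; elim: n U => // n IHn U; rewrite ltnS => Un.
have [U0|U1] := eqVneq (rsum U) 0.
  exists 0; split=> [|d _ //|q K L _ _]; first by rewrite U0.
  rewrite !expn0 !muln1; have -> : \prod_v #|L v| = #|family (fun v => mem (L v))|.
    by rewrite card_family foldrE big_map big_enum.
  by apply: subset_leq_card; apply/subsetP => f; rewrite inE => /andP[].
have [v0 v0P] : exists v0, (v0 \in U) && (rdeg U v0 != 0).
  apply/existsP; apply: contraNT U1; rewrite negb_exists => /forallP h.
  by rewrite /rsum big1 // => v vU; have := h v; rewrite vU /= negbK => /eqP.
have [v /andP[vU dv] vmin] := @arg_minnP _ v0 (fun v => (v \in U) && (rdeg U v != 0)) (rdeg U) v0P.
have Uv : #|U :\ v| < n by move: Un; rewrite (cardsD1 v) vU add1n.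
have [f [f1 f2 f3]] := IHn _ Uv.
(* If the minimum positive degree is at least 2, then after the removal of [v] the positive degrees
   are still at least [rdeg U v - 1], and a neighbour of [v] keeps an edge; the second clause of the
   induction hypothesis applies. *)
have degf : rdeg U v <= f.+1.
  have [d1|d2] := leqP (rdeg U v) 1; first exact: leq_trans d1 _.
  rewrite -ltnS -(ltn_predK d2) ltnS ltnS; apply: f2 => [u|].
    rewrite in_setD1 => /andP[uv uU] du; rewrite -ltnS (ltn_predK d2).
    apply: leq_trans (rdegD1_le U v u); apply: vmin; rewrite uU -lt0n /=.
    rewrite -lt0n in du; apply: leq_trans du _; apply: subset_leq_card.
    by apply/subsetP => x; rewrite !inE => /andP[/andP[_ ->] ->].
  have [w] : exists w, w \in [set u in U | r v u] by apply/set0Pn; rewrite -card_gt0; apply: ltnW.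
  rewrite inE => /andP[wU rvw].
  have wv : w \in U :\ v.
    by rewrite in_setD1 wU andbT; apply: contraTneq rvw => ->; rewrite r_irr.
  rewrite /rsum (big_setD1 w) //= -lt0n addn_gt0; apply/orP; left.
  have h : rdeg U v <= rdeg U w.
    by apply: vmin; rewrite wU (@rdegD1 U v) // r_sym.
  rewrite r_sym in rvw; move: h; rewrite [rdeg U w](rdegD1 rvw vU) => h.
  by rewrite -ltnS; apply: leq_trans d2 h.
exists f.+1; split.
(* [f * f.+1 + 2 * f.+1 = f.+1 * f.+2]. *)
- by rewrite (rsumD1 vU); nia.
- by move=> d h _; apply: leq_trans (h v vU dv) degf.
move=> q K L LK Lr.
have [w] : exists w, w \in [set u in U | r v u] by apply/set0Pn; rewrite -card_gt0 lt0n.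
rewrite inE => /andP[wU rvw].
have Lr' u u' : u \in U :\ v -> u' \in U :\ v -> r u u' -> L u = L u'.
  by rewrite !in_setD1 => /andP[_ uU] /andP[_ u'U]; apply: Lr.
have st := proper_lists_step vU wU rvw (Lr _ _ vU wU rvw).
have LK' u : u \in U :\ v -> #|L u| <= K.+1 by rewrite in_setD1 => /andP[_ /LK].
have {}f3 := f3 q K L LK' Lr'.
(* As [#|L v| <= K.+1], the ratio of [#|L v|.-1] to [#|L v|] is at most [K / K.+1]. *)
have key : #|proper_lists L U| * K.+1 <= #|proper_lists L (U :\ v)| * K.
  have [l0|l0] := posnP #|L v|.
    rewrite (_ : proper_lists L U = set0) ?cards0 //; apply/setP => g; rewrite [RHS]inE.
    apply/negP => /proper_listsP[/(_ v)]; by rewrite (cards0_eq l0) inE.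
  have := LK v vU; move: st l0; set x := #|proper_lists L U|; set z := #|proper_lists L _|.
  case: #|L v| => // l /= st _ lK.
  rewrite -(leq_pmul2r (ltn0Sn l)).
  rewrite mulnAC; apply: leq_trans (leq_mul st (leqnn _)) _.
  rewrite -!mulnA leq_mul2l; apply/orP; right; nia.
rewrite !expnS mulnA; apply: leq_trans (leq_mul key (leqnn _)) _.
by rewrite -mulnA mulnCA [leqRHS]mulnCA leq_mul2l f3 orbT.
Qed.

End ProperLists.

(** * Maximum cuts *)

Section MaxCut.
Variable G : sgraph.
Implicit Types (X Y Z S : {set G}) (u v : G).

Lemma eb_disjUl X Y Z : [disjoint X & Y] -> eb (X :|: Y) Z = eb X Z + eb Y Z.
Proof.
rewrite disjoint_sym => /setDidPl d.
by rewrite /eb (big_setID X) /= setUK setDUl setDv set0U d.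
Qed.

Lemma eb_disjUr X Y Z : [disjoint X & Y] -> eb Z (X :|: Y) = eb Z X + eb Z Y.
Proof. by move=> d; rewrite ![eb Z _]ebC eb_disjUl. Qed.

Lemma eb_split X S : X \subset S ->
  eb S S = eb X X + eb (S :\: X) (S :\: X) + 2 * eb X (S :\: X).
Proof.
move=> XS; have d : [disjoint X & S :\: X].
  by rewrite disjoint_sym disjoints_subset; apply: subsetDr.
have e : S = X :|: (S :\: X) by rewrite -[LHS](setID S X) (setIidPr XS).
by rewrite {1 2}e !(eb_disjUl _ d) !(eb_disjUr _ d) [eb (S :\: X) X]ebC; lia.
Qed.

Lemma eb_set1 v X : eb [set v] X = deg_in X v.
Proof. by rewrite /eb big_set1. Qed.

Lemma deg_inD1 v X : deg_in (X :\ v) v = deg_in X v.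
Proof.
apply: eq_card => u; rewrite !inE; case: eqVneq => [->|//].
by rewrite adj_irrefl.
Qed.

(** In a cut with the most crossing edges, moving one vertex to the other side is no improvement;
    and the more edges cross, the fewer are inside. *)
Lemma max_cut S : exists V1 : {set G}, [/\ V1 \subset S,
  forall v, v \in V1 -> deg_in V1 v <= deg_in (S :\: V1) v,
  forall v, v \in S :\: V1 -> deg_in (S :\: V1) v <= deg_in V1 v &
  forall X, X \subset S ->
    eb V1 V1 + eb (S :\: V1) (S :\: V1) <= eb X X + eb (S :\: X) (S :\: X)].
Proof.
pose P := [pred X : {set G} | X \subset S].
have P0 : P set0 by rewrite /= sub0set.
have [V1 /= V1S V1max] := @arg_maxnP _ set0 P (fun X : {set G} => eb X (S :\: X)) P0.
have {}V1max X : X \subset S -> eb X (S :\: X) <= eb V1 (S :\: V1) by move=> /V1max.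
exists V1; split=> // [v vV|v|X XS].
- have sub : V1 :\ v \subset S by apply: subset_trans V1S; apply: subsetDl.
  have := V1max _ sub.
  have d1 : [disjoint [set v] & V1 :\ v] by rewrite disjoints1 setD11.
  rewrite -{3}(setD1K vV) (eb_disjUl _ d1) eb_set1.
  have -> : S :\: (V1 :\ v) = [set v] :|: (S :\: V1).
    apply/setP => u; rewrite !inE; case: eqVneq => [->|] //=.
    by rewrite (subsetP V1S).
  have d2 : [disjoint [set v] & S :\: V1] by rewrite disjoints1 inE vV.
  by rewrite (eb_disjUr _ d2) [eb _ [set v]]ebC eb_set1 deg_inD1 leq_add2r.
- rewrite inE => /andP[vV vS].
  have sub : v |: V1 \subset S by rewrite subUset sub1set vS.
  have := V1max _ sub.
  have d1 : [disjoint [set v] & V1] by rewrite disjoints1.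
  rewrite (eb_disjUl _ d1) eb_set1.
  have -> : S :\: (v |: V1) = (S :\: V1) :\ v.
    by apply/setP => u; rewrite !inE negb_or andbA.
  have vD : v \in S :\: V1 by rewrite inE vV.
  have d2 : [disjoint [set v] & (S :\: V1) :\ v] by rewrite disjoints1 setD11.
  by rewrite deg_inD1 -{3}(setD1K vD) (eb_disjUr _ d2) [eb _ [set v]]ebC eb_set1 leq_add2r.
have := V1max X XS; have := eb_split XS; have := eb_split V1S; lia.
Qed.

Lemma eb_remove S : eb [set: G] [set: G] <= 2 * eb S [set: G] + eb (~: S) (~: S).
Proof.
rewrite (eb_split (subsetT S)) setTD.
have e : eb S [set: G] = eb S S + eb S (~: S).
  by rewrite -(eb_disjUr S) ?setUCr // disjoints_subset setCK.
by rewrite e; lia.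
Qed.

Lemma deg_in_le3 X Y Z v : X :|: Y :|: Z = [set: G] ->
  deg_in [set: G] v <= deg_in X v + deg_in Y v + #|Z|.
Proof.
move=> <-; rewrite /deg_in !setIUr.
apply: leq_trans (leq_card_setU _ _) _; apply: leq_add.
  exact: leq_card_setU.
by apply: subset_leq_card; apply: subsetIr.
Qed.

End MaxCut.

Lemma sqr_add_le (x z : nat) : (x + z) * (x + z) <= 2 * (x * x) + 2 * (z * z).
Proof. by have := nat_Cauchy x z; rewrite -!mulnn => -[h _]; lia. Qed.

(* Besides the imbalance [n2 - h'], the removals pay [C] times for each low-degree vertex. *)
Lemma forest_size_bound (n h h' s n1 n2 C f r : nat) :
  n = h + h' -> h <= h' <= h.+1 -> n1 + n2 + s = n -> n1 <= n2 ->
  8 * (C * C) * s <= n -> 4 * s <= n -> r <= f * f.+1 ->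
  8 * (h * h') <= 4 * r + s * n + 8 * (n1 * n2) ->
  (n2 - h') + C * s <= f.
Proof.
move=> nE hh sum n12 Cs s4 rf tot.
rewrite leqNgt; apply/negP => fx.
have sq := sqr_add_le (n2 - h') (C * s).
have cs2 : 8 * (C * s * (C * s)) <= n * s.
  have -> : 8 * (C * s * (C * s)) = 8 * (C * C) * s * s by ring.
  by rewrite leq_mul2r Cs orbT.
have ff : f * f.+1 < (n2 - h' + C * s) * (n2 - h' + C * s).
  apply: (@leq_ltn_trans (f * (n2 - h' + C * s))); first by rewrite leq_mul2l fx orbT.
  by rewrite ltn_mul2r fx (leq_ltn_trans _ fx).
(* If [f] were too small, [r <= f * f.+1] would be below the square of [n2 - h' + C * s], which is
   at most twice the sum of the two squares. *)
have rb : 4 * r < 8 * ((n2 - h') * (n2 - h')) + n * s.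
  by move: rf ff sq cs2; move: (n2 - h') (C * s) => x w; lia.
clear ff cs2 rf sq fx.
have [h2|h2] := leqP h' n2.
  pose x := n2 - h'; have xE : n2 = h' + x by rewrite /x; lia.
  have hE : h = n1 + s + x by lia.
  rewrite -/x in rb; clearbody x.
  have sh : s * n <= s * (2 * h') by rewrite leq_mul2l; apply/orP; right; lia.
  have xh : x * (n1 + s + x) <= x * h' by rewrite leq_mul2l; apply/orP; right; lia.
  rewrite xE hE in tot; move: tot rb sh xh; clear; lia.
(* The subtraction truncates: there is no imbalance to pay for, only low-degree vertices. *)
have e : n2 - h' = 0 by lia.
rewrite e in rb.
have sn : s * (3 * n) <= s * (8 * n2) by rewrite leq_mul2l; apply/orP; right; lia.
have key : (n1 + s) * n2 <= h * h'.
  pose z := h' - n2; have zE : h' = n2 + z by rewrite /z; lia.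
  have n1E : n1 + s = h + z by lia.
  have zz : z * n2 <= z * h by rewrite leq_mul2l; apply/orP; right; lia.
  rewrite n1E zE; move: zz; clear; lia.
have s0 : 0 < s by lia.
have n0 : 0 < s * n by rewrite muln_gt0 s0; lia.
move: key tot rb sn n0; clear; lia.
Qed.

Lemma expn_leS k e : k ^ e <= k.+1 ^ e.
Proof. by case: e => // e; rewrite leq_exp2r. Qed.

(** Divided by [k.+1 ^ f.+1], this says that the colorings following the cut fall short of the main
    Turan count by at least [1 / k.+1] of its smaller term. This surplus later absorbs the
    exponentially smaller errors. *)
Lemma color_count_bound (k q n h h' s n1 n2 C f r : nat) :
  0 < k -> n = h + h' -> h <= h' <= h.+1 -> n1 + n2 + s = n -> n1 <= n2 ->
  2 * q * k ^ C <= k.+1 ^ C ->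
  8 * (C * C) * s <= n -> 4 * s <= n -> r <= f * f.+1 -> (s = 0 -> 0 < f) ->
  8 * (h * h') <= 4 * r + s * n + 8 * (n1 * n2) ->
  q ^ s * (k ^ n1 * k.+1 ^ n2 + k.+1 ^ n1 * k ^ n2) * k ^ f * k.+1 + k.+1 ^ h * k ^ h' * k.+1 ^ f
  <= k.+1 ^ f.+1 * (k.+1 ^ h * k ^ h' + k ^ h * k.+1 ^ h').
Proof.
move=> k0 nE hh sum n12 qC Cs s4 rf f0 tot.
have fb := forest_size_bound nE hh sum n12 Cs s4 rf tot.
have [s0|s0] := posnP s.
  have fpos := f0 s0; move: fb sum; rewrite s0 muln0 !addn0 expn0 mul1n => fb sum.
  pose x := n2 - h'; have xE : n2 = h' + x by rewrite /x; lia.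
  have hE : h = n1 + x by lia.
  pose g := f - x; have fE : f = x + g by rewrite /g /x; lia.
  have t1 : k ^ n1 * k.+1 ^ n2 * k ^ f <= k ^ h * k.+1 ^ h' * k.+1 ^ f.
    have -> : k ^ n1 * k.+1 ^ n2 * k ^ f = k ^ n1 * k.+1 ^ h' * k ^ x * (k.+1 ^ x * k ^ g).
      by rewrite xE fE !expnD; ring.
    have -> : k ^ h * k.+1 ^ h' * k.+1 ^ f = k ^ n1 * k.+1 ^ h' * k ^ x * (k.+1 ^ x * k.+1 ^ g).
      by rewrite hE fE !expnD; ring.
    by rewrite !leq_mul2l expn_leS !orbT.
  (* Since [f] is positive, this term saves a factor [k / k.+1], which is exactly the surplus
     required. *)
  have t2 : k.+1 ^ n1 * k ^ n2 * k ^ f * k.+1 <= k.+1 ^ h * k ^ h' * k * k.+1 ^ f.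
    have fS : f = f.-1.+1 by rewrite prednK.
    have -> : k.+1 ^ n1 * k ^ n2 * k ^ f * k.+1 =
        k.+1 ^ n1 * k ^ h' * k * k.+1 * (k ^ x * k ^ f.-1).
      by rewrite xE fS /= expnS !expnD; ring.
    have -> : k.+1 ^ h * k ^ h' * k * k.+1 ^ f =
        k.+1 ^ n1 * k ^ h' * k * k.+1 * (k.+1 ^ x * k.+1 ^ f.-1).
      by rewrite hE fS /= expnS !expnD; ring.
    by rewrite leq_mul2l leq_mul ?expn_leS ?orbT.
  have -> : (k ^ n1 * k.+1 ^ n2 + k.+1 ^ n1 * k ^ n2) * k ^ f * k.+1 =
    k ^ n1 * k.+1 ^ n2 * k ^ f * k.+1 + k.+1 ^ n1 * k ^ n2 * k ^ f * k.+1 by ring.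
  have -> : k.+1 ^ f.+1 * (k.+1 ^ h * k ^ h' + k ^ h * k.+1 ^ h') =
    k ^ h * k.+1 ^ h' * k.+1 ^ f * k.+1 + k.+1 ^ h * k ^ h' * k * k.+1 ^ f
      + k.+1 ^ h * k ^ h' * k.+1 ^ f by rewrite expnS -addn1; ring.
  by rewrite leq_add2r leq_add // leq_mul2r t1 orbT.
pose x := n2 - h'; pose g := f - (x + C * s).
have fE : f = x + C * s + g by rewrite /g /x; lia.
(* For each low-degree vertex, [C] factors [k / k.+1] outweigh its [q] colors, and also the factor 2
   for the two orientations of the palette. *)
have q1 : 2 * q ^ s * k ^ (C * s) <= k.+1 ^ (C * s).
  rewrite !expnM; apply: leq_trans (_ : (2 * q * k ^ C) ^ s <= _); last by rewrite leq_exp2r.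
  rewrite !expnMn leq_mul2r leq_mul2r; apply/orP; right; apply/orP; right.
  by case: (s) s0 => // s' _; rewrite expnS leq_pmulr // expn_gt0.
have base : k ^ n1 * k.+1 ^ n2 * k ^ x <= k ^ h * k.+1 ^ h' * k.+1 ^ x.
  have [h2|h2] := leqP h' n2.
    have xE : n2 = h' + x by rewrite /x; lia.
    have n1x : n1 + x <= h by lia.
    have -> : k ^ n1 * k.+1 ^ n2 * k ^ x = k ^ (n1 + x) * k.+1 ^ h' * k.+1 ^ x.
      by rewrite xE !expnD; ring.
    by rewrite !leq_mul2r leq_pexp2l ?orbT.
  have -> : x = 0 by rewrite /x; lia.
  rewrite !expn0 !muln1 leq_mul // leq_pexp2l //; last exact: ltnW.
  lia.
have main : q ^ s * (2 * (k ^ n1 * k.+1 ^ n2)) * k ^ f <= k ^ h * k.+1 ^ h' * k.+1 ^ f.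
  have -> : q ^ s * (2 * (k ^ n1 * k.+1 ^ n2)) * k ^ f =
     (k ^ n1 * k.+1 ^ n2 * k ^ x) * (2 * q ^ s * k ^ (C * s)) * k ^ g.
    by rewrite fE !expnD; ring.
  have -> : k ^ h * k.+1 ^ h' * k.+1 ^ f =
     (k ^ h * k.+1 ^ h' * k.+1 ^ x) * k.+1 ^ (C * s) * k.+1 ^ g.
    by rewrite fE !expnD; ring.
  by apply: leq_mul (expn_leS _ _); apply: leq_mul base q1.
have sym : k.+1 ^ n1 * k ^ n2 <= k ^ n1 * k.+1 ^ n2.
  pose z := n2 - n1; have zE : n2 = n1 + z by rewrite /z; lia.
  rewrite zE !expnD [k ^ n1 * (_ * _)]mulnCA mulnA -!mulnA leq_mul2l.
  by rewrite leq_mul2l expn_leS !orbT.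
have two : k ^ n1 * k.+1 ^ n2 + k.+1 ^ n1 * k ^ n2 <= 2 * (k ^ n1 * k.+1 ^ n2).
  by rewrite mul2n -addnn leq_add2l.
rewrite [leqRHS]mulnDr [leqRHS]addnC leq_add //.
  apply: (@leq_trans (q ^ s * (2 * (k ^ n1 * k.+1 ^ n2)) * k ^ f * k.+1)).
    by rewrite leq_mul2r leq_mul2r leq_mul2l two !orbT.
  have -> : k.+1 ^ f.+1 * (k ^ h * k.+1 ^ h') = k ^ h * k.+1 ^ h' * k.+1 ^ f * k.+1.
    by rewrite expnSr; ring.
  by rewrite leq_mul2r main orbT.
by rewrite [leqLHS]mulnC leq_mul2r leq_pexp2l ?orbT.
Qed.

(** * Colorings near a bipartition *)

(** Union bound. *)
Lemma card_le_sum (T I : finType) (A : {pred T}) (J : {pred I}) (P : I -> {pred T}) :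
  (forall x, x \in A -> exists2 j, j \in J & x \in P j) ->
  (#|A| <= \sum_(j in J) #|P j|)%N.
Proof.
move=> cov; under eq_bigr do rewrite -sum1_card big_mkcond /=.
rewrite exchange_big -sum1_card /= [leqRHS](bigID (mem A)) /=.
apply: leq_trans (leq_addr _ _); apply: leq_sum => x /cov[j jJ xj].
by rewrite (bigD1 j) //= xj.
Qed.

(** * Recognizing the Turan graph *)

Lemma turan2_edges n : #|edges (turan2 n)| = n./2 * uphalf n.
Proof.
apply/eqP; rewrite -(eqn_pmul2l (isT : 0 < 2)) -eb_edges ebE; apply/eqP.
rewrite (eq_bigl xpredT) => [|u]; last by rewrite inE.
rewrite big_sumType /=.
have e1 (i : 'I_n./2) : \sum_(v in [set: turan2 n]) bip_adj (inl i) v = uphalf n.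
  rewrite (eq_bigl xpredT) => [|u]; last by rewrite inE.
  by rewrite big_sumType /= sum_nat_const muln0 add0n sum_nat_const muln1 card_ord.
have e2 (i : 'I_(uphalf n)) : \sum_(v in [set: turan2 n]) bip_adj (inr i) v = n./2.
  rewrite (eq_bigl xpredT) => [|u]; last by rewrite inE.
  by rewrite big_sumType /= addnC sum_nat_const muln0 add0n sum_nat_const muln1 card_ord.
rewrite (eq_bigr (fun=> uphalf n)) => [|i _]; last exact: e1.
rewrite [X in _ + X](eq_bigr (fun=> n./2)) => [|i _]; last exact: e2.
by rewrite !sum_nat_const !card_ord [uphalf n * _]mulnC mul2n addnn.
Qed.

Section Iso.
Variables (G : sgraph) (V1 V2 : {set G}).
Hypothesis dV : [disjoint V1 & V2].
Hypothesis VT : V1 :|: V2 = [set: G].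
Hypothesis in1 : eb V1 V1 = 0.
Hypothesis in2 : eb V2 V2 = 0.
Hypothesis ebV : eb V1 V2 = #|V1| * #|V2|.

Lemma eb0_adj (V : {set G}) u v : eb V V = 0 -> u \in V -> v \in V -> adj u v = false.
Proof.
rewrite ebE => /eqP; rewrite sum_nat_eq0 => /forall_inP h uV vV.
have := h u uV; rewrite sum_nat_eq0 => /forall_inP /(_ v vV).
by rewrite eqb0 => /negPf.
Qed.

Lemma complete_adj u v : u \in V1 -> v \in V2 -> adj u v.
Proof.
move=> uV vV.
have : \sum_(u in V1) \sum_(v in V2) ~~ adj u v = 0.
  apply/eqP; rewrite -(eqn_add2l (eb V1 V2)) addn0 {2}ebV ebE -big_split /=.
  rewrite (eq_bigr (fun=> #|V2|)) ?sum_nat_const // => x _.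
  rewrite -big_split /= (eq_bigr (fun=> 1)) ?sum1_card // => z _.
  by case: (adj x z).
move/eqP; rewrite sum_nat_eq0 => /forall_inP /(_ u uV).
by rewrite sum_nat_eq0 => /forall_inP /(_ v vV); rewrite eqb0 negbK.
Qed.

Lemma iso_bipartite a b : #|V1| = a -> #|V2| = b -> isomorphic G (complete_bipartite a b).
Proof.
move=> c1 c2.
pose g (x : complete_bipartite a b) : G := match x with
  | inl i => enum_val (cast_ord (esym c1) i) | inr j => enum_val (cast_ord (esym c2) j) end.
have g1 i : g (inl i) \in V1 by apply: enum_valP.
have g2 j : g (inr j) \in V2 by apply: enum_valP.
have g12 i j : g (inl i) <> g (inr j).
  by move=> e; have := g2 j; rewrite -e (disjointFr dV (g1 i)).
have gi : injective g.
  case=> x [] z => [|/g12 //|/esym/g12 //|]; by move=> /enum_val_inj/cast_ord_inj ->.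
have cG : #|G| = a + b.
  by rewrite -c1 -c2 -cardsUI VT (disjoint_setI0 dV) cards0 addn0 cardsT.
have gb : bijective g.
  by apply: inj_card_bij => //; rewrite card_sum !card_ord cG.
have [f gK fK] := gb; exists f; first by exists g.
have ag x z : adj (g x) (g z) = bip_adj x z.
  case: x => i; case: z => j /=.
  - exact: eb0_adj in1 (g1 i) (g1 j).
  - exact: complete_adj (g1 i) (g2 j).
  - by rewrite adj_sym; apply: complete_adj (g1 j) (g2 i).
  - exact: eb0_adj in2 (g2 i) (g2 j).
by move=> x z; rewrite -{2}(fK x) -{2}(fK z) ag.
Qed.

End Iso.

(** A bipartite graph with this many edges must have balanced sides, and then there is no room for a
    missing edge between them. *)
Lemma iso_turan2 (G : sgraph) (V1 V2 : {set G}) n :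
  [disjoint V1 & V2] -> V1 :|: V2 = [set: G] -> eb V1 V1 = 0 -> eb V2 V2 = 0 ->
  #|G| = n -> #|edges G| = #|edges (turan2 n)| -> isomorphic G (turan2 n).
Proof.
move=> dV VT i1 i2 Gn eG.
have cG : #|V1| + #|V2| = n by rewrite -cardsUI VT (disjoint_setI0 dV) cards0 addn0 cardsT.
have tot : 2 * eb V1 V2 = 2 * (n./2 * uphalf n).
  have := eb_edges G; rewrite -VT (eb_disjUl _ dV) !(eb_disjUr _ dV) i1 i2 [eb V2 V1]ebC eG.
  by rewrite turan2_edges addn0 add0n addnn !mul2n.
have {}tot : eb V1 V2 = n./2 * uphalf n by apply/eqP; rewrite -(eqn_pmul2l (isT : 0 < 2)) tot.
have le := eb_le V1 V2; rewrite tot in le.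
have nE : n = n./2 + uphalf n by rewrite addnC uphalf_half -addnA addnn odd_double_half.
have hh : n./2 <= uphalf n <= n./2.+1 by rewrite uphalf_half leq_addl -add1n leq_add2r leq_b1.
have sizes : (#|V1| = n./2 /\ #|V2| = uphalf n) \/ (#|V2| = n./2 /\ #|V1| = uphalf n).
  (* With [a = h - x] and [b = h' + x], the product is at most [h * h' - x * x], so [x] vanishes. *)
  have key a b : a <= b -> a + b = n -> n./2 * uphalf n <= a * b -> a = n./2 /\ b = uphalf n.
    move=> ab sum; move: nE hh; move: (n./2) (uphalf n) => h h' nE hh prod.
    pose x := h - a; have hE : h = a + x by rewrite /x; lia.
    have bE : b = h' + x by lia.
    have xh : x * x <= x * (h - a) by rewrite leq_mul2l; apply/orP; right; lia.
    have xx : x * a + x * x <= x * h' by rewrite -mulnDr leq_mul2l; apply/orP; right; lia.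
    have x0 : x * x = 0 by move: prod xx; rewrite hE bE; lia.
    have {}x0 : x = 0 by move/eqP: x0; rewrite muln_eq0 orbb => /eqP.
    by rewrite hE bE x0 !addn0.
  case/orP: (leq_total #|V1| #|V2|) => h; [left; apply: key | right; apply: key] => //.
    by rewrite addnC.
  by rewrite [leqRHS]mulnC.
case: sizes => -[c1 c2].
  by apply: (iso_bipartite dV VT i1 i2 _ c1 c2); rewrite tot c1 c2.
rewrite disjoint_sym in dV; rewrite setUC in VT.
by apply: (iso_bipartite dV VT i2 i1 _ c1 c2); rewrite ebC tot c1 c2.
Qed.

(** * Colorings that follow a cut exactly *)

Section MainCount.
Variables (G : sgraph) (k : nat) (Z V1 V2 : {set G}).
Local Notation q := k.*2.+1.
Hypothesis dV : [disjoint V1 & V2].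
Hypothesis VZ : V1 :|: V2 = ~: Z.

Definition respects (A : {set 'I_q}) (f : {ffun G -> 'I_q}) :=
  [forall v in V1, f v \in A] && [forall v in V2, f v \notin A].

Definition side (A : {set 'I_q}) (v : G) : {set 'I_q} :=
  if v \in V1 then A else if v \in V2 then ~: A else setT.

Lemma prod_three (F : G -> nat) (a b c : nat) :
  (forall v, v \in V1 -> F v = a) -> (forall v, v \in V2 -> F v = b) ->
  (forall v, v \in Z -> F v = c) ->
  \prod_v F v = a ^ #|V1| * b ^ #|V2| * c ^ #|Z|.
Proof.
move=> Fa Fb Fc; rewrite (bigID (mem V1)) /= (eq_bigr _ Fa) prod_nat_const.
rewrite [X in _ * X](bigID (mem V2)) /= mulnA; congr (_ * _ * _).
  rewrite (eq_bigl (mem V2)) => [|v]; first by rewrite (eq_bigr _ Fb) prod_nat_const.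
  by rewrite /= andbC; case vV : (v \in V2) => //=; rewrite (disjointFl dV vV).
rewrite (eq_bigl (mem Z)) => [|v]; first by rewrite (eq_bigr _ Fc) prod_nat_const.
by rewrite /= -negb_or -in_setU VZ in_setC negbK.
Qed.

(** Only edges within a side are kept: across the cut the lists are disjoint, and such edges are
    satisfied automatically. *)
Let r : rel G := fun u v => adj u v && ((u \in V1) == (v \in V1)).

Let r_sym : symmetric r.
Proof. by move=> u v; rewrite /r adj_sym eq_sym. Qed.

Let r_irr : irreflexive r.
Proof. by move=> u; rewrite /r adj_irrefl. Qed.

Let rsumE : rsum r (V1 :|: V2) = eb V1 V1 + eb V2 V2.
Proof.
rewrite /rsum (big_setID V1) /= setUK setDUl setDv set0U.
have /setDidPl -> : [disjoint V2 & V1] by rewrite disjoint_sym.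
congr (_ + _); apply: eq_bigr => v vV; apply: eq_card => u; rewrite !inE /r.
  rewrite vV; case uV : (u \in V1); rewrite /= ?andbT ?andbF //.
rewrite (disjointFl dV vV); case uV : (u \in V1); rewrite /= ?andbT ?andbF //.
  by rewrite (disjointFr dV uV) andbF.
by rewrite andbC.
Qed.

(** The edges inside the sides are handled by [forest_colorings]; its [f] does not depend on the
    palette, so one [f] serves all of them. *)
Lemma respects_count : exists f : nat,
  [/\ eb V1 V1 + eb V2 V2 <= f * f.+1,
      0 < eb V1 V1 + eb V2 V2 -> 0 < f &
      forall A : {set 'I_q}, #|A| <= k.+1 -> #|~: A| <= k.+1 ->
        #|[set g in colorings G q | respects A g]| * k.+1 ^ f <=
          #|A| ^ #|V1| * #|~: A| ^ #|V2| * q ^ #|Z| * k ^ f].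
Proof.
have [f [f1 _ f3]] := forest_colorings r_sym r_irr (V1 :|: V2).
rewrite rsumE in f1; exists f; split=> //.
  by case: (f) f1 => //; rewrite mul0n leqn0 => /eqP ->.
move=> A Ak Ak'.
have := f3 q k (side A) _ _.
rewrite (@prod_three (fun v => #|side A v|) #|A| #|~: A| q); first last.
- move=> v vZ; rewrite /side -[v \in V1]negbK -[v \in V2]negbK.
  have : v \notin V1 :|: V2 by rewrite VZ in_setC vZ.
  by rewrite in_setU negb_or => /andP[-> ->] /=; rewrite cardsT card_ord.
- by move=> v vV; rewrite /side (disjointFl dV vV) vV.
- by move=> v vV; rewrite /side vV.
move=> h; apply: leq_trans (h _ _) => [|v|u v].
- rewrite leq_mul2r; apply/orP; right; apply: subset_leq_card; apply/subsetP => g.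
  rewrite inE => /andP[gc /andP[/forall_inP g1 /forall_inP g2]].
  apply/proper_listsP; split=> [v|u v _ _ /andP[uv _]].
    rewrite /side; case: ifP => [/g1 //|_]; case: ifP => [/g2|]; rewrite in_set //.
  by move: gc; rewrite inE => /forallP /(_ u) /forallP /(_ v); rewrite uv.
- by rewrite /side in_setU; case: ifP => //= _ ->.
rewrite !in_setU /side /r => uU vU /andP[_ /eqP e]; move: uU vU; rewrite e.
by case: ifP => //= _ -> ->.
Qed.

Definition good (A : {set 'I_q}) := (#|A| == k) || (#|A| == k.+1).

(** Palettes of size [k] and of size [k.+1] are complements of each other, hence equally many. *)
Lemma sum_good (F : nat -> nat -> nat) :
  \sum_(A : {set 'I_q} | good A) F #|A| #|~: A| = 'C(q, k) * (F k k.+1 + F k.+1 k).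
Proof.
rewrite (bigID (fun A : {set 'I_q} => #|A| == k)) /= mulnDr.
have cC (A : {set 'I_q}) : #|~: A| = q - #|A| by rewrite cardsCs setCK card_ord.
congr (_ + _).
  rewrite (eq_big (mem [set A : {set 'I_q} | #|A| == k]) (fun=> F k k.+1)) => [|A|A /andP[_ /eqP Ak]].
  - by rewrite sum_nat_const card_draws card_ord.
  - by rewrite !inE /good; case: (#|A| == k); rewrite ?andbF.
  by rewrite cC Ak -addnn -addnS addKn.
rewrite (eq_big (mem [set A : {set 'I_q} | #|A| == k.+1]) (fun=> F k.+1 k)) => [|A|A /andP[]].
- rewrite sum_nat_const card_draws card_ord; congr (_ * _).
  by rewrite -(@bin_sub q k) -?addnn -?addnS ?addKn // leq_addr.
- rewrite !inE /good; case: eqVneq => [->|] /=; last by rewrite andbT.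
  by rewrite ltn_eqF.
by rewrite /good => /orP[/eqP ->|/eqP Ak _]; [rewrite eqxx | rewrite cC Ak subSS -addnn addnK].
Qed.

Lemma main_count : exists f : nat,
  [/\ eb V1 V1 + eb V2 V2 <= f * f.+1,
      0 < eb V1 V1 + eb V2 V2 -> 0 < f &
      #|[set g in colorings G q | [exists A, good A && respects A g]]| * k.+1 ^ f <=
      'C(q, k) * (q ^ #|Z| * (k ^ #|V1| * k.+1 ^ #|V2| + k.+1 ^ #|V1| * k ^ #|V2|) * k ^ f)].
Proof.
have [f [f1 f2 f3]] := respects_count; exists f; split=> //.
have cov g : g \in [set g in colorings G q | [exists A, good A && respects A g]] ->
   exists2 A, A \in [pred A | good A] & g \in [set g in colorings G q | respects A g].
  by rewrite inE => /andP[gc /existsP[A /andP[gA rA]]]; exists A => //; rewrite inE gc.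
have := card_le_sum cov.
rewrite -(leq_pmul2r (_ : 0 < k.+1 ^ f)) ?expn_gt0 // => h; apply: leq_trans h _.
rewrite big_distrl /=.
apply: (@leq_trans (\sum_(A : {set 'I_q} | good A) (#|A| ^ #|V1| * #|~: A| ^ #|V2| * q ^ #|Z| * k ^ f))).
  apply: leq_sum => A gA; apply: f3; first by case/orP: gA => /eqP ->.
  have -> : #|~: A| = q - #|A| by rewrite cardsCs setCK card_ord.
  by case/orP: gA => /eqP ->; rewrite -addnn ?subSS ?addnK -?addnS ?addKn.
rewrite (sum_good (fun a b => a ^ #|V1| * b ^ #|V2| * q ^ #|Z| * k ^ f)).
rewrite leq_mul2l; apply/orP; right.
by rewrite -mulnDl leq_mul2r -mulnDl mulnC leqnn orbT.
Qed.

End MainCount.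

(** Expand [(1 + M) ^ #|T|] over all subsets: a set of at most [J] elements contributes at least
    [M ^ (#|T| - J)]. For [J] small against [#|T|] and [M] large this is a subexponential bound. *)
Lemma card_small_sets_exp (T : finType) (J M : nat) : 0 < M ->
  #|[set D : {set T} | #|D| <= J]| * M ^ #|T| <= M.+1 ^ #|T| * M ^ J.
Proof.
move=> M0; rewrite -add1n.
have -> : (1 + M) ^ #|T| = \prod_(i : T) (1 + M) by rewrite prod_nat_const.
rewrite bigA_distr -sum1_card !big_distrl /= [leqRHS](bigID (mem [set D : {set T} | #|D| <= J])) /=.
apply: leq_trans (leq_addr _ _); rewrite [leqRHS](eq_bigl (mem [set D : {set T} | #|D| <= J])) //.
apply: leq_sum => D; rewrite inE mul1n => DJ.
have -> : \prod_i (if i \in D then 1 else M) = M ^ #|~: D|.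
  rewrite (bigID (mem D)) /= big1 ?mul1n => [|i ->//].
  rewrite -prod_nat_const; apply: eq_big => [i|i /negPf -> //].
  by rewrite in_setC.
by rewrite -expnD leq_pexp2l // -(cardsC D) addnC leq_add2l.
Qed.

Lemma cancel_power (P Q k g w : nat) :
  P * k.+1 ^ (w + g) <= Q * k ^ (w + g) -> P * k.+1 ^ w <= Q * k ^ w.
Proof.
rewrite !expnD !mulnA => h; rewrite -(leq_pmul2r (_ : 0 < k.+1 ^ g)) ?expn_gt0 //.
apply: leq_trans h _; rewrite leq_mul2l; apply/orP; right.
by case: (g) => // g'; rewrite leq_exp2r.
Qed.

(** * Colorings with a few deviating vertices *)

Section Deviants.
Variables (G : sgraph) (k : nat) (Z V1 V2 : {set G}).
Local Notation q := k.*2.+1.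
Hypothesis k0 : 0 < k.
Implicit Types (A : {set 'I_q}) (v : G).
Hypothesis dV : [disjoint V1 & V2].
Hypothesis VZ : V1 :|: V2 = ~: Z.
Variables (w J N : nat).
Hypothesis w1 : forall v, v \in V1 -> w <= deg_in V2 v.
Hypothesis w2 : forall v, v \in V2 -> w <= deg_in V1 v.
Hypothesis N1 : #|V1| <= N.
Hypothesis N2 : #|V2| <= N.

Definition deviants (A : {set 'I_q}) (f : {ffun G -> 'I_q}) : {set G} :=
  [set v in V1 | f v \notin A] :|: [set v in V2 | f v \in A].

Lemma deviants0 A f : (deviants A f == set0) = respects V1 V2 A f.
Proof.
apply/eqP/andP => [/setP h|[/forall_inP h1 /forall_inP h2]].
  split; apply/forall_inP => v vV; have := h v; rewrite !inE vV /=.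
    by case: (f v \in A).
  by case: (f v \in A) => //=; rewrite orbT.
apply/setP => v; rewrite !inE; case vV1 : (v \in V1); first by rewrite (disjointFr dV vV1) h1.
by case vV2 : (v \in V2) => //=; rewrite (negPf (h2 _ vV2)).
Qed.

(* The index [((A, D), (u, c))] stands for the colorings with palette [A] and deviant set [D]
   in which the vertex [u] of [D] has the color [c]; its neighbours then lose [c]. *)
Definition bad_lists (p : ({set 'I_q} * {set G}) * (G * 'I_q)) (v : G) : {set 'I_q} :=
  if v \in p.1.2 then setT
  else if adj p.2.1 v then side V1 V2 p.1.1 v :\ p.2.2 else side V1 V2 p.1.1 v.

Definition bad_index : {set ({set 'I_q} * {set G}) * (G * 'I_q)} :=
  [set p : ({set 'I_q} * {set G}) * (G * 'I_q) | [&& good p.1.1, #|p.1.2| <= J, p.2.1 \in p.1.2 &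
     ((p.2.1 \in V1) && (p.2.2 \notin p.1.1)) || ((p.2.1 \in V2) && (p.2.2 \in p.1.1))]].

Lemma card_bad_index : #|bad_index| <=
  2 ^ q * #|[set D : {set G} | #|D| <= J]| * (#|G| * q).
Proof.
have -> : 2 ^ q = #|{set 'I_q}| by rewrite -cardsT -powersetT card_powerset cardsT card_ord.
rewrite -[X in X * _ * _]cardsT -cardsX.
have -> : #|G| * q = #|[set: G * 'I_q]| by rewrite cardsT card_prod card_ord.
rewrite -cardsX; apply: subset_leq_card; apply/subsetP => -[[A D] [u c]].
by rewrite !inE /= => /and4P[_ -> _ _].
Qed.

Lemma card_side A v : good A -> 0 < #|side V1 V2 A v|.
Proof.
move=> gA; rewrite /side; case: ifP => _; first by case/orP: gA => /eqP ->.
case: ifP => _; last by rewrite cardsT card_ord.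
have -> : #|~: A| = q - #|A| by rewrite cardsCs setCK card_ord.
by case/orP: gA => /eqP ->; rewrite -addnn ?subSS ?addnK -?addnS ?addKn.
Qed.

Lemma side_le A v : good A -> v \notin Z -> #|side V1 V2 A v| <= k.+1.
Proof.
move=> gA vZ; have : v \in V1 :|: V2 by rewrite VZ in_setC.
rewrite in_setU /side; case: ifP => [_ _|_ /= ->]; first by case/orP: gA => /eqP ->.
have -> : #|~: A| = q - #|A| by rewrite cardsCs setCK card_ord.
by case/orP: gA => /eqP ->; rewrite -addnn ?subSS ?addnK -?addnS ?addKn.
Qed.

Lemma prod_side A : good A -> \prod_v #|side V1 V2 A v| <= (k * k.+1) ^ N * q ^ #|Z|.
Proof.
move=> gA; rewrite (@prod_three _ Z V1 V2 dV VZ _ #|A| #|~: A| q); first last.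
- move=> v vZ; have : v \notin V1 :|: V2 by rewrite VZ in_setC vZ.
  by rewrite in_setU negb_or /side => /andP[/negPf -> /negPf ->]; rewrite cardsT card_ord.
- by move=> v vV; rewrite /side (disjointFl dV vV) vV.
- by move=> v vV; rewrite /side vV.
rewrite leq_mul2r; apply/orP; right; rewrite expnMn.
have -> : #|~: A| = q - #|A| by rewrite cardsCs setCK card_ord.
case/orP: gA => /eqP ->; rewrite -addnn ?subSS ?addnK -?addnS ?addKn; last rewrite mulnC;
  by rewrite leq_mul // leq_pexp2l.
Qed.

(** The color [c] of the deviant [u] belongs to the palette of the opposite side, where [u] has at
    least [w - J] neighbours outside [D]; each of them loses [c] from a list of at most [k.+1]
    colors. Vertices of [D] are paid with a factor [q]. *)
Lemma prod_bad_lists p : p \in bad_index ->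
  (\prod_v #|bad_lists p v|) * k.+1 ^ (w - J) <=
  q ^ (J + #|Z|) * (k * k.+1) ^ N * k ^ (w - J).
Proof.
case: p => -[A D] [u c]; rewrite inE /= => /and4P[gA DJ uD uc].
pose V' := if u \in V1 then V2 else V1.
pose Nu := (nbhd u :&: V') :\: D.
have Nw : w - J <= #|Nu|.
  have : w <= #|nbhd u :&: V'|.
    rewrite /V'; case/orP: uc => /andP[uV _]; first by rewrite uV; apply: w1.
    by rewrite (disjointFl dV uV); apply: w2.
  rewrite /Nu cardsD => h; apply: leq_sub => //; apply: leq_trans DJ.
  by apply: subset_leq_card; apply: subsetIr.
apply: (@cancel_power _ _ k (#|Nu| - (w - J))); rewrite subnKC //.
have powNu x : x ^ #|Nu| = \prod_v (if v \in Nu then x else 1).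
  by rewrite -big_mkcond prod_nat_const.
apply: (@leq_trans (\prod_v ((if v \in D then q else 1) * #|side V1 V2 A v| *
    (if v \in Nu then k else 1)))); last first.
  rewrite !big_split /= -powNu -big_mkcond prod_nat_const leq_mul2r; apply/orP; right.
  by rewrite expnD -mulnA [q ^ #|Z| * _]mulnC leq_mul ?leq_pexp2l ?prod_side.
rewrite powNu -big_split /=; apply: leq_prod => v _.
rewrite /bad_lists /=; case: ifP => [vD|vD].
  have -> : (v \in Nu) = false by rewrite /Nu in_setD vD.
  by rewrite !muln1 cardsT card_ord leq_pmulr // card_side.
rewrite mul1n; case vN : (v \in Nu); last first.
  by rewrite !muln1; case: ifP => // _; apply: subset_leq_card; apply: subsetDl.
have : v \in V' by move: vN; rewrite /Nu in_setD in_setI => /and3P[].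
have auv : adj u v by move: vN; rewrite /Nu in_setD in_setI inE => /and3P[].
rewrite auv => vV'.
have cS : c \in side V1 V2 A v.
  move: vV'; rewrite /V' /side; case/orP: uc => /andP[uV cA].
    by rewrite uV => vV; rewrite (disjointFl dV vV) vV in_setC.
  by rewrite (disjointFl dV uV) => ->.
have vZ : v \notin Z.
  rewrite -in_setC -VZ in_setU; move: vV'; rewrite /V'; case: ifP => _ -> //.
  by rewrite orbT.
by have := side_le gA vZ; rewrite (cardsD1 c) cS add1n ltnS mulnS mulSn leq_add2r.
Qed.

Lemma deviant_count :
  #|[set f in colorings G q | [exists A, [&& good A, deviants A f != set0 & #|deviants A f| <= J]]]|
    * k.+1 ^ (w - J) <=
  2 ^ q * #|[set D : {set G} | #|D| <= J]| * (#|G| * q) *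
  (q ^ (J + #|Z|) * (k * k.+1) ^ N * k ^ (w - J)).
Proof.
have cov f : f \in [set f in colorings G q | [exists A, [&& good A, deviants A f != set0 & #|deviants A f| <= J]]] ->
    exists2 p, p \in bad_index & f \in family (fun v => mem (bad_lists p v)).
  rewrite inE => /andP[fc /existsP[A /and3P[gA /set0Pn[u uD] DJ]]].
  exists ((A, deviants A f), (u, f u)).
    by rewrite inE /= gA DJ uD /=; move: uD; rewrite !inE.
  apply/familyP => v; rewrite /bad_lists /=.
  case vD : (v \in deviants A f); first by rewrite !inE.
  have fs : f v \in side V1 V2 A v.
    move: vD; rewrite !inE /side; case: ifP => /= [_|_].
      by move=> /negbT; rewrite negb_or negbK => /andP[].
    by case: ifP => /= [_ /negbT|]; rewrite !inE.
  case: ifP => // auv; rewrite in_setD1 fs andbT.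
  move: fc; rewrite inE => /forallP /(_ v) /forallP /(_ u); rewrite adj_sym auv; exact.
have := card_le_sum cov.
rewrite -(leq_pmul2r (_ : 0 < k.+1 ^ (w - J))) ?expn_gt0 // => h; apply: leq_trans h _.
rewrite big_distrl /=; apply: (@leq_trans (#|bad_index| * (q ^ (J + #|Z|) * (k * k.+1) ^ N * k ^ (w - J)))).
  rewrite -sum_nat_const; apply: leq_sum => p pB.
  by rewrite card_family foldrE big_map big_enum /=; apply: prod_bad_lists.
by rewrite leq_mul2r card_bad_index orbT.
Qed.

End Deviants.

(** * Lower bound for complete bipartite graphs *)

Section Lower.
Variables (k a b : nat).
Local Notation q := k.*2.+1.
Let H := complete_bipartite a b.
Implicit Types (A B : {set 'I_q}).

Definition two_sided A B (x : H) : {set 'I_q} := if x is inl _ then A else B.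

Lemma card_two_sided A B : #|family (fun x => mem (two_sided A B x))| = #|A| ^ a * #|B| ^ b.
Proof.
rewrite card_family foldrE big_map big_enum big_sumType /=.
by rewrite !prod_nat_const !card_ord.
Qed.

(* The palette [A] is recovered from the coloring, so these sets are disjoint. *)
Definition onto_sided A : {set {ffun H -> 'I_q}} :=
  [set f in family (fun x => mem (two_sided A (~: A) x)) |
    A == [set f (inl i) | i in 'I_a]].

Lemma onto_sided_coloring A : onto_sided A \subset colorings H q.
Proof.
apply/subsetP => f; rewrite inE => /andP[/familyP fA _]; rewrite inE.
apply/forallP => x; apply/forallP => z; apply/implyP.
have := fA x; have := fA z; case: x => i; case: z => j //= fz fx _.
  by apply: contraTneq fz => <-; rewrite in_setC fx.
by apply: contraTneq fx => ->; rewrite in_setC fz.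
Qed.

Lemma onto_sided_sum (P : pred {set 'I_q}) : \sum_(A | P A) #|onto_sided A| <= num_colorings H q.
Proof.
rewrite /num_colorings -sum1_card.
under eq_bigr do rewrite -sum1_card big_mkcond /=.
rewrite exchange_big /= [leqRHS]big_mkcond /=; apply: leq_sum => f _.
pose A0 := [set f (inl i) | i in 'I_a].
case: ifP => fc; last first.
  rewrite big1 // => A _; case: ifP => // fA.
  by have := subsetP (onto_sided_coloring A) f fA; rewrite fc.
rewrite -big_mkcondr /= sum1_card -(cards1 A0); apply: subset_leq_card; apply/subsetP => A.
rewrite unfold_in /= => /andP[_]; rewrite inE => /andP[_ e]; by rewrite inE.
Qed.

(** A coloring with palettes [A] and [~: A] that is not onto [A] on the first side misses some color
    of [A] there; union bound over that color. *)
Lemma onto_sided_ge A : #|A| ^ a * #|~: A| ^ b <=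
  #|onto_sided A| + #|A| * (#|A|.-1 ^ a * #|~: A| ^ b).
Proof.
pose miss c := family (fun x => mem (two_sided (A :\ c) (~: A) x)).
have -> : #|A| * (#|A|.-1 ^ a * #|~: A| ^ b) = \sum_(c in A) #|miss c|.
  rewrite -sum_nat_const; apply: eq_bigr => c cA.
  by rewrite /miss card_two_sided (cardsD1 c A) cA.
rewrite -card_two_sided.
have cov f : f \in [predD (family (fun x => mem (two_sided A (~: A) x))) & onto_sided A] ->
    exists2 c, c \in A & f \in miss c.
  rewrite inE => /andP[fS fA]; move: fS; rewrite inE fA /= => fS.
  have sub : [set f (inl i) | i in 'I_a] \subset A.
    by apply/subsetP => c /imsetP[i _ ->]; exact: (familyP fA (inl i)).
  have [c cA cf] : exists2 c, c \in A & c \notin [set f (inl i) | i in 'I_a].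
    by apply/subsetPn; apply: contra fS => h; rewrite eqEsubset h sub.
  exists c => //; apply/familyP => -[i|j]; last exact: (familyP fA (inr j)).
  rewrite /= in_setD1 (familyP fA (inl i)) andbT.
  by apply: contraNneq cf => <-; apply: imset_f.
have := card_le_sum cov => h.
rewrite -[leqLHS](cardID (mem (onto_sided A))) leq_add //.
  by apply: subset_leq_card; apply/subsetP => f; rewrite inE => /andP[].
Qed.

(** The correction terms have bases [k.-1 * k.+1] and [k * k] per pair of opposite vertices, below
    the base [k * k.+1] of the main terms, so they are negligible for balanced sides. *)
Lemma bipartite_lower :
  'C(q, k) * (k ^ a * k.+1 ^ b + k.+1 ^ a * k ^ b) <=
  num_colorings H q + 'C(q, k) * (k * (k.-1 ^ a * k.+1 ^ b) + k.+1 * (k ^ a * k ^ b)).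
Proof.
rewrite -(sum_good k (fun x z => x ^ a * z ^ b)).
rewrite -[X in num_colorings _ _ + X](sum_good k (fun x z => x * (x.-1 ^ a * z ^ b))).
apply: (@leq_trans (\sum_(A : {set 'I_q} | good A) (#|onto_sided A| + #|A| * (#|A|.-1 ^ a * #|~: A| ^ b)))).
  by apply: leq_sum => A _; apply: onto_sided_ge.
by rewrite big_split leq_add2r /=; apply: onto_sided_sum.
Qed.

End Lower.

Import Order.TTheory GRing.Theory Num.Theory.
Import numFieldNormedType.Exports.
Local Open Scope ring_scope.

(** * A stability inequality for random color sets *)

Section LogBounds.
Variable R : realType.

Lemma mean_value_pos (f df : R -> R) (a b : R) : 0 < a -> a <= b ->
  (forall x : R, 0 < x -> is_derive x 1 f (df x)) ->
  exists2 c, a <= c <= b & f b - f a = df c * (b - a).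
Proof.
move=> a0 ab fd; have [||c] := @MVT_segment R f df a b ab.
- by move=> x; rewrite in_itv /= => /andP[/(lt_trans a0)/fd].
- apply: derivable_within_continuous => x; rewrite in_itv /= => /andP[ax _].
  by have [] := fd x (lt_le_trans a0 ax).
- by rewrite in_itv /=; exists c.
Qed.

(** The derivative of [s ^+ 2 / 2 - s * ln s] is [s - 1 - ln s], which is nonnegative. *)
Lemma mulr_ln_le (s : R) : 1 <= s -> s * ln s <= (s ^+ 2 - 1) / 2.
Proof.
move=> s1; pose f (x : R) := 2^-1 * x ^+ 2 - x * ln x.
have [x x0|c /andP[c1 _]] := @mean_value_pos f (fun x => x - 1 - ln x) 1 s ltr01 s1.
  have dl := is_derive1_ln x0.
  apply: is_derive_eq.
  rewrite /GRing.scale /=.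
  have : x * x^-1 = 1 by rewrite mulfV ?gt_eqF.
  move=> ->; lra.
rewrite /f ln1 => e.
have lnc : ln c <= c - 1 by rewrite -[X in ln X](subrK 1) addrC le_ln1Dx //; lra.
have : 0 <= (c - 1 - ln c) * (s - 1) by apply: mulr_ge0; lra.
lra.
Qed.

(** The derivative of [2 * x - x ^+ 2 / 2 - ln x] is [- (1 - x) ^+ 2 / x], which is nonpositive. *)
Lemma ln_le_quad (t : R) : 0 < t -> t <= 1 -> ln t <= (t - 1) - (1 - t) ^+ 2 / 2.
Proof.
move=> t0 t1; pose f (x : R) := 2 * x - 2^-1 * x ^+ 2 - ln x.
have [x x0|c /andP[ct c1]] := @mean_value_pos f (fun x => 2 - x - x^-1) t 1 t0 t1.
  have dl := is_derive1_ln x0.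
  apply: is_derive_eq.
  rewrite /GRing.scale /=.
  lra.
rewrite /f ln1 => e.
have c0 := lt_le_trans t0 ct.
have cV : c * c^-1 = 1 by rewrite mulfV ?gt_eqF.
have V0 : 0 < c^-1 by rewrite invr_gt0.
have : (2 - c - c^-1) = - c^-1 * (1 - c) ^+ 2 by field; rewrite gt_eqF.
have := sqr_ge0 (1 - c).
nra.
Qed.
End LogBounds.

Section Kernel.
Variables (R : rcfType) (T : finType).
Implicit Types C D : {set T}.

Definition rt C : R := Num.sqrt #|C|%:R.

Definition meets C D := C :&: D != set0.

(** This is the inner product of the normalized indicator vectors; it is 0 if one of the sets is
    empty, as division by 0 gives 0. *)
Definition cosine C D : R := #|C :&: D|%:R / (rt C * rt D).

Lemma rt_ge0 C : 0 <= rt C. Proof. exact: sqrtr_ge0. Qed.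

Lemma rt_gt0 C : C != set0 -> 0 < rt C.
Proof. by rewrite sqrtr_gt0 ltr0n card_gt0. Qed.

Lemma sqr_rt C : rt C ^+ 2 = #|C|%:R.
Proof. by rewrite sqr_sqrtr ?ler0n. Qed.

Lemma rt0 : rt set0 = 0.
Proof. by rewrite /rt cards0 sqrtr0. Qed.

Lemma card_div_rt C : #|C|%:R / rt C = rt C.
Proof.
have [->|C0] := eqVneq C set0; first by rewrite rt0 invr0 mulr0.
by rewrite -sqr_rt expr2 mulfK // gt_eqF // rt_gt0.
Qed.

Lemma meetsC C D : meets C D = meets D C.
Proof. by rewrite /meets setIC. Qed.

Lemma cosineC C D : cosine C D = cosine D C.
Proof. by rewrite /cosine setIC [rt C * _]mulrC. Qed.

Lemma cosine_ge0 C D : 0 <= cosine C D.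
Proof. by rewrite divr_ge0 ?mulr_ge0 ?rt_ge0. Qed.

Lemma cosine_id C : C != set0 -> cosine C C = 1.
Proof. by move=> C0; rewrite /cosine setIid -sqr_rt expr2 divff // mulf_neq0 // gt_eqF // rt_gt0. Qed.

Lemma cosine_eq0 C D : ~~ meets C D -> cosine C D = 0.
Proof. by rewrite negbK => /eqP CD; rewrite /cosine CD cards0 mul0r. Qed.

(** With [c = #|C|], the squared cosine of distinct sets is at most [c / (c + 1)], attained when [D]
    has one element more than [C]; and [4 * c * (c + 1) <= (2 * c + 1) ^ 2]. *)
Lemma cosine_neq C D : C != D -> (2 * #|C| + 2)%:R * cosine C D <= (2 * #|C| + 1)%:R.
Proof.
move=> CD.
have [->|C0] := eqVneq C set0.
  by rewrite /cosine set0I cards0 mul0r mulr0 ler0n.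
have [->|D0] := eqVneq D set0.
  by rewrite /cosine setI0 cards0 mul0r mulr0 ler0n.
rewrite /cosine mulrA ler_pdivrMr ?mulr_gt0 ?rt_gt0 //.
rewrite -(@ler_pXn2r _ 2) ?nnegrE ?mulr_ge0 ?rt_ge0 //.
rewrite !exprMn !sqr_rt -!natrX -!natrM ler_nat.
have nC : (#|C :&: D| <= #|C|)%N by rewrite subset_leq_card // subsetIl.
have nD : (#|C :&: D| <= #|D|)%N by rewrite subset_leq_card // subsetIr.
have cd : (#|C :&: D| < #|C|)%N || (#|C :&: D| < #|D|)%N.
  rewrite !ltn_neqAle nC nD !andbT -negb_and; apply: contra CD => /andP[/eqP e1 /eqP e2].
  have /eqP h1 : C :&: D == C by rewrite eqEcard subsetIl e1 /=.
  have /eqP h2 : C :&: D == D by rewrite eqEcard subsetIr e2 /=.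
  by apply/eqP; rewrite -[LHS]h1 h2.
have c0 : (0 < #|C|)%N by rewrite card_gt0.
move: nC nD cd c0; move: #|C :&: D| #|C| #|D| => n c d nc nd cd c0.
suff h : (n * n * (c + 1) <= c * c * d)%N.
  have -> : ((2 * c + 2) ^ 2 * n ^ 2 = 4 * (c + 1) * (n * n * (c + 1)))%N by ring.
  apply: leq_trans (leq_mul (leqnn _) h) _.
  have -> : ((2 * c + 1) ^ 2 * (c * d) = 4 * (c + 1) * (c * c * d) + c * d)%N by ring.
  exact: leq_addr.
have [e|nec] := eqVneq n c.
  have dc : (c + 1 <= d)%N by subst; lia.
  by rewrite e; apply: leq_mul.
have {}nc : (n <= c.-1)%N by lia.
apply: leq_trans (leq_mul (leq_mul nd nc) (leqnn _)) _.
have -> : (d * c.-1 * (c + 1) = d * (c.-1 * (c + 1)))%N by ring.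
rewrite [leqRHS]mulnC leq_mul2l; apply/orP; right; case: (c) c0 => // c' _; nia.
Qed.

Lemma cosine_le_meets C D : cosine C D <= (meets C D)%:R.
Proof.
have [m|/cosine_eq0->//] := boolP (meets C D).
have [CD|CD] := eqVneq C D.
  by rewrite CD cosine_id //; move: m; rewrite CD /meets setIid.
have := cosine_neq CD; rewrite !natrD addr0 /=; have := ler0n R #|C|; nra.
Qed.

Section Weights.
Variable a : {set T} -> R.
Hypothesis a0 : forall C, 0 <= a C.
Hypothesis a1 : \sum_C a C = 1.

(* The cosine is a positive semidefinite kernel below the intersection indicator [meets]; for
   [C], [D] drawn from [a], [tslack] is the mean difference of the two and the mean cosine is
   the sum of the squares of [cload]. *)
Definition meet_prob := \sum_C \sum_D a C * a D * (meets C D)%:R.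
Definition slack C := \sum_D a D * ((meets C D)%:R - cosine C D).
Definition tslack := \sum_C a C * slack C.
Definition cload (i : T) := \sum_(C : {set T}) (i \in C)%:R * (a C / rt C).
Definition mean_rt := \sum_C a C * rt C.
Definition corr C := \sum_D a D * cosine C D.

Lemma sum_cload : \sum_i cload i = mean_rt.
Proof.
rewrite exchange_big; apply: eq_bigr => C _ /=.
rewrite -mulr_suml -natr_sum.
have -> : (\sum_i (i \in C) = #|C|)%N by rewrite -sum1_card [RHS]big_mkcond; apply: eq_bigr => i _; case: (i \in C).
by rewrite mulrCA card_div_rt.
Qed.

Lemma corrE C : corr C = (\sum_(i in C) cload i) / rt C.
Proof.
rewrite exchange_big mulr_suml; apply: eq_bigr => D _ /=.
rewrite -mulr_suml -natr_sum /cosine.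
have -> : (\sum_(i in C) (i \in D) = #|C :&: D|)%N.
  rewrite -sum1_card big_mkcond [RHS]big_mkcond; apply: eq_bigr => i _ /=.
  by rewrite inE; case: (i \in C); case: (i \in D).
by rewrite invfM; ring.
Qed.

Lemma sum_corr : \sum_C a C * corr C = \sum_i cload i ^+ 2.
Proof.
transitivity (\sum_(C : {set T}) \sum_i cload i * ((i \in C)%:R * (a C / rt C))).
  apply: eq_bigr => C _; rewrite corrE big_mkcond mulr_suml mulr_sumr.
  by apply: eq_bigr => i _; case: (i \in C); rewrite /=; ring.
by rewrite exchange_big; apply: eq_bigr => i _; rewrite -mulr_sumr -expr2.
Qed.

Lemma meet_prob_split : meet_prob = tslack + \sum_i cload i ^+ 2.
Proof.
rewrite -sum_corr -big_split; apply: eq_bigr => C _ /=.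
rewrite -mulrDr -big_split mulr_sumr; apply: eq_bigr => D _ /=.
by ring.
Qed.

Lemma slack_ge0 C : 0 <= slack C.
Proof. by apply: sumr_ge0 => D _; rewrite mulr_ge0 // subr_ge0 cosine_le_meets. Qed.

(** By [cosine_neq], the cosine with any other set meeting [C] is at most [2 * #|C| + 1] times its
    distance from 1. Thus a set of small slack owes nearly all its correlation to its own weight. *)
Lemma corr_sub_le C : C != set0 -> corr C - a C <= (2 * #|C| + 1)%:R * slack C.
Proof.
move=> C0; rewrite /corr (bigD1 C) //= cosine_id // mulr1 addrAC subrr add0r.
rewrite /slack [X in _ * X](bigD1 C) //= cosine_id //.
rewrite {1}/meets setIid C0 subrr mulr0 add0r mulr_sumr; apply: ler_sum => D DC.
rewrite [leRHS]mulrCA ler_wpM2l //.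
have [m|/cosine_eq0->] := boolP (meets C D); last by rewrite subrr mulr0.
have := @cosine_neq C D; rewrite eq_sym DC => /(_ isT).
rewrite !natrD addr0 /=; lra.
Qed.

Lemma corr_ge C : a C * (C != set0)%:R <= corr C.
Proof.
have [->|C0] := eqVneq C set0.
  by rewrite mulr0 sumr_ge0 // => D _; rewrite mulr_ge0 ?cosine_ge0.
rewrite /corr (bigD1 C) //= cosine_id // lerDl sumr_ge0 // => D _.
by rewrite mulr_ge0 ?cosine_ge0.
Qed.

Lemma double_sum_split (w : {set T} -> {set T} -> R) (S : pred {set T}) :
  (forall C D, w C D = w D C) ->
  \sum_C \sum_D a C * a D * w C D =
  \sum_(C | S C) \sum_(D | S D) a C * a D * w C D +
  2 * (\sum_(C | ~~ S C) a C * \sum_(D | S D) a D * w C D) +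
  \sum_(C | ~~ S C) \sum_(D | ~~ S D) a C * a D * w C D.
Proof.
move=> wC.
pose B (X Y : pred {set T}) := \sum_(C | X C) \sum_(D | Y D) a C * a D * w C D.
have Bsplit X : \sum_(C | X C) \sum_D a C * a D * w C D = B X S + B X (predC S).
  rewrite -big_split; apply: eq_bigr => C _ /=.
  by rewrite (bigID S).
have BC : B S (predC S) = B (predC S) S.
  rewrite /B exchange_big /=; apply: eq_bigr => C _; apply: eq_bigr => D _.
  by rewrite wC; ring.
have B2 : B (predC S) S = \sum_(C | ~~ S C) a C * \sum_(D | S D) a D * w C D.
  by apply: eq_bigr => C _; rewrite mulr_sumr; apply: eq_bigr => D _; rewrite mulrA.
rewrite (bigID S) /= !Bsplit BC -B2 /B /=; ring.
Qed.

(** The pairs within [S] and those outside [S] contribute nonnegative amounts; the mixed pairs occur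
    in both orders. *)
Lemma tslack_ge (S : pred {set T}) :
  2 * (\sum_(C | ~~ S C) a C * \sum_(D | S D) a D * ((meets C D)%:R - cosine C D))
  <= tslack.
Proof.
have -> : tslack = \sum_C \sum_D a C * a D * ((meets C D)%:R - cosine C D).
  by apply: eq_bigr => C _; rewrite mulr_sumr; apply: eq_bigr => D _; rewrite mulrA.
rewrite (double_sum_split S) => [|C D]; last by rewrite meetsC cosineC.
have p (X Y : pred {set T}) :
    0 <= \sum_(C | X C) \sum_(D | Y D) a C * a D * ((meets C D)%:R - cosine C D).
  apply: sumr_ge0 => C _; apply: sumr_ge0 => D _.
  by rewrite !mulr_ge0 // subr_ge0 cosine_le_meets.
have := p S S; have := p (predC S) (predC S) => /=; lra.
Qed.

Lemma tslack_ge1 A : A != set0 -> 2 * (a A * slack A) <= tslack.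
Proof.
move=> A0; apply: le_trans (tslack_ge (pred1 A)); rewrite ler_pM2l ?ltr0n //.
rewrite mulr_sumr (bigD1 A) //= cosine_id // /meets setIid A0 subrr !mulr0 add0r.
rewrite le_eqVlt; apply/orP; left; apply/eqP; apply: eq_bigr => C _.
by rewrite big_pred1_eq -[_ != set0]/(meets _ _) -[in RHS]/(meets _ _) meetsC cosineC; ring.
Qed.

Lemma sqr_sum_le (C : {set T}) (f : T -> R) :
  (\sum_(i in C) f i) ^+ 2 <= #|C|%:R * \sum_(i in C) f i ^+ 2.
Proof.
have [->|C0] := eqVneq C set0; first by rewrite !big_set0 expr2 mul0r mulr0.
have c0 : 0 < #|C|%:R :> R by rewrite ltr0n card_gt0.
set S := \sum_(i in C) f i; set Q := \sum_(i in C) f i ^+ 2.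
have : 0 <= \sum_(i in C) (#|C|%:R * f i - S) ^+ 2 by apply: sumr_ge0 => i _; apply: sqr_ge0.
have -> : \sum_(i in C) (#|C|%:R * f i - S) ^+ 2 = #|C|%:R * (#|C|%:R * Q - S ^+ 2).
  rewrite /Q mulr_sumr; transitivity (\sum_(i in C)
    (#|C|%:R * (#|C|%:R * f i ^+ 2) + (- 2 * #|C|%:R * S) * f i + S ^+ 2)).
    by apply: eq_bigr => i _; ring.
  rewrite !big_split /= -!mulr_sumr -/S sumr_const -[_ *+ _]mulr_natl; ring.
by rewrite pmulr_rge0 // subr_ge0.
Qed.

Definition cload_mean := mean_rt / #|T|%:R.
Definition cload_var := \sum_i (cload i - cload_mean) ^+ 2.

Hypothesis T0 : (0 < #|T|)%N.

Lemma sum_cload_sqr : \sum_i cload i ^+ 2 = mean_rt ^+ 2 / #|T|%:R + cload_var.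
Proof.
have t0 : #|T|%:R != 0 :> R by rewrite pnatr_eq0 -lt0n.
transitivity (\sum_i ((cload i - cload_mean) ^+ 2 + 2 * cload_mean * cload i - cload_mean ^+ 2)).
  by apply: eq_bigr => i _; ring.
rewrite !big_split /= -mulr_sumr sum_cload -/cload_var sumr_const -[_ *+ _]mulr_natl.
rewrite /cload_mean; by field.
Qed.

(** The difference is the sum over [C] of the deviations of the loads from their mean, divided by
    [rt C]; Cauchy-Schwarz. *)
Lemma corr_dev C : (corr C - cload_mean * rt C) ^+ 2 <= cload_var.
Proof.
have [->|C0] := eqVneq C set0.
  rewrite corrE rt0 invr0 !mulr0 subrr expr2 mul0r.
  by apply: sumr_ge0 => i _; apply: sqr_ge0.
have -> : corr C - cload_mean * rt C = (\sum_(i in C) (cload i - cload_mean)) / rt C.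
  rewrite corrE sumrB sumr_const -[_ *+ _]mulr_natl mulrBl.
  by rewrite [#|C|%:R * _ / _]mulrAC card_div_rt [rt C * _]mulrC.
rewrite exprMn exprVn sqr_rt ler_pdivrMr ?ltr0n ?card_gt0 // mulrC.
apply: le_trans (sqr_sum_le _ _) _; rewrite ler_wpM2l ?ler0n //.
rewrite /cload_var [leRHS](bigID (mem C)) /= lerDl.
by apply: sumr_ge0 => i _; apply: sqr_ge0.
Qed.

End Weights.
End Kernel.

(** * Numerical estimates *)

Section Scalars.
Variable R : realType.
Implicit Types t y : R.

(** For [t] the normalized root of a list size, the bounds [lo], [midl], [midr], [hi] treat the
    sizes below [k], equal to [k], equal to [k.+1], and above. The difference of the constants
    [68 / 100] and [1 / 10] is the penalty for non-optimal sizes. *)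
Lemma ln_dev_lo t y : 0 < t -> 0 <= y -> t ^+ 2 <= 1 - 3 * y ->
  68 / 100 * y ^+ 2 <= t - 1 - ln t.
Proof.
move=> t0 y0 ty; have t1 : t <= 1 - 3 / 2 * y by have := sqr_ge0 (t - 1); nra.
have := @ln_le_quad R t t0; rewrite (le_trans t1) //; last lra.
move=> /(_ isT); nra.
Qed.

Lemma ln_dev_midl t y : 0 < t -> 0 <= y -> t ^+ 2 = 1 - y ->
  10^-1 * y ^+ 2 <= t - 1 - ln t.
Proof.
move=> t0 y0 ty; have t1 : t <= 1 - y / 2 by have := sqr_ge0 (t - 1); nra.
have := @ln_le_quad R t t0; rewrite (le_trans t1) //; last lra.
move=> /(_ isT); nra.
Qed.

Lemma ln_dev_ge t (c : R) : 1 <= t -> c * t <= (t - 1) ^+ 2 -> c / 2 <= t - 1 - ln t.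
Proof.
move=> t1 ct; have t0 : 0 < t by lra.
have := mulr_ln_le t1 => h; rewrite -(ler_pM2l t0); lra.
Qed.

Lemma ln_dev_hi t y : 0 < t -> 0 <= y -> y <= 1 / 5 -> 1 + 3 * y <= t ^+ 2 ->
  68 / 100 * y ^+ 2 <= t - 1 - ln t.
Proof.
move=> t0 y0 y5 ty; have t1 : 1 + 132 / 100 * y <= t.
  rewrite leNgt; apply/negP => h.
  have : t * t < (1 + 132 / 100 * y) * (1 + 132 / 100 * y) by nra.
  nra.
have := @ln_dev_ge t (136 / 100 * y ^+ 2).
suff h : 136 / 100 * y ^+ 2 * t <= (t - 1) ^+ 2.
  have t1' : 1 <= t by lra.
  by move=> /(_ t1' h); lra.
pose u := t - (1 + 132 / 100 * y); have u0 : 0 <= u by rewrite /u; lra.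
have -> : t = u + (1 + 132 / 100 * y) by rewrite /u; ring.
have y2 : 0 <= y ^+ 2 by apply: sqr_ge0.
have : y ^+ 2 * y <= y ^+ 2 / 5 by nra.
have : y ^+ 2 * u <= y * u by rewrite ler_wpM2r //; nra.
have := mulr_ge0 y0 u0; have := sqr_ge0 u; lra.
Qed.

Lemma ln_dev_midr t y : 0 < t -> 0 <= y -> y <= 1 / 5 -> t ^+ 2 = 1 + y ->
  10^-1 * y ^+ 2 <= t - 1 - ln t.
Proof.
move=> t0 y0 y5 ty; have t1 : 1 + 477 / 1000 * y <= t.
  rewrite leNgt; apply/negP => h.
  have : t * t < (1 + 477 / 1000 * y) * (1 + 477 / 1000 * y) by nra.
  nra.
have := @ln_dev_ge t (2 / 10 * y ^+ 2).
suff h : 2 / 10 * y ^+ 2 * t <= (t - 1) ^+ 2.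
  have t1' : 1 <= t by lra.
  by move=> /(_ t1' h); lra.
pose u := t - (1 + 477 / 1000 * y); have u0 : 0 <= u by rewrite /u; lra.
have -> : t = u + (1 + 477 / 1000 * y) by rewrite /u; ring.
have y2 : 0 <= y ^+ 2 by apply: sqr_ge0.
have : y ^+ 2 * y <= y ^+ 2 / 5 by nra.
have : y ^+ 2 * u <= y / 5 * u by rewrite ler_wpM2r //; nra.
have := mulr_ge0 y0 u0; have := sqr_ge0 u; lra.
Qed.

Lemma ln_1Bsqr y : 0 <= y -> y <= 1 / 5 -> - ln (1 - y ^+ 2) <= 1022 / 1000 * y ^+ 2.
Proof.
move=> y0 y5; set z := y ^+ 2; have z0 : 0 <= z by apply: sqr_ge0.
have z1 : z <= 1 / 25 by rewrite /z; nra.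
have z2 : 0 < 1 - z by lra.
have s1 : 1 <= (1 - z)^-1 by rewrite invr_ge1 ?unitfE ?gt_eqF //; lra.
have := mulr_ln_le s1; rewrite lnV ?posrE //.
rewrite -(ler_pM2l z2) mulrA divff ?gt_eqF // mul1r.
rewrite -(ler_pM2l z2) => h; rewrite -(ler_pM2l z2); apply: le_trans h _.
have -> : (1 - z) * ((1 - z) * (((1 - z)^-1 ^+ 2 - 1) / 2)) = (1 - (1 - z) ^+ 2) / 2.
  by field; rewrite gt_eqF.
nra.
Qed.

Lemma quad_light t y : 0 <= t -> 0 <= y -> y <= 1 / 5 -> 2 * y <= t ^+ 2 -> t ^+ 2 <= 2 ->
  28 / 100 * (t ^+ 2 + y) <= 494 / 1000 * t - 395 / 1000 * y.
Proof.
move=> t0 y0 y5 ty t2.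
have t3 : t <= 1415 / 1000 by rewrite leNgt; apply/negP => h; nra.
have [t4|t4] := lerP t (8 / 10); nra.
Qed.

(** Here [x], [z] are the weights of the two main sets and [rA], [rB], [rX] those of their proper
    subsets and of the sets crossing both. The intersection bound controls the imbalance [tau] by
    [r = rA + rB], the logarithmic bound controls [r] by half of [tau], and together they give
    [r ^+ 2 <= 3 * d]. *)
Lemma balance (x z rA rB rX lA lB lq th d y eta : R) :
  0 <= rA -> 0 <= rB -> 0 <= rX -> x + z + rA + rB + rX = 1 ->
  rA + rB + rX <= 27 / 100 ->
  x ^+ 2 + z ^+ 2 + 2 * (x * (rA + rX) + z * (rB + rX)) <= 1 / 2 + d ->
  (lA + lB) / 2 - d <= (x + rA) * lA + (z + rB) * lB - (rA + rB) * th + rX * lq ->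
  `|lA - lB| <= th -> lq - (lA + lB) / 2 <= 86 / 100 ->
  rA + rB <= 3 / 8 * y -> 166 / 100 * y <= th -> 0 < th ->
  0 <= d -> 0 <= eta -> eta <= 1 -> d <= eta ^+ 2 / 100 ->
  1 / 2 - eta <= x /\ 1 / 2 - eta <= z.
Proof.
move=> rA0 rB0 rX0 sum1 rho hmeet hlog hl hq hy hth th0 d0 e0 e1 de.
pose tau := x + rA - z - rB; pose r := rA + rB.
have xE : x = (1 - rX + tau) / 2 - rA by rewrite /tau; lra.
have zE : z = (1 - rX - tau) / 2 - rB by rewrite /tau; lra.
have meet : tau ^+ 2 / 2 + 46 / 100 * rX <= r ^+ 2 + d.
  have p1 : 0 <= rX * (27 / 100 - (rA + rB + rX)) by rewrite mulr_ge0 // subr_ge0.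
  have p2 := mulr_ge0 rA0 rB0; have p3 := mulr_ge0 rX0 rX0.
  by move: hmeet; rewrite xE zE /r; move: (tau) => u; lra.
have r0 : 0 <= r by rewrite addr_ge0.
have hlog2 : r * th <= `|tau| * th / 2 + 86 / 100 * rX + d.
  have t1 : tau * (lA - lB) <= `|tau| * th.
    by rewrite (le_trans (ler_norm _)) // normrM ler_wpM2l.
  have t2 : rX * (lq - (lA + lB) / 2) <= rX * (86 / 100) by rewrite ler_wpM2l.
  by move: hlog; rewrite xE zE /r; move: t1; move: (`|tau|) (tau) => v u; lra.
have rth : r <= 226 / 1000 * th by rewrite /r; lra.
have main : r ^+ 2 <= 3 * d.
  have t1 := sqr_ge0 (`|tau| - r); have t2 : `|tau| ^+ 2 = tau ^+ 2 by rewrite real_normK ?num_real.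
  have t3 : r * (r * th) <= r * (`|tau| * th / 2 + 86 / 100 * rX + d) by rewrite ler_wpM2l.
  have t4 : rX * r <= rX * (226 / 1000 * th) by rewrite ler_wpM2l.
  have t5 : d * r <= d * (226 / 1000 * th) by rewrite ler_wpM2l.
  have t6 : (tau ^+ 2 / 2 + 46 / 100 * rX) * th <= (r ^+ 2 + d) * th by rewrite ler_pM2r.
  have t7 : 0 <= (`|tau| - r) ^+ 2 * th by rewrite mulr_ge0 // ltW.
  have t8 : 0 <= rX * th by rewrite mulr_ge0 // ltW.
  have t9 : 0 <= d * th by rewrite mulr_ge0 // ltW.
  rewrite -(ler_pM2r th0); move: t6; rewrite -t2; lra.
have r_le : r <= 18 / 100 * eta.
  rewrite -(@ler_pXn2r _ 2) ?nnegrE //; last by rewrite mulr_ge0 //; lra.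
  by have := sqr_ge0 eta; lra.
have ee : eta ^+ 2 <= eta by rewrite expr2 ler_piMl.
have rX_le : rX <= 9 / 100 * eta by have := sqr_ge0 tau; lra.
have tau_le : `|tau| <= 29 / 100 * eta.
  rewrite -(@ler_pXn2r _ 2) ?nnegrE ?normr_ge0 //; last by rewrite mulr_ge0 //; lra.
  rewrite real_normK ?num_real //; have := sqr_ge0 eta; lra.
move: tau_le; rewrite ler_norml => /andP[t1 t2].
by rewrite xE zE; move: t1 t2 r_le; rewrite /r; move: (tau) => u; split; lra.
Qed.

End Scalars.

(** * Near-extremal distributions sit on a set and its complement *)

Section Structure.
Variables (R : realType) (T : finType) (k : nat).
Hypothesis k2 : (2 <= k)%N.
Hypothesis cardT : #|T| = k.*2.+1.
Implicit Types A B C D : {set T}.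
Variable a : {set T} -> R.
Hypothesis a0 : forall C, 0 <= a C.
Hypothesis a1 : \sum_C a C = 1.
Hypothesis aset0 : a set0 = 0.
Variable y : R.
Hypothesis yE : y = #|T|%:R^-1.
Variable d : R.
Hypothesis d0 : 0 <= d.
Hypothesis dy : d <= y ^+ 2 / 4000.
Hypothesis meet_le : meet_prob a <= 1 / 2 + d.
Hypothesis log_ge : (ln k%:R + ln k.+1%:R) / 2 - d <= \sum_C a C * ln #|C|%:R.

Let nk : #|T|%:R = 2 * k%:R + 1 :> R.
Proof. by rewrite cardT -addn1 natrD -muln2 natrM mulrC. Qed.

Let kR : 2 <= k%:R :> R. Proof. by rewrite ler_nat. Qed.

Let y0 : 0 < y. Proof. by rewrite yE invr_gt0 nk; have := kR; lra. Qed.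

Let yk : y * (2 * k%:R + 1) = 1.
Proof. by rewrite yE -nk mulVf // nk gt_eqF //; have := kR; lra. Qed.

Let y5 : y <= 1 / 5. Proof.
have k0 : 0 <= k%:R - 2 :> R by rewrite subr_ge0.
by have := mulr_ge0 (ltW y0) k0; have := yk; lra.
Qed.

Let T0 : (0 < #|T|)%N. Proof. by rewrite cardT. Qed.

(* [tt C] is the square root of [#|C|] normalized by [#|T| / 2]. The logarithmic hypothesis bounds
   the mean of [ln tt] from below, so the mean of [tt] is at least about [1], while the mean of
   the cosine is at least half its square; [dev] is what [ln t <= t - 1] loses, diminished by
   a lower bound for its values at the optimal sizes [k] and [k.+1]. *)
Let tt (C : {set T}) : R := Num.sqrt (2 * y) * rt R C.

Let tt_gt0 C : C != set0 -> 0 < tt C.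
Proof. by move=> C0; rewrite mulr_gt0 ?rt_gt0 // sqrtr_gt0 mulr_gt0. Qed.

Let tt_sqr C : tt C ^+ 2 = 2 * y * #|C|%:R.
Proof. by rewrite exprMn sqr_rt sqr_sqrtr // mulr_ge0 // ltW. Qed.

Let dev C : R := tt C - 1 - ln (tt C) - 10^-1 * y ^+ 2.

Let good (C : {set T}) := (#|C| == k) || (#|C| == k.+1).

Let cardR C : (#|C|%:R : R) <= 2 * k%:R + 1.
Proof. by rewrite -nk ler_nat max_card. Qed.

Let dev_ge C : C != set0 -> (~~ good C)%:R * (58 / 100 * y ^+ 2) <= dev C.
Proof.
move=> C0; have t0 := tt_gt0 C0; have ts := tt_sqr C.
have y0' := ltW y0; rewrite /dev /good.
have yk' := yk; have kR' := kR; have y5' := y5.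
have [ck|ck] := eqVneq #|C| k.
  have e : tt C ^+ 2 = 1 - y by rewrite ts ck; lra.
  by rewrite /= mul0r; have := ln_dev_midl t0 y0' e; lra.
have [ck'|ck'] := eqVneq #|C| k.+1.
  have e : tt C ^+ 2 = 1 + y by rewrite ts ck' -addn1 natrD; lra.
  by rewrite /= mul0r; have := ln_dev_midr t0 y0' y5 e; lra.
rewrite /= mul1r.
have [ck2|ck2] := leqP #|C| k.-1.
  have h : #|C|%:R + 1 <= k%:R :> R by rewrite natr1 ler_nat -(ltn_predK k2) ltnS.
  have e : tt C ^+ 2 <= 1 - 3 * y.
    rewrite ts; have : 0 <= y * (k%:R - #|C|%:R - 1) by apply: mulr_ge0 => //; lra.
    lra.
  by have := ln_dev_lo t0 y0' e; lra.
have h : k%:R + 2 <= #|C|%:R :> R.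
  rewrite -natrD ler_nat addn2 ltn_neqAle eq_sym ck' ltn_neqAle eq_sym ck.
  by rewrite -(ltn_predK k2).
have e : 1 + 3 * y <= tt C ^+ 2.
  rewrite ts; have : 0 <= y * (#|C|%:R - k%:R - 2) by apply: mulr_ge0 => //; lra.
  lra.
by have := ln_dev_hi t0 y0' y5 e; lra.
Qed.

Let dev_ge0 C : C != set0 -> 0 <= dev C.
Proof.
move=> C0; apply: le_trans (dev_ge C0); rewrite mulr_ge0 ?ler0n //.
by have := sqr_ge0 y; lra.
Qed.

Let ET := \sum_C a C * tt C.
Let DV := \sum_C a C * dev C.

Let ET_mean : ET = Num.sqrt (2 * y) * mean_rt a.
Proof. by rewrite /ET mulr_sumr; apply: eq_bigr => C _; rewrite /tt; ring. Qed.

Let ET_sqr : mean_rt a ^+ 2 / #|T|%:R = ET ^+ 2 / 2.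
Proof. by rewrite ET_mean exprMn sqr_sqrtr ?mulr_ge0 ?(ltW y0) // -yE; field. Qed.

Let mean_corr C : cload_mean a * rt R C = ET * tt C / 2.
Proof.
rewrite ET_mean /tt mulrACA -expr2 sqr_sqrtr ?mulr_ge0 ?(ltW y0) //.
by rewrite /cload_mean -yE; field.
Qed.

(** As [y * (2 * k + 1) = 1], the optimal sizes normalized by [#|T| / 2] are [1 - y] and [1 + y]. *)
Let lnT : ln (2 * y) + (ln k%:R + ln k.+1%:R) / 2 = ln (1 - y ^+ 2) / 2.
Proof.
have k0 : 0 < k%:R :> R by have := kR; lra.
have -> : 1 - y ^+ 2 = (2 * y) * (2 * y) * (k%:R * k.+1%:R).
  rewrite -addn1 natrD /=; have e := yk.
  have {}e : (y * (2 * k%:R + 1)) ^+ 2 = 1 by rewrite e expr1n.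
  by rewrite -[X in X - _]e; ring.
have p2 : 0 < 2 * y by rewrite mulr_gt0.
have p3 : 0 < 2 * y * (2 * y) by rewrite mulr_gt0.
have p4 : 0 < k%:R * k.+1%:R :> R by rewrite mulr_gt0 // ltr0n.
have p5 : 0 < k.+1%:R :> R by rewrite ltr0n.
rewrite (lnM p3 p4) (lnM p2 p2) (lnM k0 p5); lra.
Qed.

(** Average the identity [tt C = 1 + dev C + ln (tt C) + y ^+ 2 / 10] and insert the logarithmic
    hypothesis. *)
Let ET_ge : DV + 10^-1 * y ^+ 2 + ln (1 - y ^+ 2) / 4 - d / 2 <= ET - 1.
Proof.
have -> : ET - 1 = DV + 10^-1 * y ^+ 2 + ln (2 * y) / 2 + (\sum_C a C * ln #|C|%:R) / 2.
  rewrite -{1}a1.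
  have -> : ET - \sum_C a C = \sum_C (a C * dev C + (10^-1 * y ^+ 2 + ln (2 * y) / 2) * a C
     + (a C * ln #|C|%:R) / 2).
    rewrite -sumrB; apply: eq_bigr => C _.
    have [->|C0] := eqVneq C set0; first by rewrite aset0 !mul0r mulr0; ring.
    have e : ln (2 * y) + ln #|C|%:R = 2 * ln (tt C).
      have p : 0 < 2 * y by rewrite mulr_gt0.
      have c : 0 < #|C|%:R :> R by rewrite ltr0n card_gt0.
      by rewrite [2 * ln (tt C)]mulr_natl -lnXn ?tt_gt0 // tt_sqr (lnM p c).
    by rewrite /dev -[ln #|C|%:R](addrK (ln (2 * y))) [ln #|C|%:R + _]addrC e; field.
  by rewrite !big_split /= -mulr_sumr -mulr_suml a1 /DV; ring.
have := log_ge; have := lnT; lra.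
Qed.

Let DV_ge0 : 0 <= DV.
Proof.
apply: sumr_ge0 => C _; have [->|C0] := eqVneq C set0; first by rewrite aset0 mul0r.
by rewrite mulr_ge0 // dev_ge0.
Qed.

(** The intersection probability is [tslack a + cload_var a + ET ^+ 2 / 2], and
    [ET ^+ 2 >= 2 * ET - 1] with [ET_ge] leaves only this much for the losses: [1022 / 4000 - 1 / 10
    + 3 / 8000 <= 156 / 1000]. *)
Let budget : tslack a + cload_var a + DV <= 156 / 1000 * y ^+ 2.
Proof.
have := meet_le; rewrite meet_prob_split // sum_cload_sqr // ET_sqr.
have := sqr_ge0 (ET - 1); have := ET_ge; have := ln_1Bsqr (ltW y0) y5; have := dy; nra.
Qed.

Let var_ge0 : 0 <= cload_var a.
Proof. by apply: sumr_ge0 => i _; apply: sqr_ge0. Qed.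

Let tslack_ge0 : 0 <= tslack a.
Proof. by apply: sumr_ge0 => C _; rewrite mulr_ge0 // slack_ge0. Qed.

(** The square of [395 / 1000] just exceeds [156 / 1000]. *)
Let corr_dev' C : `|corr a C - ET * tt C / 2| <= 395 / 1000 * y.
Proof.
have := corr_dev a C; rewrite mean_corr => h.
have p : 0 <= 395 / 1000 * y by have := y0; lra.
rewrite -(@ler_pXn2r _ 2) ?nnegrE // real_normK ?num_real //.
have := budget; have := DV_ge0; have := tslack_ge0; have := sqr_ge0 y; lra.
Qed.

Let ET_lo : 988 / 1000 <= ET.
Proof.
have := ET_ge; have := ln_1Bsqr (ltW y0) y5; have := DV_ge0; have := dy.
have : y ^+ 2 <= 1 / 25 by have := y0; have := y5; nra.
by have := sqr_ge0 y; lra.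
Qed.

Let ET_hi : ET <= 1 + d.
Proof.
have := meet_le; rewrite meet_prob_split // sum_cload_sqr // ET_sqr.
by have := sqr_ge0 (ET - 1); have := var_ge0; have := tslack_ge0; lra.
Qed.

Let corr_lo C : C != set0 -> 494 / 1000 * tt C - 395 / 1000 * y <= corr a C.
Proof.
move=> C0; have := corr_dev' C; have := tt_gt0 C0; have := ET_lo.
rewrite ler_norml => e1 e2 /andP[e3 _]; nra.
Qed.

Let corr_quad C : C != set0 -> 28 / 100 * (tt C ^+ 2 + y) <= corr a C.
Proof.
move=> C0; apply: le_trans (corr_lo C0).
apply: quad_light; rewrite ?(ltW (tt_gt0 C0)) ?(ltW y0) ?y5 // tt_sqr.
  have : 1 <= #|C|%:R :> R by rewrite ler1n card_gt0.
  by have := y0; nra.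
have := cardR C; have := yk; have := y0; nra.
Qed.

Let corr_sub C : C != set0 -> y * (corr a C - a C) <= (tt C ^+ 2 + y) * slack a C.
Proof.
move=> C0; have := corr_sub_le a0 C0; rewrite natrD natrM /= => h.
rewrite tt_sqr; have := y0; have := slack_ge0 a0 C; nra.
Qed.

Let heavy C := corr a C / 2 <= a C.

Let hg C := heavy C && good C.

Let good_neq0 C : good C -> C != set0.
Proof.
by apply: contraL => /eqP ->; rewrite /good cards0; case: (k) k2 => [|[]].
Qed.

(** More than half of the correlation comes from other sets; [corr_sub] charges it to the slack, and
    by [corr_quad] the factor [tt C ^+ 2 + y] cancels. *)
Let slack_light C : C != set0 -> ~~ heavy C -> 14 / 100 * y <= slack a C.
Proof.
move=> C0; rewrite -ltNge => h.
have := corr_sub C0; have := corr_quad C0 => q1 q2.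
have p : 0 < tt C ^+ 2 + y by have := sqr_ge0 (tt C); have := y0; lra.
rewrite -(ler_pM2l p); apply: le_trans q2.
have : y * a C <= y * (corr a C / 2) by rewrite ler_pM2l ?y0 // ltW.
have : y * (28 / 100 * (tt C ^+ 2 + y)) <= y * corr a C by rewrite ler_pM2l ?y0.
lra.
Qed.

Let cost_ge C : C != set0 -> ~~ hg C -> 58 / 100 * y ^+ 2 <= slack a C + dev C.
Proof.
move=> C0; rewrite negb_and => /orP[h|g].
  have := slack_light C0 h; have := dev_ge0 C0.
  have : y ^+ 2 <= y * (1 / 5) by rewrite expr2 ler_pM2l ?y0 ?y5.
  have := y0; lra.
have := dev_ge C0; rewrite g mul1r; have := slack_ge0 a0 C; lra.
Qed.

(** By [cost_ge] each of these sets uses the budget at rate [58 / 100 * y ^+ 2], and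
    [156 / 580 <= 27 / 100]. *)
Let rest_mass : \sum_(C | ~~ hg C) a C <= 27 / 100.
Proof.
have y2 : 0 < y ^+ 2 by rewrite exprn_gt0 ?y0.
suff : (\sum_(C | ~~ hg C) a C) * (58 / 100 * y ^+ 2) <= 156 / 1000 * y ^+ 2.
  move=> h; rewrite -(ler_pM2r y2); lra.
apply: le_trans budget; rewrite mulr_suml.
apply: (@le_trans _ _ (\sum_C (a C * slack a C + a C * dev C))); last first.
  by rewrite big_split /= -/DV; have := var_ge0; rewrite -/(tslack a); lra.
rewrite [leRHS](bigID (fun C => ~~ hg C)) /=.
have p C : 0 <= a C * slack a C + a C * dev C.
  have [->|C0] := eqVneq C set0; first by rewrite aset0 !mul0r addr0.
  by rewrite addr_ge0 // mulr_ge0 ?slack_ge0 ?dev_ge0.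
apply: (@le_trans _ _ (\sum_(C | ~~ hg C) (a C * slack a C + a C * dev C))); last first.
  by rewrite lerDl sumr_ge0.
apply: ler_sum => C nC; have [->|C0] := eqVneq C set0.
  by rewrite aset0 !mul0r addr0.
by rewrite -mulrDr ler_wpM2l // cost_ge.
Qed.

Let good_tt_lo C : good C -> 1 - 53 / 100 * y <= tt C.
Proof.
move=> g; have C0 := good_neq0 g; rewrite leNgt; apply/negP => h.
have : tt C ^+ 2 < (1 - 53 / 100 * y) ^+ 2.
  by rewrite ltr_pXn2r ?nnegrE ?(ltW (tt_gt0 C0)) //; have := y5; have := y0; lra.
have : 1 - y <= tt C ^+ 2.
  rewrite tt_sqr; have : k%:R <= #|C|%:R :> R.
    by rewrite ler_nat; case/orP: g => /eqP ->.
  rewrite -subr_ge0 => /(mulr_ge0 (ltW y0)); have := yk; lra.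
have := mulr_ge0 (ltW y0) (ltW y0); have := y5; have := y0 => p1 p2.
have : y * y <= y * (1 / 5) by rewrite ler_pM2l.
lra.
Qed.

Let good_tt_hi C : good C -> tt C <= 1 + y / 2.
Proof.
move=> g; have : tt C ^+ 2 <= 1 + y.
  rewrite tt_sqr; have : #|C|%:R <= k%:R + 1 :> R.
    by rewrite natr1 ler_nat; case/orP: g => /eqP ->.
  rewrite -subr_ge0 => /(mulr_ge0 (ltW y0)); have := yk; lra.
by have := sqr_ge0 (tt C - 1); lra.
Qed.

Let y2_le : y ^+ 2 <= y / 5.
Proof.
have : y * y <= y * (1 / 5) by rewrite ler_pM2l ?y0 ?y5.
lra.
Qed.

Let d_small : d <= 1 / 1000.
Proof. by have := y2_le; have := y5; have := dy; lra. Qed.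

(** The budget and heaviness bound the slack, so by [corr_sub] the weight falls short of the
    correlation by at most [558 / 1000 * y]; the correlation itself is almost [1 / 2 * tt C] by
    [corr_lo], up to a multiple of [y]. *)
Let hg_lo C : hg C -> 1 / 4 <= a C.
Proof.
case/andP=> h g; have C0 := good_neq0 g.
have t1 := good_tt_lo g; have q1 := corr_quad C0; have q2 := corr_lo C0.
have q3 := corr_sub C0; have y0' := y0; have y5' := y5.
suff : corr a C - a C <= 558 / 1000 * y by lra.
have [|e] := lerP (corr a C - a C) 0; first lra.
have s0 := slack_ge0 a0 C.
have b1 : 2 * (a C * slack a C) <= 156 / 1000 * y ^+ 2.
  by have := tslack_ge1 a0 C0; have := budget; have := var_ge0; have := DV_ge0; lra.
have b2 : corr a C / 2 * slack a C <= a C * slack a C by apply: ler_wpM2r.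
have b3 : 28 / 100 * (tt C ^+ 2 + y) * slack a C <= corr a C * slack a C by apply: ler_wpM2r.
have b4 : 28 / 100 * ((tt C ^+ 2 + y) * slack a C) <= 156 / 1000 * y ^+ 2 by lra.
have y2 := sqr_ge0 y.
rewrite -(ler_pM2l y0); apply: le_trans q3 _.
have -> : y * (558 / 1000 * y) = 558 / 1000 * y ^+ 2 by ring.
lra.
Qed.

Let hg_hi C : hg C -> a C <= 63 / 100.
Proof.
case/andP=> _ g; have C0 := good_neq0 g.
have := corr_ge a0 C; rewrite C0 mulr1 => h.
have := corr_dev' C; rewrite ler_norml => /andP[_ h2].
have y5' := y5; have t2 := good_tt_hi g; have t3 := tt_gt0 C0.
have : ET * tt C <= (1 + d) * (1 + y / 2).
  by apply: ler_pM; rewrite ?ET_hi // ?(ltW t3) //; have := ET_lo; lra.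
have : d * y <= d * (1 / 5) by rewrite ler_wpM2l.
have := d_small; lra.
Qed.

Let tslack_le : tslack a <= 156 / 1000 * y ^+ 2.
Proof. by have := budget; have := var_ge0; have := DV_ge0; lra. Qed.

Let gap C D : C != D -> meets C D -> (#|C| <= k.+1)%N ->
  y / (1 + 3 * y) <= (meets C D)%:R - cosine R C D.
Proof.
move=> CD m ck; rewrite m /=; have := cosine_neq R CD.
have y0' := y0; rewrite !natrD addr0 ler_pdivrMr; last lra.
have c1 : #|C|%:R <= k%:R + 1 :> R by rewrite natr1 ler_nat.
have p : 0 < 2 * (1 + 3 * y) by lra.
have e : 2 * k%:R * y = 1 - y by have := yk; lra.
move=> h.
have h2 : 1 <= (2 * k%:R + 4) * (1 - cosine R C D).
  have : 0 <= 1 - cosine R C D by rewrite subr_ge0; have := cosine_le_meets R C D; rewrite m.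
  rewrite -subr_ge0 in c1 => /(mulr_ge0 c1); lra.
have := mulr_ge0 (ltW y0) (ltac:(rewrite subr_ge0; exact: h2) : 0 <= (2 * k%:R + 4) * (1 - cosine R C D) - 1).
have -> : y * ((2 * k%:R + 4) * (1 - cosine R C D) - 1) =
  (2 * k%:R * y + 4 * y) * (1 - cosine R C D) - y by ring.
rewrite e; lra.
Qed.

(** Two meeting sets of weight at least [1 / 4] would have slack of order [y], beyond the budget of
    order [y ^+ 2]. *)
Let hg_disj A B : hg A -> hg B -> A != B -> ~~ meets A B.
Proof.
move=> hA hB AB; apply/negP => m.
have ckA : (#|A| <= k.+1)%N by case/andP: hA => _ /orP[] /eqP ->.
have g := gap AB m ckA; have lA := hg_lo hA; have lB := hg_lo hB.
have := tslack_ge a0 (pred1 B); rewrite (bigD1 A) //= big_pred1_eq.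
set w := (meets A B)%:R - _ in g *.
set r := \sum_(_ | _) _; have r0 : 0 <= r.
  apply: sumr_ge0 => C _; rewrite mulr_ge0 // sumr_ge0 // => D _.
  by rewrite mulr_ge0 // subr_ge0 cosine_le_meets.
have y0' := y0; have y5' := y5.
have p : 0 < 1 + 3 * y by lra.
have w1 : y * (5 / 8) <= w.
  apply: le_trans g; rewrite ler_pM2l // -[leRHS]mul1r ler_pdivlMr //; lra.
have w2 : a B / 4 * w <= a A * (a B * w).
  by rewrite [leRHS]mulrA ler_wpM2r //; [lra | rewrite mulrC ler_wpM2r //; lra].
have w3 : 1 / 4 / 4 * w <= a B / 4 * w by rewrite ler_wpM2r //; lra.
have := tslack_le; have := y2_le; lra.
Qed.

(** The heavy good sets have total weight at least [73 / 100] but each at most [63 / 100], so there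
    are two. They are pairwise disjoint, and three would need [3 * k > 2 * k + 1] elements. *)
Lemma coarse_structure : exists A B, [/\ (A != B) && ~~ meets A B,
  good A && good B, 1 / 4 <= a A, 1 / 4 <= a B &
  \sum_(C | ~~ ((C == A) || (C == B))) a C <= 27 / 100].
Proof.
have tot : 73 / 100 <= \sum_(C | hg C) a C.
  have := a1; rewrite (bigID hg) /=; have := rest_mass; lra.
have [A hA|no] := pickP hg; last first.
  by move: tot; rewrite big_pred0 //; lra.
have [B /andP[hB BA]|no] := pickP [pred C | hg C & C != A]; last first.
  move: tot; rewrite (bigD1 A) //= big_pred0 //; have := hg_hi hA; lra.
have gA : good A by case/andP: hA.
have gB : good B by case/andP: hB.
have mAB : ~~ meets A B by rewrite hg_disj // eq_sym.
exists A, B; split; rewrite ?hg_lo ?gA ?gB ?mAB ?andbT // 1?eq_sym //.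
apply: le_trans rest_mass; rewrite [leRHS](bigID (fun C => ~~ ((C == A) || (C == B)))) /=.
rewrite -[leLHS]addr0 lerD ?sumr_ge0 // le_eqVlt; apply/orP; left; apply/eqP.
apply: eq_bigl => C; apply/idP/andP => [CAB|[]//]; split=> //.
apply: contra CAB => hC; apply/negPn/negP; rewrite negb_or => /andP[CA CB].
have gC : good C by case/andP: hC.
have := hg_disj hC hA CA; have := hg_disj hC hB CB.
rewrite /meets !negbK => /eqP CB0 /eqP CA0; move/negPn/eqP: mAB => AB0.
have := max_card (mem (A :|: B :|: C)).
rewrite !cardsU AB0 cards0 subn0 setIUl setIC CA0 set0U setIC CB0 cards0 subn0 cardT.
have gk D : good D -> (k <= #|D|)%N by case/orP => /eqP ->.
have := gk _ gA; have := gk _ gB; have := gk _ gC.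
move=> h1 h2 h3 h4; have := leq_trans (leq_add (leq_add h3 h2) h1) h4.
by rewrite addnn -addn1 leq_add2l leqNgt k2.
Qed.

Let gapk C D : C != D -> meets C D -> (#|C| <= k)%N ->
  y / (1 + y) <= (meets C D)%:R - cosine R C D.
Proof.
move=> CD m ck; rewrite m /=; have := cosine_neq R CD.
have y0' := y0; rewrite !natrD addr0 ler_pdivrMr; last lra.
have c1 : #|C|%:R <= k%:R :> R by rewrite ler_nat.
have e : 2 * k%:R * y = 1 - y by have := yk; lra.
move=> h.
have h2 : 0 <= (2 * k%:R + 2) * (1 - cosine R C D) - 1.
  have : 0 <= 1 - cosine R C D by rewrite subr_ge0; have := cosine_le_meets R C D; rewrite m.
  rewrite -subr_ge0 in c1 => /(mulr_ge0 c1); lra.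
have := mulr_ge0 (ltW y0) h2.
have -> : y * ((2 * k%:R + 2) * (1 - cosine R C D) - 1) =
  (2 * k%:R * y + 2 * y) * (1 - cosine R C D) - y by ring.
rewrite e; lra.
Qed.

Section Pair.
Variables A B : {set T}.
Hypothesis AB : A != B.
Hypothesis A4 : 1 / 4 <= a A.
Hypothesis B4 : 1 / 4 <= a B.

Let rest C := ~~ ((C == A) || (C == B)).

Let sum_pair (f : {set T} -> R) : \sum_(C | (C == A) || (C == B)) f C = f A + f B.
Proof.
rewrite (bigD1 A) ?eqxx //= (bigD1 B) ?eqxx ?orbT ?(eq_sym B) //= big_pred0 ?addr0 //.
by move=> C; case: (C == A); case: (C == B).
Qed.

(** By [gapk], each such [C] has a gap of order [y] to a set of weight at least [1 / 4], so its
    weight counts against the budget; [312 / 1000 * (6 / 5) <= 3 / 8]. *)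
Let touch_mass (Q : pred {set T}) :
  (forall C, Q C -> rest C /\ exists2 D, (D == A) || (D == B) &
     meets C D /\ ((#|C| <= k)%N \/ (#|D| <= k)%N)) ->
  \sum_(C | Q C) a C <= 3 / 8 * y.
Proof.
move=> QP; have y0' := y0; have y5' := y5.
have p : 0 < 1 + y by lra.
suff : 2 * ((\sum_(C | Q C) a C) * (1 / 4 * (y / (1 + y)))) <= 156 / 1000 * y ^+ 2.
  rewrite -(ler_pM2r p).
  have -> : 2 * ((\sum_(C | Q C) a C) * (1 / 4 * (y / (1 + y)))) * (1 + y) =
    (\sum_(C | Q C) a C) / 2 * y by field; rewrite gt_eqF.
  rewrite (_ : 156 / 1000 * y ^+ 2 * (1 + y) = (156 / 1000 * y * (1 + y)) * y); last by ring.
  by rewrite ler_pM2r //; have := y2_le; lra.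
apply: le_trans tslack_le; apply: le_trans (tslack_ge a0 (fun C => (C == A) || (C == B))).
rewrite ler_pM2l ?ltr0n // mulr_suml [leRHS](bigID Q) /=.
have w0 C D : 0 <= a D * ((meets C D)%:R - cosine R C D).
  by rewrite mulr_ge0 // subr_ge0 cosine_le_meets.
have s0 C : 0 <= a C * \sum_(D | (D == A) || (D == B)) a D * ((meets C D)%:R - cosine R C D).
  by rewrite mulr_ge0 // sumr_ge0.
apply: (@le_trans _ _ (\sum_(C | ~~ ((C == A) || (C == B)) && Q C)
   a C * \sum_(D | (D == A) || (D == B)) a D * ((meets C D)%:R - cosine R C D))); last first.
  by rewrite lerDl sumr_ge0.
rewrite [leRHS](eq_bigl Q); last first.
  by move=> C; case q : (Q C); rewrite ?andbF // andbT; case: (QP C q).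
apply: ler_sum => C /QP [rC [D DAB [m sz]]]; rewrite ler_wpM2l //.
rewrite (bigD1 D) //= -[leLHS]addr0 lerD ?sumr_ge0 //.
have CD : C != D by apply: contraNneq rC => ->.
have D4 : 1 / 4 <= a D by case/orP: DAB => /eqP ->.
have g : y / (1 + y) <= (meets C D)%:R - cosine R C D.
  case: sz => sz; first exact: gapk.
  by rewrite meetsC cosineC; apply: gapk; rewrite // 1?eq_sym // meetsC.
by apply: ler_pM => //; [lra | rewrite divr_ge0 // ltW].
Qed.

Hypothesis nAB : ~~ meets A B.
Hypothesis gA : good A.
Hypothesis gB : good B.
Hypothesis restAB : \sum_(C | ~~ ((C == A) || (C == B))) a C <= 27 / 100.

Let th := ln k.+1%:R - ln k%:R : R.

Let k0 : (0 < k)%N. Proof. exact: ltnW. Qed.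

Let th_ge : 166 / 100 * y <= th.
Proof.
have kp : 0 < k%:R :> R by rewrite ltr0n.
have kp1 : 0 < k.+1%:R :> R by rewrite ltr0n.
have : ln (1 + (k%:R / k.+1%:R - 1)) <= k%:R / k.+1%:R - 1 :> R.
  by apply: le_ln1Dx; rewrite ltrBrDr addNr divr_gt0.
rewrite addrC subrK ln_div // /th => h.
suff h2 : 166 / 100 * y <= 1 - k%:R / k.+1%:R.
  by apply: le_trans h2 _; move: h; move: (k%:R / k.+1%:R : R) (ln k%:R) (ln k.+1%:R) => u v w; lra.
have -> : 1 - k%:R / k.+1%:R = 1 / k.+1%:R :> R.
  by rewrite -[X in X - _](@divff _ k.+1%:R) ?gt_eqF // -mulrBl -natr1; congr (_ / _); ring.
rewrite ler_pdivlMr // -natr1; have := yk; have := y5; lra.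
Qed.

Let disjAB : A :&: B = set0. Proof. by apply/eqP; rewrite -[_ == _]negbK. Qed.

Let size_le : (#|A| + #|B| <= k.*2.+1)%N.
Proof. by rewrite -cardT -cardsUI disjAB cards0 addn0 max_card. Qed.

(** Only one element would lie outside [A] and [B], so every set of more than [k] elements would
    meet one of them. By [touch_mass] such sets would be too rare to raise the mean logarithm from
    [ln k] halfway to [ln k.+1]. *)
Let not_both_small : ~ (#|A| = k /\ #|B| = k).
Proof.
case=> Ak Bk; have y0' := y0; have y5' := y5.
have kp : 0 < k%:R :> R by rewrite ltr0n.
pose Q C := (k < #|C|)%N.
have M : \sum_(C | Q C) a C <= 3 / 8 * y.
  apply: touch_mass => C; rewrite /Q => kC; split.
    by rewrite /rest; apply/norP; split; apply: contraTneq kC => ->; rewrite ?Ak ?Bk ltnn.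
  have [mA|mA] := boolP (meets C A).
    by exists A; rewrite ?eqxx //; split=> //; right; rewrite Ak.
  exists B; rewrite ?eqxx ?orbT //; split; last by right; rewrite Bk.
  apply: contraT => mB; have := max_card (mem (A :|: B :|: C)).
  move: mA mB; rewrite /meets !negbK => /eqP CA /eqP CB.
  rewrite !cardsU disjAB cards0 subn0 setIUl setIC CA set0U setIC CB cards0 subn0 cardT Ak Bk.
  move=> h; have := leq_trans (leq_add (leqnn (k + k)) kC) h.
  by rewrite addnn addnS ltnS -[X in (_ <= X)%N]addn0 leq_add2l leqn0 eqn0Ngt k0.
pose lq := ln #|T|%:R : R.
have qp : 0 < #|T|%:R :> R by rewrite ltr0n T0.
have lqk : lq - ln k%:R <= 3 / 2.
  rewrite /lq -ln_div // -[X in ln X](subrK 1) addrC.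
  have e : #|T|%:R / k%:R <= 5 / 2 :> R by rewrite ler_pdivrMr // nk; have := kR; lra.
  by apply: le_trans (le_ln1Dx _) _; [rewrite ltrBrDr addNr divr_gt0 | lra].
have lqk0 : 0 <= lq - ln k%:R.
  by rewrite subr_ge0 ler_ln // nk; have := kR; lra.
have : \sum_C a C * ln #|C|%:R <= \sum_C (a C * ln k%:R + (if Q C then a C else 0) * (lq - ln k%:R)).
  apply: ler_sum => C _.
  have [->|C0] := eqVneq C set0; first by rewrite aset0 !mul0r; case: ifP; rewrite mul0r addr0.
  have cp : 0 < #|C|%:R :> R by rewrite ltr0n card_gt0.
  case: ifP => [_|/negbT]; rewrite /Q ?mul0r ?addr0 -?mulrDr.
    by rewrite addrC subrK ler_wpM2l // ler_ln // ler_nat max_card.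
  by rewrite -leqNgt => h; rewrite ler_wpM2l // ler_ln // ler_nat.
rewrite big_split /= -!mulr_suml a1 -big_mkcond /= => h.
have h2 : (\sum_(C | Q C) a C) * (lq - ln k%:R) <= 3 / 8 * y * (3 / 2).
  by apply: ler_pM => //; rewrite sumr_ge0.
have := log_ge; have := th_ge; rewrite /th; have := dy; have := y2_le; lra.
Qed.

Let sizes : (#|A| = k /\ #|B| = k.+1) \/ (#|A| = k.+1 /\ #|B| = k).
Proof.
case/orP: gA => /eqP eA; case/orP: gB => /eqP eB; [by case: not_both_small|by left|by right|].
move: size_le; rewrite eA eB addSn ltnS addnS addnn ltnNge.
by rewrite leqnn.
Qed.

Let compl : B = ~: A.
Proof.
apply/eqP; rewrite eqEcard; apply/andP; split.
  by rewrite -disjoints_subset disjoint_sym -setI_eq0 disjAB.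
rewrite cardsCs setCK cardT leq_subLR.
by case: sizes => -[-> ->]; rewrite ?addnS ?addSn addnn.
Qed.

Let lA := ln #|A|%:R : R.
Let lB := ln #|B|%:R : R.

Let lsum : lA + lB = ln k%:R + ln k.+1%:R.
Proof. by rewrite /lA /lB; case: sizes => -[-> ->] //; rewrite addrC. Qed.

Let th_gt0 : 0 < th.
Proof. by apply: lt_le_trans th_ge; have := y0; lra. Qed.

Let ldiff : `|lA - lB| <= th.
Proof.
rewrite /lA /lB; case: sizes => -[-> ->]; last by rewrite gtr0_norm ?lexx -/th.
by rewrite distrC gtr0_norm ?lexx -/th.
Qed.

Let ln_proper C D : good D -> C != set0 -> C \subset D -> C != D ->
  ln #|C|%:R <= ln #|D|%:R - th.
Proof.
move=> gD C0 CD nCD.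
have cp : (0 < #|C|)%N by rewrite card_gt0.
have CltD : (#|C| < #|D|)%N by rewrite proper_card // properEneq nCD.
have Dk : (#|D| <= k.+1)%N by case/orP: gD => /eqP ->.
rewrite /th opprB addrA lerBrDr -!lnM ?posrE ?ltr0n // ?(leq_trans cp (ltnW CltD)) //.
rewrite -!natrM ler_ln ?posrE ?ltr0n ?muln_gt0 ?cp ?k0 ?(leq_trans cp (ltnW CltD)) // ler_nat.
apply: (@leq_trans (#|D|.-1 * k.+1)); first by rewrite leq_mul2r -ltnS (ltn_predK CltD) CltD orbT.
rewrite -subn1 mulnBl mul1n leq_subLR mulnS leq_add2r //.
Qed.

Let touch C : rest C -> C != set0 -> (C \subset A) || (C \subset B) ->
  exists2 D, (D == A) || (D == B) & meets C D /\ ((#|C| <= k)%N \/ (#|D| <= k)%N).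
Proof.
case/norP=> CA CB C0 sub.
have small D : good D -> C != D -> C \subset D -> meets C D /\ ((#|C| <= k)%N \/ (#|D| <= k)%N).
  move=> gD CD sD; split; first by rewrite /meets (setIidPl sD).
  left; rewrite -ltnS (@leq_trans #|D|) //; first by rewrite proper_card // properEneq CD.
  by case/orP: gD => /eqP ->.
by case/orP: sub => s; [exists A | exists B]; rewrite ?eqxx ?orbT //; apply: small.
Qed.

Let crosses C := ~~ (C \subset A) && ~~ (C \subset B).

Let split1 C : a C = a C * (C \subset A)%:R + a C * (C \subset B)%:R + a C * (crosses C)%:R.
Proof.
have [->|C0] := eqVneq C set0; first by rewrite aset0 !mul0r !addr0.
rewrite /crosses; have [sA|sA] /= := boolP (C \subset A); last first.
  by case: (C \subset B); rewrite /= !mulr1 !mulr0 ?addr0 ?add0r.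
rewrite (_ : C \subset B = false) ?mulr1 ?mulr0 ?addr0 //.
apply: contraNF C0 => sB; rewrite -subset0 -disjAB; exact/subsetIP.
Qed.

Let rA := \sum_(C | rest C) a C * (C \subset A)%:R.
Let rB := \sum_(C | rest C) a C * (C \subset B)%:R.
Let rX := \sum_(C | rest C) a C * (crosses C)%:R.

Let r_sum : rA + rB + rX = \sum_(C | rest C) a C.
Proof. by rewrite -!big_split /=; apply: eq_bigr => C _; rewrite -split1. Qed.

Let r_small : rA + rB <= 3 / 8 * y.
Proof.
pose Q C := [&& rest C, C != set0 & (C \subset A) || (C \subset B)].
apply: le_trans (touch_mass (Q := Q) _).
  rewrite -big_split /= [leRHS]big_mkcond [leLHS]big_mkcond /=; apply: ler_sum => C _.
  rewrite /Q; case: ifP => //= rC; have [->|C0] /= := eqVneq C set0.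
    by rewrite aset0 !mul0r addr0.
  rewrite [X in _ <= if _ then X else _]split1 /crosses.
  by case: (C \subset A); case: (C \subset B); rewrite /= ?mulr1 ?mulr0 ?addr0 ?add0r.
by move=> C /and3P[rC C0 sub]; split=> //; apply: touch.
Qed.

Let meet_pair : a A ^+ 2 + a B ^+ 2 + 2 * (a A * (rA + rX) + a B * (rB + rX)) <= 1 / 2 + d.
Proof.
apply: le_trans meet_le; rewrite /meet_prob.
rewrite (double_sum_split a (fun C => (C == A) || (C == B))) => [|C D]; last by rewrite meetsC.
rewrite !sum_pair -[leLHS]addr0; apply: lerD; last first.
  by apply: sumr_ge0 => C _; apply: sumr_ge0 => D _; rewrite !mulr_ge0.
apply: lerD.
  rewrite (meetsC B A) (negPf nAB) /meets !setIid (good_neq0 gA) (good_neq0 gB) /=; lra.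
rewrite ler_pM2l ?ltr0n // !mulrDr !mulr_sumr -!big_split /=; apply: ler_sum => C rC.
rewrite sum_pair.
have [->|C0] := eqVneq C set0; first by rewrite aset0 !mul0r !mulr0 !addr0.
have mA : (C \subset A) || crosses C -> meets C A.
  rewrite /crosses; case: (boolP (C \subset A)) => [sA _|nA /=].
    by rewrite /meets (setIidPl sA).
  by rewrite compl -disjoints_subset -setI_eq0.
have mB : (C \subset B) || crosses C -> meets C B.
  rewrite /crosses; case: (boolP (C \subset B)) => [sB _|nB /=].
    by rewrite /meets (setIidPl sB).
  by rewrite andbT compl /meets setI_eq0 disjoints_subset setCK.
have ind (D : {set T}) : ((C \subset D) || crosses C -> meets C D) -> (D == A) || (D == B) ->
    (C \subset D)%:R + (crosses C)%:R <= (meets C D)%:R :> R.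
  move=> h DAB; have ex : ~~ ((C \subset D) && crosses C).
    by rewrite /crosses; case/orP: DAB => /eqP ->; case: (C \subset A); case: (C \subset B).
  move: h ex; case: (C \subset D); case: (crosses C) => //= h _.
  - by rewrite h // addr0.
  - by rewrite h // add0r.
  - by rewrite addr0 ler0n.
have hA := ind _ mA; have hB := ind _ mB; rewrite !eqxx ?orbT in hA hB.
have gA' : a C * a A * ((C \subset A)%:R + (crosses C)%:R) <= a C * a A * (meets C A)%:R.
  by rewrite ler_wpM2l ?mulr_ge0 ?hA.
have gB' : a C * a B * ((C \subset B)%:R + (crosses C)%:R) <= a C * a B * (meets C B)%:R.
  by rewrite ler_wpM2l ?mulr_ge0 ?hB.
lra.
Qed.

Let lq := ln #|T|%:R : R.

(** A proper subset of [A] or [B] has a logarithm smaller by at least [th], by [ln_proper]; a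
    crossing set has at most [#|T|] elements. *)
Let log_pair : (lA + lB) / 2 - d <=
  (a A + rA) * lA + (a B + rB) * lB - (rA + rB) * th + rX * lq.
Proof.
apply: le_trans (_ : \sum_C a C * ln #|C|%:R <= _); first by rewrite lsum.
rewrite (bigID (fun C => (C == A) || (C == B))) /= sum_pair.
have : \sum_(C | rest C) a C * ln #|C|%:R <= \sum_(C | rest C)
   (a C * (C \subset A)%:R * (lA - th) + a C * (C \subset B)%:R * (lB - th) +
    a C * (crosses C)%:R * lq).
  apply: ler_sum => C /norP[CA CB].
  have [->|C0] := eqVneq C set0; first by rewrite aset0 !mul0r !addr0.
  rewrite {1}(split1 C) !mulrDl.
  have f (b : bool) (u v : R) : (b -> u <= v) -> a C * b%:R * u <= a C * b%:R * v.
    by case: b => h; rewrite ?mulr0 ?mul0r // mulr1 ler_wpM2l // h.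
  apply: lerD; [apply: lerD|]; apply: f => h.
  - by apply: ln_proper.
  - by apply: ln_proper.
  by rewrite /lq ler_ln ?posrE ?ltr0n ?card_gt0 ?T0 // ler_nat max_card.
rewrite !big_split /= -!mulr_suml -/rA -/rB -/rX -/lA -/lB.
rewrite -[\sum_(C | ~~ _) _]/(\sum_(C | rest C) _); lra.
Qed.

Let lq_le : lq - (lA + lB) / 2 <= 86 / 100.
Proof.
have kp : 0 < k%:R :> R by rewrite ltr0n.
have kp1 : 0 < k.+1%:R :> R by rewrite ltr0n.
have qp : 0 < #|T|%:R :> R by rewrite ltr0n T0.
have k1 : k.+1%:R = k%:R + 1 :> R by rewrite -natr1.
(* The ratio is largest at [k = 2], where [25 / 6 <= (143 / 100) ^+ 4]. Half of four times
   [ln (143 / 100) <= 43 / 100] gives [86 / 100]. *)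
have e : #|T|%:R ^+ 2 <= (143 / 100) ^+ 4 * (k%:R * k.+1%:R) :> R.
  rewrite nk k1; have : 2 * k%:R <= k%:R * k%:R :> R by rewrite ler_pM2r // kR.
  have := kR; lra.
have c0 : 0 < 143 / 100 :> R by lra.
have c4 : 0 < (143 / 100) ^+ 4 :> R by apply: exprn_gt0.
have kk : 0 < k%:R * k.+1%:R :> R by apply: mulr_gt0.
have : ln (#|T|%:R ^+ 2) <= ln ((143 / 100) ^+ 4 * (k%:R * k.+1%:R)) :> R.
  by rewrite (ler_ln (exprn_gt0 2 qp) (mulr_gt0 c4 kk)).
rewrite (lnM c4 kk) (lnM kp kp1) !lnXn // -/lq lsum => h.
have : ln (1 + 43 / 100) <= 43 / 100 :> R by apply: le_ln1Dx; lra.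
have -> : 1 + 43 / 100 = 143 / 100 :> R by lra.
by move: h; move: (ln (143 / 100)) lq => u v; lra.
Qed.

Lemma fine_structure eta : 0 <= eta -> eta <= 1 -> d <= eta ^+ 2 / 100 ->
  B = ~: A /\ (1 / 2 - eta <= a A /\ 1 / 2 - eta <= a B).
Proof.
move=> e0 e1 de; split; first exact: compl.
apply: (@balance _ _ _ rA rB rX lA lB lq th d y eta) => //.
- by apply: sumr_ge0 => C _; rewrite mulr_ge0.
- by apply: sumr_ge0 => C _; rewrite mulr_ge0.
- by apply: sumr_ge0 => C _; rewrite mulr_ge0.
- by rewrite -!addrA [rA + _]addrA r_sum -a1 [RHS](bigID (fun C => (C == A) || (C == B))) /= sum_pair addrA.
- by rewrite r_sum.
Qed.

End Pair.

Lemma structure eta : 0 <= eta -> eta <= 1 -> d <= eta ^+ 2 / 100 ->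
  exists A, [/\ (#|A| == k) || (#|A| == k.+1), 1 / 2 - eta <= a A & 1 / 2 - eta <= a (~: A)].
Proof.
move=> e0 e1 de; have [A [B [/andP[AB nAB] /andP[gA gB] A4 B4 r]]] := coarse_structure.
have [BA [hA hB]] := fine_structure AB A4 B4 nAB gA gB r e0 e1 de.
by exists A; split=> //; rewrite -BA.
Qed.

End Structure.

(** * Typical colorings *)


Lemma card_family_prod (aT rT : finType) (F : aT -> {set rT}) :
  #|family (fun x => mem (F x))| = (\prod_x #|F x|)%N.
Proof. by rewrite card_family foldrE big_map big_enum. Qed.

Section ListStructure.
Variables (R : realType) (k : nat).
Hypothesis k2 : (2 <= k)%N.
Local Notation q := k.*2.+1.

(** [structure] is applied to the distribution of the list of a uniformly random vertex; [d] depends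
    only on [k] and [eta]. *)
Lemma list_structure (eta : R) : 0 < eta -> eta <= 1 ->
  exists2 d : R, 0 < d & forall (V : finType) (L : V -> {set 'I_q}),
    (0 < #|V|)%N -> (forall v, L v != set0) ->
    (\sum_u \sum_v (L u :&: L v != set0))%:R <= (1 / 2 + d) * #|V|%:R ^+ 2 ->
    #|V|%:R * ((ln k%:R + ln k.+1%:R) / 2 - d) <= \sum_v ln #|L v|%:R ->
    exists A : {set 'I_q}, [/\ (#|A| == k) || (#|A| == k.+1),
      (1 / 2 - eta) * #|V|%:R <= #|[set v | L v == A]|%:R
    & (1 / 2 - eta) * #|V|%:R <= #|[set v | L v == ~: A]|%:R].
Proof.
move=> eta0 eta1; pose y : R := q%:R^-1.
have y0 : 0 < y by rewrite invr_gt0 ltr0n.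
pose d := Num.min (y ^+ 2 / 4000) (eta ^+ 2 / 100).
have d0 : 0 < d by rewrite lt_min !divr_gt0 ?exprn_gt0 // ltr0n.
exists d => // V L V0 L0 hmeet hln.
have n0 : 0 < #|V|%:R :> R by rewrite ltr0n.
pose al (C : {set 'I_q}) : R := #|[set v | L v == C]|%:R / #|V|%:R.
have al_sum (f : {set 'I_q} -> R) : \sum_C al C * f C = (\sum_v f (L v)) / #|V|%:R.
  rewrite (partition_big L xpredT) //= mulr_suml; apply: eq_bigr => C _.
  rewrite /al mulrAC; congr (_ / _).
  rewrite (eq_bigr (fun=> f C)) => [|v /eqP -> //]; rewrite sumr_const mulr_natl; congr (_ *+ _).
  by rewrite cardsE.
have al_ge0 C : 0 <= al C by rewrite divr_ge0.
have al1 : \sum_C al C = 1.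
  have := al_sum (fun=> 1); rewrite sumr_const -[1 *+ _]/(_%:R) divff ?gt_eqF // => <-.
  by apply: eq_bigr => C _; rewrite mulr1.
have al0 : al set0 = 0.
  rewrite /al (_ : [set v | _] = set0) ?cards0 ?mul0r //.
  by apply/setP => v; rewrite !inE (negPf (L0 v)).
have hm : meet_prob al <= 1 / 2 + d.
  rewrite /meet_prob.
  under eq_bigr => C _.
    under eq_bigr do rewrite -mulrA.
    rewrite -mulr_sumr al_sum. over.
  rewrite (al_sum (fun C => (\sum_v (meets C (L v))%:R) / #|V|%:R)) -mulr_suml.
  rewrite -mulrA -invfM -expr2 ler_pdivrMr ?exprn_gt0 //.
  apply: le_trans hmeet; rewrite natr_sum; apply: ler_sum => u _.
  by rewrite natr_sum.
have hl : (ln k%:R + ln k.+1%:R) / 2 - d <= \sum_C al C * ln #|C|%:R.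
  by rewrite (al_sum (fun C => ln #|C|%:R)) ler_pdivlMr // mulrC.
have dy : d <= y ^+ 2 / 4000 by rewrite ge_min lexx.
have de : d <= eta ^+ 2 / 100 by rewrite ge_min lexx orbT.
have cT : #|'I_q| = q by rewrite card_ord.
have yE : y = #|'I_q|%:R^-1 by rewrite cT.
have [A [gA h1 h2]] := structure k2 cT al_ge0 al1 al0 yE (ltW d0) dy hm hl (ltW eta0) eta1 de.
by exists A; split=> //; rewrite -ler_pdivlMr.
Qed.

Lemma poly_le_exp (e : R) (M : nat) : 0 < e ->
  exists n0 : nat, forall n, (n0 <= n)%N -> n.+1%:R ^+ M <= expR (e * n%:R).
Proof.
move=> e0; have [->|M0] := eqVneq M 0%N.
  exists 0%N => n _; rewrite expr0; apply: le_trans (expR_ge1Dx _).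
  by rewrite lerDl mulr_ge0 // ltW.
(* The exponential is a product of [2 * M] equal factors, and two of them already exceed [n.+1]. *)
pose b := e / (2 * M)%:R.
have b0 : 0 < b by rewrite divr_gt0 // ltr0n muln_gt0 /= lt0n.
have B0 : 0 <= 2 / b ^+ 2 by rewrite divr_ge0 // exprn_ge0 // ltW.
exists (Num.bound (2 / b ^+ 2)) => n nb.
have nr : 2 / b ^+ 2 <= n%:R.
  apply: le_trans (ltW (archi_boundP B0)) _; by rewrite ler_nat.
have -> : e * n%:R = (2 * M)%:R * (b * n%:R).
  by rewrite /b mulrA mulrCA divff ?mulr1 // pnatr_eq0 muln_eq0 negb_or M0.
rewrite expRM_natl exprM; apply: lerXn2r; rewrite ?nnegrE ?ler0n ?exprn_ge0 ?expR_ge0 //.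
have h1 : 1 + b * n%:R <= expR (b * n%:R) by apply: expR_ge1Dx.
have bn : 0 <= b * n%:R by rewrite mulr_ge0 // ltW.
apply: (@le_trans _ _ ((1 + b * n%:R) ^+ 2)); last first.
  by apply: lerXn2r; rewrite ?nnegrE ?expR_ge0 // addr_ge0.
have : 2 * n%:R <= (b * n%:R) ^+ 2.
  rewrite (_ : (b * n%:R) ^+ 2 = n%:R * b ^+ 2 * n%:R); last by ring.
  by rewrite ler_wpM2r // -ler_pdivrMr ?exprn_gt0.
rewrite -natr1; have : 0 <= n%:R :> R by apply: ler0n.
lra.
Qed.

End ListStructure.

Lemma double_le_of_edges (a b e n2 : nat) :
  (a + 2 * e <= n2 + b -> n2 <= 4 * e + 1 -> 2 * a <= n2 + 1 + 2 * b)%N.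
Proof. lia. Qed.

Lemma card_setC_good (k : nat) (A : {set 'I_(k.*2.+1)}) :
  (#|A| == k) || (#|A| == k.+1) -> (#|~: A| == k) || (#|~: A| == k.+1).
Proof.
have -> : #|~: A| = (k.*2.+1 - #|A|)%N by rewrite cardsCs setCK card_ord.
by case/orP => /eqP ->; rewrite -addnn ?subSS ?addnK -?addnS ?addKn eqxx ?orbT.
Qed.

Section Typical.
Variables (R : realType) (k : nat).
Hypothesis k2 : (2 <= k)%N.
Local Notation q := k.*2.+1.

(** [U] and [W] stand for the vertices whose list is [A] or its complement; of the lists, only the
    sizes, colors and sparsity of these two sets are remembered. *)
Definition typical (G : sgraph) (eta : R) (f : {ffun G -> 'I_q}) : bool :=
  [exists A : {set 'I_q}, exists U : {set G}, exists W : {set G},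
    [&& (#|A| == k) || (#|A| == k.+1),
        (1 / 2 - eta) * #|G|%:R <= #|U|%:R, (1 / 2 - eta) * #|G|%:R <= #|W|%:R,
        [forall v in U, f v \in A], [forall v in W, f v \notin A],
        (eb U U)%:R <= eta * #|G|%:R ^+ 2 & (eb W W)%:R <= eta * #|G|%:R ^+ 2]].

Definition half_rate : R := (ln k%:R + ln k.+1%:R) / 2.

(* A list assignment [clist S] admitting too many colorings falls under [list_structure], so that
   its colorings are typical; there are few assignments. *)
Lemma atypical_few (eta : R) : 0 < eta -> eta <= 1 ->
  exists n0 : nat, exists2 c : R, 0 < c & forall G : sgraph, (n0 <= #|G|)%N ->
    (#|G| ^ 2 <= 4 * #|edges G| + 1)%N ->
    #|[set f in colorings G q | ~~ typical eta f]|%:R <= expR (#|G|%:R * (half_rate - c)).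
Proof.
move=> eta0 eta1; have [d d0 LS] := list_structure k2 eta0 eta1.
pose e := Num.min (d / 2) eta.
have e0 : 0 < e by rewrite lt_min eta0 andbT divr_gt0.
have ed : e <= d / 2 by rewrite ge_min lexx.
have ee : e <= eta by rewrite ge_min lexx orbT.
have B0 : 0 <= 2 * q%:R / e by rewrite divr_ge0 ?mulr_ge0 // ltW.
pose m := Num.bound (2 * q%:R / e).
have mB : 2 * q%:R / e < m%:R by apply: archi_boundP.
have m0 : (0 < m)%N by rewrite -(ltr_nat R); apply: le_lt_trans mB.
have [n1 n1P] := @poly_le_exp R (d / 2) (m * q) (divr_gt0 d0 (ltr0n _ 2)).
have d1 : 0 <= 1 / d by rewrite divr_ge0 // ltW.
exists (maxn 1 (maxn m (maxn n1 (Num.bound (1 / d))))); exists (d / 2); first by rewrite divr_gt0.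
move=> G; rewrite !geq_max => /and4P[n_gt0 mn n1n dn] edg.
set n := #|G| in n_gt0 mn n1n dn edg *.
have nR : 1 <= n%:R :> R by rewrite ler1n.
have mR : 0 < m%:R :> R by rewrite ltr0n.
have mnR : m%:R <= n%:R :> R by rewrite ler_nat.
(* This threshold limits fingerprints to [m] vertices, while the containers span only [e * n ^+ 2]
   ordered adjacent pairs. *)
pose t := (n %/ m).+1.
have t_small : (q * (n * t))%:R <= e * n%:R ^+ 2 :> R.
  have tm : m%:R * t%:R <= n%:R + m%:R :> R.
    by rewrite -natrM -natrD ler_nat /t mulnS addnC leq_add2r mulnC leq_divM.
  have qm : 2 * q%:R <= e * m%:R by rewrite -ler_pdivrMl // mulrC ltW.
  have qm2 : 2 * q%:R <= e * n%:R by apply: le_trans qm _; rewrite ler_pM2l.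
  have n0' : 0 <= n%:R :> R by lra.
  rewrite -(ler_pM2l mR) !natrM.
  have -> : m%:R * (q%:R * (n%:R * t%:R)) = q%:R * n%:R * (m%:R * t%:R) :> R by ring.
  have s1 : q%:R * n%:R * (m%:R * t%:R) <= q%:R * n%:R * (n%:R + m%:R) :> R.
    by rewrite ler_wpM2l // mulr_ge0.
  have s2 : n%:R * n%:R * (2 * q%:R) <= n%:R * n%:R * (e * m%:R) by rewrite ler_wpM2l // mulr_ge0.
  have s3 : n%:R * m%:R * (2 * q%:R) <= n%:R * m%:R * (e * n%:R) by rewrite ler_wpM2l // mulr_ge0 // ltW.
  lra.
have dn2 : 1 <= d * n%:R ^+ 2.
  have : 1 <= d * n%:R.
    rewrite -ler_pdivrMl // mulrC; apply: le_trans (ltW (archi_boundP d1)) _.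
    by rewrite ler_nat.
  rewrite expr2 mulrA => h; apply: le_trans h _; rewrite ler_peMr //.
  by rewrite mulr_ge0 // ltW // ltW.
pose L := @clist G q t.
(* The number of these fingerprint tuples is polynomial in [n], of degree [m * q]. *)
pose J := [set S : {ffun 'I_q -> {set G}} | [forall i, (#|S i| <= m)%N] &&
  (#|family (fun v => mem (L S v))|%:R <= expR (n%:R * (half_rate - d)))].
have cover f : f \in [set f in colorings G q | ~~ typical eta f] ->
    exists2 S, S \in J & f \in family (fun v => mem (L S v)).
  rewrite inE => /andP[fc ft].
  have [S Ssmall fS] := @clist_exists G q t f (ltn0Sn _) fc.
  exists S => //; rewrite inE; apply/andP; split.
    apply/forallP => i; have := leq_ltn_trans (Ssmall i) (ltn_ceil n m0).
    by rewrite ltn_mul2l => /andP[_ /ltnW].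
  have fam0 v : L S v != set0.
    by apply/set0Pn; exists (f v); apply: (familyP fS v).
  have Lpos v : 0 < #|L S v|%:R :> R by rewrite ltr0n card_gt0.
  rewrite card_family_prod natr_prod.
  have -> : \prod_v #|L S v|%:R = expR (\sum_v ln #|L S v|%:R) :> R.
    by rewrite expR_sum; apply: eq_bigr => v _; rewrite lnK ?posrE.
  (* Otherwise the lists satisfy the hypotheses of [list_structure], which makes [f] typical. *)
  rewrite ler_expR leNgt; apply/negP => hln.
  have bad : (\sum_u \sum_v (adj u v && (L S u :&: L S v != set0)))%:R <= e * n%:R ^+ 2.
    by apply: le_trans t_small; rewrite ler_nat eb_clist.
  have hmeet : (\sum_u \sum_v (L S u :&: L S v != set0))%:R <= (1 / 2 + d) * n%:R ^+ 2.
    have s1 : (\sum_u \sum_v (L S u :&: L S v != set0) + eb [set: G] [set: G] <=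
        n ^ 2 + \sum_u \sum_v (adj u v && (L S u :&: L S v != set0)))%N.
      have -> : eb [set: G] [set: G] = (\sum_(u : G) \sum_(v : G) adj u v)%N.
        rewrite ebE; apply: eq_big => [u|u _]; first by rewrite inE.
        by apply: eq_bigl => v; rewrite inE.
      have -> : (n ^ 2 = \sum_(u : G) \sum_(v : G) 1)%N.
        by rewrite sum_nat_const sum_nat_const muln1.
      rewrite -!big_split /=; apply: leq_sum => u _.
      rewrite -!big_split /=; apply: leq_sum => v _.
      by case: (adj u v); case: (_ != _).
    have : (2 * (\sum_u \sum_v (L S u :&: L S v != set0)) <=
       n ^ 2 + 1 + 2 * \sum_u \sum_v (adj u v && (L S u :&: L S v != set0)))%N.
      by move: s1; rewrite eb_edges => s1; apply: double_le_of_edges s1 edg.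
    have ed2 : e * n%:R ^+ 2 <= d / 2 * n%:R ^+ 2 by rewrite ler_wpM2r // exprn_ge0.
    rewrite -(ler_nat R) => h2; move: bad h2 dn2 ed2; lra.
  have n_gt0' : (0 < #|G|)%N by [].
  have [A [gA hU hW]] := LS G (L S) n_gt0' fam0 hmeet (ltW hln).
  have inner (C : {set 'I_q}) : C != set0 -> (eb [set v | L S v == C] [set v | L S v == C])%:R <= eta * n%:R ^+ 2.
    move=> C0; apply: (@le_trans _ _ (e * n%:R ^+ 2)); last first.
      by rewrite ler_wpM2r // exprn_ge0.
    apply: le_trans bad; rewrite ler_nat ebE big_mkcond /=; apply: leq_sum => u _.
    rewrite inE; case: eqVneq => // uC; rewrite big_mkcond /=; apply: leq_sum => v _.
    by rewrite inE; case: eqVneq => // vC; rewrite uC vC setIid C0 andbT.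
  have ne (C : {set 'I_q}) : (#|C| == k) || (#|C| == k.+1) -> C != set0.
    by rewrite -card_gt0; case/orP => /eqP -> //; apply: ltnW.
  move/negP: ft; apply; apply/existsP; exists A; apply/existsP; exists [set v | L S v == A].
  apply/existsP; exists [set v | L S v == ~: A].
  rewrite gA hU hW !inner ?ne ?card_setC_good // !andbT /=; apply/andP; split.
    by apply/forallP => v; rewrite inE; apply/implyP => /eqP <-; apply: (familyP fS v).
  apply/forallP => v; rewrite inE; apply/implyP => /eqP h; rewrite -in_setC -h.
  exact: (familyP fS v).
have h1 := card_le_sum cover.
have h2 : (\sum_(S in J) #|family (fun v => mem (L S v))|)%:R <=
    #|J|%:R * expR (n%:R * (half_rate - d)).
  rewrite natr_sum -sum1_card natr_sum mulr_suml; apply: ler_sum => S.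
  by rewrite inE mul1r => /andP[].
apply: (@le_trans _ _ (#|J|%:R * expR (n%:R * (half_rate - d)))).
  by apply: le_trans h2; rewrite ler_nat.
have -> : n%:R * (half_rate - d / 2) = d / 2 * n%:R + n%:R * (half_rate - d) by lra.
rewrite expRD ler_wpM2r ?expR_ge0 //; apply: le_trans (n1P n n1n).
rewrite -natrX ler_nat expnM.
apply: (@leq_trans (#|[set S : {set G} | #|S| <= m]| ^ #|'I_q|)%N); last first.
  by rewrite card_ord leq_exp2r // card_small_sets.
rewrite -card_ffun_on; apply: subset_leq_card; apply/subsetP => S.
rewrite inE => /andP[/forallP h _]; apply/ffun_onP => i; rewrite inE; exact: h.
Qed.

End Typical.

(** In the application [a], [b] are the sizes of the parts of [U] in [V1], [V2], and [c], [d] those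
    of [W]. As [(a + b) * (c + d)] hardly exceeds [n ^+ 2 / 4], the sum [a * c + b * d] is small;
    one of [a * d], [b * c] is large, so both its factors are, and the other two sizes are small. *)
Lemma products_alternative (R : realType) (n eta a b c d : R) :
  0 < n -> 0 < eta -> eta * 1000 <= 1 -> 0 <= a -> 0 <= b -> 0 <= c -> 0 <= d ->
  a <= n -> b <= n -> c <= n -> d <= n ->
  a + b <= (1 / 2 + eta) * n -> c + d <= (1 / 2 + eta) * n ->
  n ^+ 2 / 4 - 40 * eta * n ^+ 2 <= a * d + b * c ->
  (b <= 420 * eta * n /\ c <= 420 * eta * n) \/ (a <= 420 * eta * n /\ d <= 420 * eta * n).
Proof.
move=> n0 e0 e1 a0 b0 c0 d0 an bn cn dn ab cd h.
have nn : 0 < n ^+ 2 by rewrite exprn_gt0.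
have p : (a + b) * (c + d) <= ((1 / 2 + eta) * n) * ((1 / 2 + eta) * n).
  by apply: ler_pM => //; apply: addr_ge0.
have en : eta * eta * n ^+ 2 <= eta * n ^+ 2.
  by rewrite ler_pM2r // ler_piMl //; lra.
have e2 : eta * 1000 * n ^+ 2 <= 1 * n ^+ 2 by rewrite ler_pM2r.
have sm : a * c + b * d <= 42 * eta * n ^+ 2 by lra.
have ac0 := mulr_ge0 a0 c0; have bd0 := mulr_ge0 b0 d0.
have div x z : 0 <= x -> n / 10 <= z -> x * z <= 42 * eta * n ^+ 2 -> x <= 420 * eta * n.
  move=> x0 zn xz; rewrite -(ler_pM2r n0).
  have : x * (n / 10) <= x * z by rewrite ler_wpM2l.
  lra.
have big x z : 0 <= x -> z <= n -> n ^+ 2 / 10 <= x * z -> n / 10 <= x.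
  move=> x0 zn xz; rewrite -(ler_pM2r n0).
  have : x * z <= x * n by rewrite ler_wpM2l.
  lra.
have [ad|ad] := lerP (n ^+ 2 / 10) (a * d); [left | right].
  have ha := big _ _ a0 dn ad; have hd : n / 10 <= d by apply: (big d a) => //; rewrite [d * a]mulrC.
  by split; [apply: (div b d) => // | apply: (div c a) => //]; lra.
have bc : n ^+ 2 / 10 <= b * c by lra.
have hb := big _ _ b0 cn bc; have hc : n / 10 <= c by apply: (big c b) => //; rewrite [c * b]mulrC.
by split; [apply: (div a c) => // | apply: (div d b) => //]; lra.
Qed.

(** * A common cut for all typical colorings *)

Section NearBipartite.
Variables (R : realType) (k : nat).
Hypothesis k2 : (2 <= k)%N.
Local Notation q := k.*2.+1.
Variables (G : sgraph) (eta : R).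
Hypothesis eta0 : 0 < eta.
Hypothesis eta1 : eta * 1000 <= 1.
Hypothesis edg : (#|G| ^ 2 <= 4 * #|edges G| + 1)%N.
Hypothesis big : 2 <= eta * #|G|%:R ^+ 2.
Implicit Types (f : {ffun G -> 'I_q}) (A : {set 'I_q}).

Let n : R := #|G|%:R.

Let n0 : 0 < n.
Proof.
rewrite /n ltr0n lt0n; apply/negP => /eqP e.
by move: big; rewrite e expr0n /= mulr0; lra.
Qed.

Let E (X Y : {set G}) : R := (eb X Y)%:R.
Let c (X : {set G}) : R := #|X|%:R.

Let tot : n ^+ 2 / 2 - eta * n ^+ 2 <= E setT setT.
Proof.
have h : n ^+ 2 <= 2 * E setT setT + 1.
  have : (#|G| ^ 2 <= 2 * eb [set: G] [set: G] + 1)%N by rewrite eb_edges; move: edg; lia.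
  rewrite -(ler_nat R) /n /E; lra.
by move: big; rewrite -/n; move: (n ^+ 2) (E _ _) h => x z h; lra.
Qed.

Definition typical_data f A (U W : {set G}) :=
  [/\ [/\ (#|A| == k) || (#|A| == k.+1), forall v, v \in U -> f v \in A
        & forall v, v \in W -> f v \notin A],
      (1 / 2 - eta) * #|G|%:R <= #|U|%:R, (1 / 2 - eta) * #|G|%:R <= #|W|%:R,
      (eb U U)%:R <= eta * #|G|%:R ^+ 2 & (eb W W)%:R <= eta * #|G|%:R ^+ 2].

Lemma typicalP f : typical eta f -> exists A U W, typical_data f A U W.
Proof.
case/existsP=> A /existsP[U /existsP[W /and5P[gA hU hW fU /and3P[fW eU eW]]]].
exists A, U, W; split=> //; split=> // v vX.
  exact: (forall_inP fU).
exact: (forall_inP fW).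
Qed.

Section Data.
Variables (f : {ffun G -> 'I_q}) (A : {set 'I_q}) (U W : {set G}).
Hypothesis D : typical_data f A U W.
Let X := ~: (U :|: W).

Let UW : [disjoint U & W].
Proof.
case: D => -[_ fU fW] _ _ _ _; rewrite -setI_eq0; apply/eqP/setP => v; rewrite !inE.
by apply/negP => /andP[/fU h /fW]; rewrite h.
Qed.

Let card3 : c U + c W + c X = n.
Proof.
by rewrite /c /n -!natrD -cardsUI (disjoint_setI0 UW) cards0 addn0 cardsC.
Qed.

Lemma typical_sizes : [/\ c X <= 2 * eta * n, c U <= (1 / 2 + eta) * n & c W <= (1 / 2 + eta) * n].
Proof.
case: D => _; rewrite -/n -/(c U) -/(c W) => hU hW _ _; have := card3.
have : 0 <= c X by apply: ler0n.
by split; lra.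
Qed.

Lemma typical_comp_inner : E (~: U) (~: U) <= 5 * eta * n ^+ 2.
Proof.
case: D => _ _ _ _; rewrite -/n -/(E W W) => eW; have [hX _ _] := typical_sizes.
have -> : ~: U = W :|: X.
  apply/setP => v; rewrite !inE negb_or; case vU : (v \in U) => //=.
    by rewrite (disjointFr UW vU).
  by case: (v \in W).
have h : (eb (W :|: X) (W :|: X) <= eb W W + 2 * (#|X| * #|G|))%N.
  apply: leq_trans (eb_setUl _ _ _) _.
  apply: leq_trans (leq_add (eb_setUr _ _ _) (leqnn _)) _.
  rewrite -addnA leq_add2l mul2n -addnn leq_add //.
    by rewrite ebC (leq_trans (eb_le _ _)) // leq_mul2l max_card orbT.
  by rewrite (leq_trans (eb_le _ _)) // leq_mul2l max_card orbT.
have {}h : E (W :|: X) (W :|: X) <= E W W + 2 * (c X * n).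
  by rewrite /E /c /n -!natrM -natrD ler_nat.
have : c X * n <= 2 * eta * n * n by rewrite ler_pM2r.
lra.
Qed.

End Data.

Definition low_deg : {set G} := [set v | (8 * deg_in [set: G] v < #|G|)%N].

(* [(V1, V2)] is a maximum cut outside [low_deg]: it has no more inner edges than the cut given by
   the single typical coloring [f0], and this forces every typical coloring to follow it. *)
Lemma near_bipartite f0 : typical eta f0 -> exists V1 V2 : {set G},
  [/\ [disjoint V1 & V2] /\ V1 :|: V2 = ~: low_deg,
   #|low_deg|%:R <= 30 * eta * #|G|%:R,
   (forall v, v \in V1 -> #|G| <= 32 * deg_in V2 v)%N /\
   (forall v, v \in V2 -> #|G| <= 32 * deg_in V1 v)%N,
   #|V1|%:R <= (1 / 2 + 850 * eta) * #|G|%:R /\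
   #|V2|%:R <= (1 / 2 + 850 * eta) * #|G|%:R &
   forall f, typical eta f -> exists2 A : {set 'I_q}, (#|A| == k) || (#|A| == k.+1) &
     (#|[set v in V1 | f v \notin A]| + #|[set v in V2 | f v \in A]|)%:R
       <= 850 * eta * #|G|%:R].
Proof.
move=> typ0; have [A0 [U0 [W0 D0]]] := typicalP typ0.
pose Z := low_deg; pose S := ~: Z.
have [V1 [V1S cut1 cut2 cutmin]] := max_cut S; set V2 := S :\: V1 in cut1 cut2 cutmin *.
have dV : [disjoint V1 & V2] by rewrite disjoint_sym disjoints_subset subsetDr.
have VS : V1 :|: V2 = S by rewrite -[RHS](setID S V1) (setIidPr V1S).
have [x0 u0 w0] := typical_sizes D0.
have en2 : 0 <= eta * n ^+ 2 by rewrite mulr_ge0 ?exprn_ge0 // ltW.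
have inner : E V1 V1 + E V2 V2 <= 6 * eta * n ^+ 2.
  have hU : E U0 U0 <= eta * n ^+ 2 by case: D0.
  have hW := typical_comp_inner D0.
  have h : E V1 V1 + E V2 V2 <= E U0 U0 + E (~: U0) (~: U0).
    rewrite /E -!natrD ler_nat; apply: leq_trans (cutmin (U0 :&: S) (subsetIr _ _)) _.
    apply: leq_add; apply: eb_subset; rewrite ?subsetIl //.
      by rewrite setDIr setDv setU0 setDE subsetIr.
    by rewrite setDIr setDv setU0 setDE subsetIr.
  lra.
have cS : c V1 + c V2 + c Z = n.
  by rewrite /c /n -!natrD -cardsUI (disjoint_setI0 dV) cards0 addn0 VS addnC cardsC.
(* Deleting [Z] removes at most [#|Z| * n / 4] ordered adjacent pairs. What remains is, up to the
   inner edges, at most [(n - #|Z|) ^+ 2 / 2], which is below [n ^+ 2 / 2] by at least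
   [#|Z| * n / 2]. *)
have Z_small : c Z <= 30 * eta * n.
  have h1 : 8 * E Z setT <= c Z * n.
    rewrite /E /c /n -!natrM ler_nat /eb big_distrr /= -sum_nat_const.
    by apply: leq_sum => v; rewrite inE => /ltnW.
  have h2 : E setT setT <= 2 * E Z setT + E S S.
    by rewrite /E -natrM -natrD ler_nat; apply: eb_remove.
  have h3 : E S S = E V1 V1 + E V2 V2 + 2 * E V1 V2.
    by rewrite /E (eb_split V1S) -/V2 !natrD addr0; lra.
  have h4 : E V1 V2 <= c V1 * c V2 by rewrite /E /c -natrM ler_nat eb_le.
  have h5 : 4 * (c V1 * c V2) <= (n - c Z) ^+ 2.
    have e : n - c Z = c V1 + c V2 by rewrite -cS addrK.
    by rewrite e; have := sqr_ge0 (c V1 - c V2); lra.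
  have z0 : 0 <= c Z by apply: ler0n.
  have zn : c Z <= n by rewrite ler_nat max_card.
  have h6 : c Z * c Z <= c Z * n by rewrite ler_wpM2l.
  rewrite -(ler_pM2r n0); have := tot; have := en2; lra.
(* A vertex outside [Z] has degree at least [n / 8]; apart from the few neighbours in [Z], at least
   half of them are across the maximum cut. *)
have cross (Y Y' : {set G}) v : Y :|: Y' = S -> v \notin Z -> (deg_in Y v <= deg_in Y' v)%N ->
    (#|G| <= 32 * deg_in Y' v)%N.
  move=> YS vZ le; have tri := @deg_in_le3 G Y Y' Z v.
  have {}tri := tri _; rewrite -(ler_nat R) -/n natrM.
  have h1 : n <= 8 * (deg_in [set: G] v)%:R.
    by move: vZ; rewrite inE -leqNgt -(ler_nat R) natrM.
  have h2 : (deg_in [set: G] v)%:R <= 2 * (deg_in Y' v)%:R + c Z.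
    rewrite /c -natrM -natrD ler_nat; apply: leq_trans (tri _) _.
      by rewrite YS setUC setUCr.
    by rewrite leq_add2r mul2n -addnn leq_add2r.
  have h3 : eta * 1000 * n <= 1 * n by rewrite ler_pM2r.
  have h4 : 0 <= (deg_in Y' v)%:R :> R by apply: ler0n.
  lra.
(* Nearly all edges run between [U] and [W], and also between [V1] and [V2], so the two partitions
   nearly agree, in one of two orientations. *)
have main f A U W : typical_data f A U W ->
    [/\ c (U :&: V2) <= 420 * eta * n & c (W :&: V1) <= 420 * eta * n] \/
    [/\ c (U :&: V1) <= 420 * eta * n & c (W :&: V2) <= 420 * eta * n].
  move=> D; have [hX hU hW] := typical_sizes D.
  pose X := ~: (U :|: W).
  have eU : E U U <= eta * n ^+ 2 by case: D.
  have eW : E W W <= eta * n ^+ 2 by case: D.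
  have split2 (Y : {set G}) : (#|Y :&: V1| + #|Y :&: V2| <= #|Y|)%N.
    rewrite -cardsUI [X in (_ + #|pred_of_set X|)%N](_ : _ = set0) ?cards0 ?addn0.
      by apply: subset_leq_card; rewrite -setIUr subsetIl.
    by rewrite setIACA setIid (disjoint_setI0 dV) setI0.
  have le_n (Y : {set G}) : c Y <= n by rewrite ler_nat max_card.
  have h1 : (eb [set: G] [set: G] <= 2 * ((#|Z| + #|X|) * #|G|) + (eb U U + eb W W +
      2 * (eb V1 V1 + eb V2 V2 + (#|U :&: V1| * #|W :&: V2| + #|U :&: V2| * #|W :&: V1|))))%N.
    apply: leq_trans (eb_remove (Z :|: X)) _; apply: leq_add.
      rewrite leq_mul2l /=; apply: leq_trans (eb_le _ _) _.
      rewrite cardsT leq_mul2r; apply/orP; right; exact: leq_card_setU.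
    pose U' := U :&: S; pose W' := W :&: S.
    have sub : ~: (Z :|: X) \subset U' :|: W'.
      by rewrite setCU setCK -setIUl setIC.
    apply: leq_trans (eb_subset sub sub) _.
    apply: (@leq_trans (eb U' U' + eb W' W' + 2 * eb U' W')).
      apply: leq_trans (eb_setUl _ _ _) _.
      apply: leq_trans (leq_add (eb_setUr _ _ _) (eb_setUr _ _ _)) _.
      by rewrite [eb W' U']ebC [(eb U' W' + eb W' W')%N]addnC addnACA mul2n -addnn.
    apply: leq_add; first by apply: leq_add; apply: eb_subset; apply: subsetIl.
    rewrite leq_mul2l /=.
    have spl (Y : {set G}) : Y :&: S = (Y :&: V1) :|: (Y :&: V2) by rewrite -VS setIUr.
    rewrite /U' /W' !spl; apply: leq_trans (eb_setUl _ _ _) _.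
    apply: leq_trans (leq_add (eb_setUr _ _ _) (eb_setUr _ _ _)) _.
    have b1 := @eb_subset G (U :&: V1) V1 (W :&: V1) V1 (subsetIr _ _) (subsetIr _ _).
    have b2 := @eb_subset G (U :&: V2) V2 (W :&: V2) V2 (subsetIr _ _) (subsetIr _ _).
    have b3 := eb_le (U :&: V1) (W :&: V2).
    have b4 := eb_le (U :&: V2) (W :&: V1).
    apply: leq_trans (leq_add (leq_add b1 b3) (leq_add b4 b2)) _.
    by rewrite [(_ + eb V2 V2)%N]addnC addnACA.
  have {}h1 : E setT setT <= 2 * ((c Z + c X) * n) + (E U U + E W W + 2 * (E V1 V1 + E V2 V2 +
      (c (U :&: V1) * c (W :&: V2) + c (U :&: V2) * c (W :&: V1)))).
    by move: h1; rewrite -(ler_nat R) /c /n /E; lra.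
  have h2 : (c Z + c X) * n <= 32 * eta * n * n by rewrite ler_pM2r //; lra.
  have := @products_alternative R n eta (c (U :&: V1)) (c (U :&: V2)) (c (W :&: V1)) (c (W :&: V2)).
  case=> //; try exact: ler0n.
  - by apply: le_trans hU; rewrite /c -natrD ler_nat.
  - by apply: le_trans hW; rewrite /c -natrD ler_nat.
  - by have := tot; lra.
  - by case=> h3 h4; left; split.
  - by case=> h3 h4; right; split.
have part f A U W (Y : {set G}) : typical_data f A U W ->
    c Y <= c (U :&: Y) + c (W :&: Y) + c (~: (U :|: W)).
  move=> D; rewrite /c -!natrD ler_nat.
  apply: (@leq_trans #|(U :&: Y) :|: (W :&: Y) :|: ~: (U :|: W)|).
    apply: subset_leq_card; apply/subsetP => v vY; rewrite !inE vY !andbT.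
    by case: (v \in U); case: (v \in W).
  apply: leq_trans (leq_card_setU _ _) _; rewrite leq_add2r; exact: leq_card_setU.
have capl (X Y : {set G}) : c (X :&: Y) <= c X by rewrite /c ler_nat subset_leq_card // subsetIl.
have ne : 0 < eta * n by rewrite mulr_gt0.
exists V1, V2; split=> //.
- split=> v vV.
    apply: (cross V1 V2) => //; last exact: cut1.
    by have := subsetP V1S v vV; rewrite in_setC.
  apply: (cross V2 V1); [by rewrite setUC | | exact: cut2].
  by move: vV; rewrite in_setD in_setC => /andP[].
- have p1 := part _ _ _ _ V1 D0; have p2 := part _ _ _ _ V2 D0.
  have q1 := capl U0 V1; have q2 := capl U0 V2; have q3 := capl W0 V1; have q4 := capl W0 V2.
  by case: (main _ _ _ _ D0) => -[m1 m2]; split; rewrite -/(c _) -/n; lra.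
move=> f /typicalP[A [U [W D]]]; have [hX _ _] := typical_sizes D.
have [[gA fU fW] _ _ _ _] := D.
have dev (P : pred G) (Y Y' : {set G}) : (forall v, v \in Y' -> ~~ P v) ->
    Y' :|: Y = U :|: W -> forall V0 : {set G},
    (#|[set v in V0 | P v]| <= #|Y :&: V0| + #|~: (U :|: W)|)%N.
  move=> nP YU V0; apply: leq_trans (leq_card_setU _ _); apply: subset_leq_card.
  apply/subsetP => v; rewrite inE => /andP[vV Pv]; rewrite !inE vV andbT.
  have : v \notin Y' by apply: contraTN Pv => /nP.
  move=> vY'; have /setP/(_ v) := YU; rewrite !inE (negPf vY') /= => ->.
  by case: (v \in U); case: (v \in W).
have UW' : W :|: U = U :|: W by rewrite setUC.
have fU1 v : v \in U -> ~~ (f v \notin A) by move/fU => ->.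
have fW1 v : v \in W -> ~~ (f v \in A) by move/fW.
have kA : (#|~: A| == k) || (#|~: A| == k.+1) by apply: card_setC_good.
have fin (a b : nat) (x z : {set G}) : (a <= #|x| + #|~: (U :|: W)|)%N ->
    (b <= #|z| + #|~: (U :|: W)|)%N -> c x <= 420 * eta * n -> c z <= 420 * eta * n ->
    (a + b)%:R <= 850 * eta * n.
  move=> ax bz cx cz.
  have : (a + b <= #|x| + #|z| + 2 * #|~: (U :|: W)|)%N.
    by rewrite mul2n -addnn addnACA leq_add.
  rewrite -(ler_nat R) !natrD addr0 -/(c x) -/(c z) => h; apply: le_trans h _.
  by move: hX; rewrite /c; lra.
case: (main _ _ _ _ D) => -[m1 m2].
  exists A => //; apply: fin m2 m1.
    exact: (dev (fun v => f v \notin A) W U).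
  exact: (dev (fun v => f v \in A) U W).
(* Here [U] follows [V2], so the palette of [V1] is the complement. *)
exists (~: A) => //; apply: fin m1 m2.
  have -> : [set v in V1 | f v \notin ~: A] = [set v in V1 | f v \in A].
    by apply/setP => v; rewrite !inE negbK.
  exact: (dev (fun v => f v \in A) U W).
have -> : [set v in V2 | f v \in ~: A] = [set v in V2 | f v \notin A].
  by apply/setP => v; rewrite !inE.
exact: (dev (fun v => f v \notin A) W U).
Qed.

End NearBipartite.

(** * Asymptotics *)

(** Bernoulli's inequality for [(1 + 1 / k) ^ m], cleared of denominators. *)
Lemma bernoulli_nat (k m : nat) : (k ^ m * (k + m) <= k.+1 ^ m * k)%N.
Proof.
elim: m => [|m IH]; first by rewrite !expn0 addn0.
rewrite !expnS -mulnA [leqRHS](_ : _ = k.+1 * (k.+1 ^ m * k))%N; last by rewrite mulnA.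
apply: leq_trans (leq_mul (leqnn k.+1) IH).
rewrite mulnCA [leqRHS]mulnCA leq_mul2l; apply/orP; right; lia.
Qed.

Lemma ratio_exponent (k q : nat) : (0 < k)%N -> exists C, (2 * q * k ^ C <= k.+1 ^ C)%N.
Proof.
move=> k0; exists (2 * q * k)%N; have := bernoulli_nat k (2 * q * k).
rewrite (_ : k + 2 * q * k = (2 * q + 1) * k)%N; last by rewrite mulnDl mul1n addnC.
rewrite mulnA leq_pmul2r // => h; apply: leq_trans h.
by rewrite mulnC leq_mul2l leq_addr orbT.
Qed.

Section RealBounds.
Variable R : realType.

Lemma natX_expR (x m : nat) : (0 < x)%N -> (x ^ m)%:R = expR (m%:R * ln x%:R) :> R.
Proof. by move=> x0; rewrite expRM_natl lnK ?posrE ?ltr0n // natrX. Qed.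

Lemma ln_nat_le (x : nat) : ln x%:R <= x%:R :> R.
Proof.
have [->|x0] := posnP x; first by rewrite ln0.
by apply/ltW/ln_sublinear; rewrite ltr0n.
Qed.

Lemma ln_ratio_le (M : nat) : (0 < M)%N -> ln M.+1%:R - ln M%:R <= 1 / M%:R :> R.
Proof.
move=> M0; have Mp : 0 < M%:R :> R by rewrite ltr0n.
rewrite -ln_div ?posrE ?ltr0n // -natr1 mulrDl divff ?gt_eqF //.
by apply: le_ln1Dx; apply: lt_trans (divr_gt0 ltr01 Mp); rewrite ltrN10.
Qed.

Lemma deviant_bound (X P B n M J s N W q k : nat) :
  (0 < k)%N -> (0 < q)%N -> (0 < M)%N ->
  (X * k.+1 ^ W <= P * B * (q ^ (J + s) * (k * k.+1) ^ N * k ^ W))%N ->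
  (B * M ^ n <= M.+1 ^ n * M ^ J)%N ->
  X%:R <= P%:R * expR (n%:R / M%:R + J%:R * M%:R + (J + s)%:R * q%:R +
     N%:R * (ln k%:R + ln k.+1%:R) - W%:R * (ln k.+1%:R - ln k%:R)) :> R.
Proof.
move=> k0 q0 M0; rewrite -(ler_nat R) !natrM !natX_expR ?muln_gt0 ?k0 // => hX.
rewrite -(ler_nat R) !natrM !natX_expR // => hB.
have hB' : B%:R <= expR (n%:R / M%:R + J%:R * M%:R) :> R.
  rewrite -(ler_pM2r (expR_gt0 (n%:R * ln M%:R))); apply: le_trans hB _.
  rewrite -!expRD ler_expR.
  have h1 : n%:R * (ln M.+1%:R - ln M%:R) <= n%:R * (1 / M%:R) :> R.
    by rewrite ler_wpM2l // ln_ratio_le.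
  have h2 : J%:R * ln M%:R <= J%:R * M%:R :> R by rewrite ler_wpM2l // ln_nat_le.
  lra.
have hq : expR ((J + s)%:R * ln q%:R) <= expR ((J + s)%:R * q%:R) :> R.
  by rewrite ler_expR ler_wpM2l // ln_nat_le.
rewrite -(ler_pM2r (expR_gt0 (W%:R * ln k.+1%:R))); apply: le_trans hX _.
have -> : ln (k * k.+1)%:R = ln k%:R + ln k.+1%:R :> R.
  by rewrite natrM lnM // posrE ltr0n.
have step : B%:R * (expR ((J + s)%:R * ln q%:R) * expR (N%:R * (ln k%:R + ln k.+1%:R)) *
     expR (W%:R * ln k%:R)) <=
   expR (n%:R / M%:R + J%:R * M%:R) * (expR ((J + s)%:R * q%:R) *
     expR (N%:R * (ln k%:R + ln k.+1%:R)) * expR (W%:R * ln k%:R)) :> R.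
  apply: ler_pM => //; first by rewrite !mulr_ge0 ?expR_ge0.
  by rewrite !ler_wpM2r ?expR_ge0.
rewrite -mulrA -[leRHS]mulrA ler_wpM2l //; apply: le_trans step _.
rewrite -!expRD ler_expR; lra.
Qed.

End RealBounds.

(** Since [k.-1 * k.+1 <= k ^ 2], both error terms are of order [k ^ (2 * h)], exponentially below
    the main terms. *)
Lemma turan_error_nat (k h h' : nat) : (0 < k)%N -> (h <= h' <= h.+1)%N ->
  (k * (k.-1 ^ h * k.+1 ^ h') + k.+1 * (k ^ h * k ^ h') <= k.*2.+1 * k.+1 * k ^ (2 * h))%N.
Proof.
move=> k0 /andP[hh hh1].
have sq (x y : nat) : (x ^ h * y ^ h = (x * y) ^ h)%N by rewrite expnMn.
have up (y : nat) : (0 < y <= k.+1)%N -> (y ^ h' <= y ^ h * k.+1)%N.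
  case/andP=> y0 yk; apply: (@leq_trans (y ^ h.+1)); first by rewrite leq_pexp2l.
  by rewrite expnSr leq_mul2l yk orbT.
have e1 : (k.-1 ^ h * k.+1 ^ h' <= k ^ (2 * h) * k.+1)%N.
  apply: leq_trans (leq_mul (leqnn _) (up k.+1 _)) _; first by rewrite leqnn.
  rewrite mulnA leq_mul2r sq expnM; apply/orP; right.
  have le : (k.-1 * k.+1 <= k ^ 2)%N by rewrite -{2}(prednK k0) -{2}(prednK k0) -mulnn; lia.
  by case: (h) => // h0; rewrite leq_exp2r.
have e2 : (k ^ h * k ^ h' <= k ^ (2 * h) * k.+1)%N.
  apply: leq_trans (leq_mul (leqnn _) (up k _)) _; first by rewrite k0 leqnSn.
  by rewrite mulnA sq expnM mulnn.
apply: leq_trans (leq_add (leq_mul (leqnn k) e1) (leq_mul (leqnn k.+1) e2)) _.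
by rewrite -mulnDl addnS addnn mulnA [leqRHS]mulnAC.
Qed.

Lemma half_bounds (n h h' : nat) : n = (h + h')%N -> (h <= h' <= h.+1)%N ->
  (2 * h <= n)%N /\ (n <= (2 * h).+1)%N.
Proof. by move=> -> /andP[]; lia. Qed.

Section Errors.
Variables (R : realType) (k : nat).
Hypothesis k2 : (2 <= k)%N.
Local Notation q := k.*2.+1.
Local Notation hr := (half_rate R k).
Let k0 : (0 < k)%N. Proof. exact: ltnW. Qed.
Let th : R := ln k.+1%:R - ln k%:R.

Lemma log_gap_gt0 : 0 < th.
Proof. by rewrite subr_gt0 ltr_ln ?posrE ?ltr0n // ltr_nat. Qed.

Lemma half_rate_ge0 : 0 <= hr.
Proof. by rewrite divr_ge0 // addr_ge0 // ln_ge0 // ler1n. Qed.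

(** Each error is at most a polynomial times [expR (n * (hr - c))], whereas the right-hand side is
    at least [expR ((n - 1) * hr)]. The factor [k.+1] matches the surplus of [color_count_bound]. *)
Lemma error_small (c : R) : 0 < c -> c <= th / 64 ->
  exists n0 : nat, forall n, (n0 <= n)%N -> forall h h' : nat, n = (h + h')%N -> (h <= h' <= h.+1)%N ->
  forall Xb XE : nat, Xb%:R <= expR (n%:R * (hr - c)) ->
    XE%:R <= (2 ^ q * (n * q))%:R * expR (n%:R * hr - n%:R * c + th) ->
    (k.+1 * (Xb + XE + 'C(q, k) * (k * (k.-1 ^ h * k.+1 ^ h') + k.+1 * (k ^ h * k ^ h')))
      < k.+1 ^ h * k ^ h')%N.
Proof.
move=> c0 cth; have t0 := log_gap_gt0; have r0 := half_rate_ge0.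
pose K : R := k.+1%:R * (1 + (2 ^ q * q)%:R * expR th + (2 ^ q * (q * k.+1))%:R * expR th).
have K0 : 0 <= K * expR hr by rewrite !mulr_ge0 ?addr_ge0 ?mulr_ge0 ?expR_ge0.
have [n1 n1P] := @poly_le_exp R c 2 c0.
exists (maxn 1 (maxn n1 (Num.bound (K * expR hr)))) => n; rewrite !geq_max => /and3P[n_gt0 nn1 nK].
move=> h h' nE hh Xb XE hXb hXE.
have nR : 1 <= n%:R :> R by rewrite ler1n.
have nK' : K * expR hr <= n%:R by apply: le_trans (ltW (archi_boundP K0)) _; rewrite ler_nat.
have h2 : 2 * h%:R <= n%:R :> R.
  by rewrite -natrM ler_nat; case: (half_bounds nE hh).
have h3 : n%:R - 1 <= 2 * h%:R :> R.
  by rewrite lerBlDr -natrM natr1 ler_nat; case: (half_bounds nE hh).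
pose X := expR (n%:R * hr - n%:R * c).
have X0 : 0 < X by apply: expR_gt0.
have b1 : Xb%:R <= X * n%:R.
  apply: le_trans hXb _; rewrite mulrBr -/X ler_peMr // ltW //.
have b2 : XE%:R <= (2 ^ q * q)%:R * expR th * X * n%:R.
  by apply: le_trans hXE _; rewrite expRD -/X !natrM; lra.
have b3 : ('C(q, k) * (k * (k.-1 ^ h * k.+1 ^ h') + k.+1 * (k ^ h * k ^ h')))%:R <=
    (2 ^ q * (q * k.+1))%:R * expR th * X * n%:R.
  have e : (k ^ (2 * h))%:R <= X * expR th.
    rewrite natX_expR // /X -expRD ler_expR natrM.
    have -> : ln k%:R = hr - th / 2 by rewrite /half_rate /th; lra.
    have p1 : 2 * h%:R * hr <= n%:R * hr by rewrite ler_wpM2r.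
    have p2 : (n%:R - 1) * th <= 2 * h%:R * th by rewrite ler_pM2r.
    have p3 : n%:R * c <= n%:R * (th / 64) by rewrite ler_wpM2l.
    have p4 : 0 <= n%:R * th by rewrite mulr_ge0 // ltW.
    lra.
  have bin : ('C(q, k) <= 2 ^ q)%N.
    rewrite -[X in (_ <= 2 ^ X)%N]card_ord -cardsT -card_powerset -[X in 'C(X, _)](card_ord q).
    by rewrite -card_draws powersetT cardsT; apply: max_card.
  apply: (@le_trans _ _ (2 ^ q * (q * k.+1 * k ^ (2 * h)))%:R).
    by rewrite ler_nat leq_mul // turan_error_nat.
  rewrite mulnA natrM; set P := (2 ^ q * _)%:R.
  have P0 : 0 <= P by apply: ler0n.
  apply: le_trans (ler_wpM2l P0 e) _.
  have : P * (X * expR th) * 1 <= P * (X * expR th) * n%:R.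
    by rewrite ler_wpM2l // !mulr_ge0 ?expR_ge0.
  lra.
have tgt : expR (n%:R * hr - hr) <= (k.+1 ^ h * k ^ h')%:R.
  apply: (@le_trans _ _ (k.+1 ^ h * k ^ h)%:R); last first.
    by rewrite ler_nat leq_mul2l leq_pexp2l ?orbT //; case/andP: hh.
  rewrite natrM !natX_expR // -expRD ler_expR.
  have -> : h%:R * ln k.+1%:R + h%:R * ln k%:R = 2 * h%:R * hr by rewrite /half_rate; lra.
  have : (n%:R - 1) * hr <= 2 * h%:R * hr by rewrite ler_wpM2r.
  lra.
rewrite -(ltr_nat R); apply: lt_le_trans tgt.
apply: (@le_lt_trans _ _ (K * X * n%:R)).
  rewrite natrM !natrD /K -mulrA -mulrA ler_pM2l ?ltr0n //; lra.
have -> : n%:R * hr - hr = (n%:R * hr - n%:R * c) + (- hr + n%:R * c) by lra.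
rewrite expRD -/X [K * X]mulrC -mulrA ltr_pM2l // expRD expRN -ltr_pdivrMl ?invr_gt0 ?expR_gt0 //.
rewrite invrK [n%:R * c]mulrC; apply: lt_le_trans (n1P n nn1).
have p1 : K * expR hr * n%:R <= n%:R * n%:R by rewrite ler_wpM2r.
rewrite -natr1; lra.
Qed.

End Errors.

(** In the application [K] is [k.+1], [N] the number of palettes of size [k], and [N * e] the error
    in the lower bound on [P]; the surplus [N * t] left by the main colorings [XM] exceeds [K] times
    all errors. *)
Lemma compare_counts (K N X Xb XE XM S t e P : nat) : (0 < N)%N -> (t <= S)%N ->
  (K * (Xb + XE + N * e) < t)%N -> (N * S <= P + N * e)%N ->
  (K * XM + N * t <= K * (N * S))%N -> (X <= Xb + XE + XM)%N -> (0 < K)%N -> (X < P)%N.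
Proof.
move=> N0 tS small PS main cover K0.
have tN : (t <= N * t)%N by rewrite leq_pmull.
have := leq_mul (leqnn K) PS; have := leq_mul (leqnn K) cover.
rewrite -(ltn_pmul2l K0); move: small main; rewrite !mulnDr; lia.
Qed.

Lemma add_mul_cancel (B K X F S T Y : nat) : (0 < F)%N -> (X * F <= B * Y)%N ->
  (Y * K + T * F <= K * F * S)%N -> (K * X + B * T <= K * (B * S))%N.
Proof.
move=> F0 /(leq_mul (leqnn K)) h1 /(leq_mul (leqnn B)) h2; rewrite -(leq_pmul2r F0).
have -> : ((K * X + B * T) * F = K * (X * F) + B * (T * F))%N by ring.
have -> : (K * (B * S) * F = B * (K * F * S))%N by ring.
by apply: leq_trans h2; rewrite mulnDr leq_add2r (_ : B * (Y * K) = K * (B * Y))%N //; ring.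
Qed.

Lemma balanced_product (h h' : nat) : (h <= h' <= h.+1)%N -> ((h + h') ^ 2 <= 4 * (h * h') + 1)%N.
Proof.
rewrite leq_eqVlt => /andP[/orP[/eqP <- _|h1 h2]].
  by rewrite addnn -mul2n expnMn -mulnn leq_addr.
have -> : h' = h.+1 by apply/eqP; rewrite eqn_leq h1 h2.
by rewrite -mulnn; lia.
Qed.

(** The lost colors gain about [n * th / 32]. The choices of the deviant set, the free vertices and
    the imbalance cost two portions of [n * th / 128], which leaves [n * th / 64]. *)
Lemma deviant_exponent (R : realFieldType) (n M J s N W q hr th eta c : R) :
  0 <= n -> 0 <= M -> 0 <= q -> 0 <= hr -> 0 < th -> 128 / th <= M ->
  J <= 850 * eta * n -> s <= 30 * eta * n -> N <= (1 / 2 + 850 * eta) * n ->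
  n / 32 - 1 - J <= W -> c <= th / 64 ->
  eta * (850 * M + 880 * q + 1700 * hr + 850 * th) <= th / 128 ->
  n / M + J * M + (J + s) * q + N * (2 * hr) - W * th <= n * hr - n * c + th.
Proof.
move=> n0 M0 q0 r0 t0 MB hJ hs hN hW hc hQ.
have p1 : n / M <= n * (th / 128).
  rewrite ler_wpM2l // -[leRHS]invrK lef_pV2 ?posrE ?invr_gt0 ?divr_gt0 //; first by rewrite invf_div.
  by apply: lt_le_trans MB; rewrite divr_gt0.
have p2 : J * M <= 850 * eta * n * M by rewrite ler_wpM2r.
have p3 : (J + s) * q <= (880 * eta * n) * q by rewrite ler_wpM2r //; lra.
have p4 : N * (2 * hr) <= (1 / 2 + 850 * eta) * n * (2 * hr) by rewrite ler_wpM2r // mulr_ge0.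
have p5 : (n / 32 - 1 - 850 * eta * n) * th <= W * th by rewrite ler_pM2r //; lra.
have p6 : n * c <= n * (th / 64) by rewrite ler_wpM2l.
have p7 : n * (eta * (850 * M + 880 * q + 1700 * hr + 850 * th)) <= n * (th / 128) by rewrite ler_wpM2l.
clear -p1 p2 p3 p4 p5 p6 p7; lra.
Qed.

Lemma small_multiple (R : realFieldType) (eta : R) (C n s : nat) :
  eta * (240 * (C * C)%:R) <= 1 -> eta * 1000 <= 1 -> s%:R <= 30 * eta * n%:R ->
  (4 * s <= n)%N /\ (8 * (C * C) * s <= n)%N.
Proof.
move=> hC h1 hs; have n0 : 0 <= n%:R :> R by [].
split; rewrite -(ler_nat R) natrM.
  have : n%:R * (eta * 1000) <= n%:R * 1 by rewrite ler_wpM2l.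
  lra.
have CC0 : 0 <= (C * C)%:R :> R by [].
have h2 : n%:R * (eta * (240 * (C * C)%:R)) <= n%:R * 1 by rewrite ler_wpM2l.
have h3 : (C * C)%:R * s%:R <= (C * C)%:R * (30 * eta * n%:R) by rewrite ler_wpM2l.
rewrite natrM; lra.
Qed.

(** * Comparison with the Turan graph *)

Section Extremal.
Variables (R : realType) (k : nat).
Hypothesis k2 : (2 <= k)%N.
Local Notation q := k.*2.+1.
Local Notation hr := (half_rate R k).
Let k0 : (0 < k)%N. Proof. exact: ltnW. Qed.
Let th : R := ln k.+1%:R - ln k%:R.

Section Main.
Variables (G : sgraph) (n h h' C : nat) (Z V1 V2 : {set G}).
Hypothesis Gn : #|G| = n.
Hypothesis nE : n = (h + h')%N.
Hypothesis hh : (h <= h' <= h.+1)%N.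
Hypothesis edg : #|edges G| = (h * h')%N.
Hypothesis dV : [disjoint V1 & V2].
Hypothesis VZ : V1 :|: V2 = ~: Z.
Hypothesis Zdeg : forall v, v \in Z -> (8 * deg_in [set: G] v < #|G|)%N.
Hypothesis qC : (2 * q * k ^ C <= k.+1 ^ C)%N.
Hypothesis Cs : (8 * (C * C) * #|Z| <= n)%N.
Hypothesis s4 : (4 * #|Z| <= n)%N.
Hypothesis not_bip : Z = set0 -> eb V1 V1 + eb V2 V2 = 0%N -> False.

Lemma main_bound :
  (k.+1 * #|[set g in colorings G q | [exists A, good A && respects V1 V2 A g]]| +
     'C(q, k) * (k.+1 ^ h * k ^ h') <=
   k.+1 * ('C(q, k) * (k.+1 ^ h * k ^ h' + k ^ h * k.+1 ^ h')))%N.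
Proof.
have [f [f1 f2 f3]] := main_count k dV VZ.
have cS : (#|V1| + #|V2| + #|Z| = n)%N.
  by rewrite -Gn -cardsUI (disjoint_setI0 dV) cards0 addn0 VZ addnC cardsC.
(* At most [#|Z| * n / 8] edges touch [Z]. *)
have tot : (8 * (h * h') <= 4 * (eb V1 V1 + eb V2 V2) + #|Z| * n + 8 * (#|V1| * #|V2|))%N.
  have e1 := eb_remove Z; rewrite eb_edges edg -VZ in e1.
  have e2 : (8 * eb Z [set: G] <= #|Z| * n)%N.
    rewrite /eb big_distrr /= -sum_nat_const -Gn; apply: leq_sum => v /Zdeg /ltnW; exact.
  have e3 := eb_le V1 V2.
  rewrite (eb_disjUl _ dV) !(eb_disjUr _ dV) [eb V2 V1]ebC in e1.
  by move: e1 e2 e3; clear; lia.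
have f0 : #|Z| = 0%N -> (0 < f)%N.
  move=> /cards0_eq Z0; apply: f2; rewrite lt0n; apply/negP => /eqP; exact: not_bip.
have num : (q ^ #|Z| * (k ^ #|V1| * k.+1 ^ #|V2| + k.+1 ^ #|V1| * k ^ #|V2|) * k ^ f * k.+1 +
    k.+1 ^ h * k ^ h' * k.+1 ^ f <=
    k.+1 ^ f.+1 * (k.+1 ^ h * k ^ h' + k ^ h * k.+1 ^ h'))%N.
  case/orP: (leq_total #|V1| #|V2|) => le12.
    exact: (color_count_bound k0 nE hh cS le12 qC Cs s4 f1 f0 tot).
  have -> : (k ^ #|V1| * k.+1 ^ #|V2| + k.+1 ^ #|V1| * k ^ #|V2| =
     k ^ #|V2| * k.+1 ^ #|V1| + k.+1 ^ #|V2| * k ^ #|V1|)%N.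
    by rewrite addnC [(k ^ #|V2| * _)%N]mulnC [(k.+1 ^ #|V2| * _)%N]mulnC.
  rewrite [(#|V1| * #|V2|)%N]mulnC in tot; rewrite [(#|V1| + #|V2|)%N]addnC in cS.
  exact: (color_count_bound k0 nE hh cS le12 qC Cs s4 f1 f0 tot).
by rewrite expnS in num; apply: (add_mul_cancel _ f3 num); rewrite expn_gt0.
Qed.

End Main.

Section Deviation.
Variables (G : sgraph) (n : nat) (eta c : R) (M : nat) (Z V1 V2 : {set G}).
Hypothesis Gn : #|G| = n.
Hypothesis M0 : (0 < M)%N.
Hypothesis MB : 128 / th <= M%:R.
Hypothesis cth : c <= th / 64.
Hypothesis etaQ : eta * (850 * M%:R + 880 * q%:R + 1700 * hr + 850 * th) <= th / 128.
Hypothesis dV : [disjoint V1 & V2].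
Hypothesis VZ : V1 :|: V2 = ~: Z.
Hypothesis Zs : #|Z|%:R <= 30 * eta * n%:R.
Hypothesis cr1 : forall v, v \in V1 -> (n <= 32 * deg_in V2 v)%N.
Hypothesis cr2 : forall v, v \in V2 -> (n <= 32 * deg_in V1 v)%N.
Hypothesis v1 : #|V1|%:R <= (1 / 2 + 850 * eta) * n%:R.
Hypothesis v2 : #|V2|%:R <= (1 / 2 + 850 * eta) * n%:R.

Lemma deviant_few (J : nat) : J%:R <= 850 * eta * n%:R ->
  #|[set f in colorings G q | [exists A,
     [&& good A, deviants V1 V2 A f != set0 & (#|deviants V1 V2 A f| <= J)%N]]]|%:R <=
  (2 ^ q * (n * q))%:R * expR (n%:R * hr - n%:R * c + th).
Proof.
move=> JR; pose w := (n %/ 32)%N.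
have w1 v : v \in V1 -> (w <= deg_in V2 v)%N.
  by move=> /cr1 h; rewrite -(mulKn (deg_in V2 v) (isT : 0 < 32)%N) leq_div2r.
have w2 v : v \in V2 -> (w <= deg_in V1 v)%N.
  by move=> /cr2 h; rewrite -(mulKn (deg_in V1 v) (isT : 0 < 32)%N) leq_div2r.
have NR : (maxn #|V1| #|V2|)%:R <= (1 / 2 + 850 * eta) * n%:R by rewrite /maxn; case: ifP.
have count := deviant_count k0 dV VZ J w1 w2 (leq_maxl _ _) (leq_maxr #|V1| #|V2|).
have small := card_small_sets_exp G J M0.
rewrite Gn [(2 ^ q * _ * (n * q))%N]mulnAC in count; rewrite Gn in small.
apply: le_trans (deviant_bound R k0 (ltn0Sn _) M0 count small) _.
rewrite ler_wpM2l // ler_expR.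
have -> : ln k%:R + ln k.+1%:R = 2 * hr by rewrite /half_rate; lra.
rewrite [(J + _)%:R]natrD; apply: (deviant_exponent _ _ _ _ _ MB JR Zs NR _ cth etaQ) => //.
- exact: half_rate_ge0.
- exact: log_gap_gt0.
have le1 : (n <= 32 * (w - J + J + 1))%N.
  apply: ltnW; apply: (@leq_trans (32 * w.+1)); first by rewrite mulnC ltn_ceil.
  by rewrite leq_mul2l addn1 ltnS addnC -leq_subLR leqnn.
move: le1; rewrite -(ler_nat R) natrM !natrD; lra.
Qed.

End Deviation.

Lemma extremal : exists n0 : nat, forall n, (n0 <= n)%N ->
  forall G : sgraph, #|G| = n -> #|edges G| = #|edges (turan2 n)| ->
    ~ isomorphic G (turan2 n) -> (num_colorings G q < num_colorings (turan2 n) q)%N.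
Proof.
have t0 : 0 < th := log_gap_gt0 R k2; have r0 := half_rate_ge0 R k2.
have [C qC] := ratio_exponent q k0.
have B0 : 0 <= 128 / th by rewrite divr_ge0 // ltW.
pose M := (Num.bound (128 / th)).+1.
have MB : 128 / th <= M%:R.
  by apply: le_trans (ltW (archi_boundP B0)) _; rewrite ler_nat leqnSn.
pose Q : R := 850 * M%:R + 880 * q%:R + 1700 * hr + 850 * th.
have Q0 : 0 <= Q by rewrite /Q !addr_ge0 // mulr_ge0 // ltW.
(* The inverse [eta] meets three demands at once, one per summand: [eta <= 1 / 1000], the bounds of
   [small_multiple], and that of [deviant_exponent]. *)
pose D : R := 1000 + 240 * (C * C)%:R + 128 / th * Q.
have CC0 : 0 <= (C * C)%:R :> R by apply: ler0n.
have BQ0 : 0 <= 128 / th * Q by rewrite mulr_ge0.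
have D0 : 1000 <= D by rewrite /D; lra.
pose eta := D^-1; have eta0 : 0 < eta by rewrite invr_gt0; lra.
have etaD : eta * D = 1 by rewrite mulVf // gt_eqF //; lra.
have etaB x : x <= D -> eta * x <= 1 by move=> xD; rewrite -etaD ler_pM2l.
have eta1 : eta * 1000 <= 1 by apply: etaB.
have etaC : eta * (240 * (C * C)%:R) <= 1 by apply: etaB; rewrite /D; lra.
have etaQ : eta * Q <= th / 128.
  have : eta * (128 / th * Q) <= 1 by apply: etaB; rewrite /D; lra.
  rewrite -(ler_pM2l (divr_gt0 t0 (ltr0n R 128))).
  have -> : th / 128 * (eta * (128 / th * Q)) = eta * Q by field; rewrite gt_eqF.
  by rewrite mulr1.
have etale1 : eta <= 1 by lra.
have [n1 [c1 c10 atyp]] := atypical_few k2 eta0 etale1.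
pose c := Num.min c1 (th / 64).
have c0 : 0 < c by rewrite lt_min c10 divr_gt0.
have cc1 : c <= c1 by rewrite ge_min lexx.
have cth : c <= th / 64 by rewrite ge_min lexx orbT.
have [n2 errP] := error_small k2 c0 cth.
have E0 : 0 <= 2 / eta by rewrite divr_ge0 // ltW.
exists (maxn 1 (maxn n1 (maxn n2 (Num.bound (2 / eta))))) => n.
rewrite !geq_max => /and4P[n_gt0 nn1 nn2 nE2] G Gn eG niso.
pose h := n./2; pose h' := uphalf n.
have nE : n = (h + h')%N by rewrite /h /h' addnC uphalf_half -addnA addnn odd_double_half.
have hh : (h <= h' <= h.+1)%N by rewrite /h /h' uphalf_half leq_addl -add1n leq_add2r leq_b1.
have edgE : #|edges G| = (h * h')%N by rewrite eG turan2_edges.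
have edg : (#|G| ^ 2 <= 4 * #|edges G| + 1)%N.
  by rewrite edgE Gn nE balanced_product.
have nR : 1 <= n%:R :> R by rewrite ler1n.
have big : 2 <= eta * #|G|%:R ^+ 2.
  have : 2 <= eta * n%:R.
    rewrite -ler_pdivrMl // mulrC; apply: le_trans (ltW (archi_boundP E0)) _.
    by rewrite ler_nat.
  by rewrite Gn => h1; apply: le_trans h1 _; rewrite ler_pM2l // expr2 ler_peMr //; lra.
pose Xb := #|[set f in colorings G q | ~~ typical eta f]|.
have hXb : Xb%:R <= expR (n%:R * (hr - c)).
  have := atyp G; rewrite Gn => /(_ nn1); rewrite -{1}Gn => /(_ edg) h1.
  apply: le_trans h1 _; rewrite ler_expR ler_wpM2l //; lra.
have low := @bipartite_lower k h h'.
have bin0 : (0 < 'C(q, k))%N by rewrite bin_gt0 -addnn ltnW // ltnS leq_addr.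
have tS : (k.+1 ^ h * k ^ h' <= k ^ h * k.+1 ^ h' + k.+1 ^ h * k ^ h')%N by apply: leq_addl.
(* Without any typical coloring, the atypical ones are all, and their bound alone suffices. *)
have [f0 /andP[f0c typ0]|no] := pickP [pred f in colorings G q | typical eta f]; last first.
  apply: (@compare_counts k.+1 'C(q, k) _ Xb 0 0 _ _ _ _ bin0 tS _ low) => //.
  - by apply: errP nE hh _ _ hXb _ => //; rewrite mulr_ge0 ?expR_ge0.
  - rewrite muln0 add0n; apply: leq_trans (leq_mul (leqnn _) tS) _; exact: leq_pmull.
  rewrite !addn0; apply: subset_leq_card; apply/subsetP => f fc; rewrite inE fc /=.
  by have := no f; rewrite /= fc /= => ->.
have [V1 [V2 [[dV VZ] Zs [cr1 cr2] [v1 v2] devP]]] := near_bipartite k2 eta0 eta1 edg big typ0.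
pose J := Num.truncn (850 * eta * n%:R).
rewrite Gn in Zs cr1 cr2 v1 v2 devP.
have J0 : 0 <= 850 * eta * n%:R by rewrite !mulr_ge0 // ltW.
have JR : (J%:R <= 850 * eta * n%:R) by rewrite truncn_le.
have hXE := deviant_few Gn (ltn0Sn _ : (0 < M)%N) MB cth etaQ dV VZ Zs cr1 cr2 v1 v2 JR.
have Zd v : v \in low_deg G -> (8 * deg_in [set: G] v < #|G|)%N by rewrite inE.
have [s4 Cs] := small_multiple etaC eta1 Zs.
have notb : low_deg G = set0 -> eb V1 V1 + eb V2 V2 = 0%N -> False.
  move=> Z0 e; apply: niso; move/eqP: e; rewrite addn_eq0 => /andP[/eqP e1 /eqP e2].
  by apply: (iso_turan2 dV _ e1 e2 Gn eG); rewrite VZ Z0 setC0.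
have XM := main_bound Gn nE hh edgE dV VZ Zd qC Cs s4 notb.
rewrite [(k.+1 ^ h * k ^ h' + k ^ h * _)%N]addnC in XM.
apply: (compare_counts bin0 tS (errP n nn2 h h' nE hh Xb _ hXb hXE) low XM) => //.
(* Every coloring is atypical, or has between 1 and [J] deviants for some good palette, or follows
   the cut exactly. *)
apply: leq_trans (leq_trans (leq_card_setU _ _) (leq_add (leq_card_setU _ _) (leqnn _))).
apply: subset_leq_card; apply/subsetP => f fc; rewrite !in_setU.
have memE P : (f \in [set g in colorings G q | P g]) = P f by rewrite inE fc.
rewrite !memE.
case typ : (typical eta f) => //=; have [A gA dev] := devP f typ.
have DJ : (#|deviants V1 V2 A f| <= J)%N.
  by rewrite truncn_ge_nat //; apply: le_trans dev; rewrite ler_nat leq_card_setU.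
have [D0'|Dn0] := eqVneq (deviants V1 V2 A f) set0.
  apply/orP; right; apply/existsP; exists A; apply/andP; split=> //.
  by rewrite -deviants0 // D0'.
by apply/orP; left; apply/existsP; exists A; apply/and3P; split.
Qed.

End Extremal.

Local Close Scope ring_scope.

Theorem theorem1 (q : nat) (hq5 : 5 <= q) (hqodd : odd q) :
  exists n0 : nat, forall n : nat, n0 <= n ->
    forall G : sgraph, #|G| = n -> #|edges G| = #|edges (turan2 n)| ->
      ~ isomorphic G (turan2 n) ->
      num_colorings G q < num_colorings (turan2 n) q.
Proof.
have -> : q = q./2.*2.+1 by rewrite -[LHS]odd_double_half hqodd.
exact: (extremal Rdefinitions.R (half_leq hq5)).
Qed.
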